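(* Let $p\ge 2$ be an integer and let $\alpha>0$, $\beta>0$ be real numbers. If $$\min(4\beta,1)\,(p-1)p\,\alpha<1,$$ then $$\lim_{N\to\infty}F_N=\inf_{\zeta\in\Pr[-1,1]}\mathcal{P}(\zeta),$$ where $F_N$ is the free energy of the random $p$-sat model with connectivity parameter $\alpha$ and inverse temperature $\beta$, and $\mathcal{P}$ is the replica symmetric functional, both defined in the context.
   Context: Let $(J_i)_{1\le i\le p}$ be independent random signs, $\mathbb{P}(J_i=\pm1)=1/2$, and define the random function on $[-1,1]^p$ $$\theta(\sigma_1,\ldots,\sigma_p)=\log\Bigl(1+(e^{-\beta}-1)\prod_{1\le i\le p}\frac{1+J_i\sigma_i}{2}\Bigr).$$ On $\{-1,1\}^p$ it coincides with $-\beta\prod_{1\le i\le p}\frac{1+J_i\sigma_i}{2}$. Let $(\theta_k)_{k\ge1}$ be independent copies of $\theta$ (defined with independent copies of $(J_i)_{i\le p}$). The Hamiltonian $H_N$ on $\Sigma_N=\{-1,1\}^N$ is given by $$-H_N(\sigma)=\sum_{k\le \pi(\alpha N)}\theta_k(\sigma_{i_{1,k}},\ldots,\sigma_{i_{p,k}}),$$ where $\pi(\alpha N)$ is a Poisson random variable with mean $\alpha N$, the indices $(i_{j,k})_{j,k\ge1}$ are i.i.d. uniform on $\{1,\ldots,N\}$, and $\pi(\alpha N)$, $(i_{j,k})$, $(\theta_k)$ are independent of each other. The free energy is $$F_N=\frac1N\,\mathbb{E}\log\sum_{\sigma\in\Sigma_N}\exp(-H_N(\sigma)).$$ $\Pr[-1,1]$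 denotes the set of (Borel) probability measures on $[-1,1]$. For $\zeta\in\Pr[-1,1]$, let $(z_i)_{i\ge1}$ and $(z_{i,j})_{i,j\ge1}$ be i.i.d. random variables with distribution $\zeta$, and set $$\mathcal{P}(\zeta)=\log2+\mathbb{E}\log \mathrm{Av}\exp\sum_{k\le\pi(\alpha p)}\theta_k(z_{1,k},\ldots,z_{p-1,k},\varepsilon)-(p-1)\alpha\,\mathbb{E}\,\theta(z_1,\ldots,z_p),$$ where $\pi(\alpha p)$ is a Poisson random variable with mean $\alpha p$ independent of everything else and $\mathrm{Av}$ denotes the uniform average over $\varepsilon\in\{-1,1\}$. The $z$'s are independent of the functions $\theta,\theta_k$. *)

(* Defs.v *)
From HB Require Import structures.
From mathcomp Require Import all_boot all_order all_algebra.
From mathcomp Require Import all_classical all_reals all_analysis.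

Set Implicit Arguments.
Unset Strict Implicit.
Unset Printing Implicit Defensive.
Import Order.TTheory GRing.Theory Num.Theory.
Import numFieldNormedType.Exports.
Local Open Scope classical_set_scope.
Local Open Scope ring_scope.

(* The nonempty finite sets {0, ..., n} carry the discrete sigma-algebra, as
   nat and bool do in the library. *)
HB.instance Definition _ (n : nat) := isPointed.Build 'I_n.+1 ord0.
HB.instance Definition _ (n : nat) :=
  @isMeasurable.Build default_measure_display 'I_n.+1
    discrete_measurable discrete_measurable0
    discrete_measurableC discrete_measurableU.

(* Mutual independence of an arbitrary family of classes of events: the product
   rule for every finite subfamily, a subfamily being enumerated without
   repetition by s. For random variables X i, take F i to be the sigma-algebra
   generated by X i; the X i may then have different codomains. *)
Definition mutually_independent (d : measure_display) (T : measurableType d)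
    (R : realType) (P : probability T R) (I : Type) (F : I -> set (set T)) :=
  forall (n : nat) (s : 'I_n -> I), injective s ->
  forall A : 'I_n -> set T, (forall k, F (s k) (A k)) ->
  P (\bigcap_k A k) = (\prod_(k < n) P (A k))%E.

Definition spin (R : realType) (b : bool) : R := if b then 1 else -1.

Section laws.
Context {d : measure_display} {T : measurableType d} {R : realType}.
Context {P : probability T R}.

Definition has_poisson_law (rate : R) (X : {RV P >-> nat}) :=
  forall k, distribution P X [set k] = (poisson_pmf rate k)%:E.

Definition has_uniform_law (n : nat) (X : {RV P >-> 'I_n.+1}) :=
  forall i, distribution P X [set i] = (n.+1%:R^-1)%:E.

Definition is_random_sign (X : {RV P >-> R}) :=
  distribution P X [set 1] = (2^-1)%:E /\
  distribution P X [set -1] = (2^-1)%:E.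

Definition has_law (zeta : probability R R) (X : {RV P >-> R}) :=
  forall A, measurable A -> distribution P X A = zeta A.

End laws.

(* The value theta(x_1, ..., x_p) for the realization J_1, ..., J_p of the
   signs. *)
Definition theta (R : realType) (p : nat) (beta : R) (J x : 'I_p -> R) : R :=
  ln (1 + (expR (- beta) - 1) * \prod_(i < p) ((1 + J i * x i) / 2)).

Variant sat_label (p : nat) : Type :=
| SatCount
| SatIndex of nat & 'I_p
| SatSign of nat & 'I_p.

(* A probability space carrying the randomness of the Hamiltonian on N = n.+1
   spins. Clauses and coordinates are numbered from 0. *)
Record sat_disorder (R : realType) (p n : nat) (alpha : R) : Type := SatDisorder {
  sat_display : measure_display;
  sat_space : measurableType sat_display;
  sat_prob : probability sat_space R;
  sat_count : {RV sat_prob >-> nat};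
  sat_index : nat -> 'I_p -> {RV sat_prob >-> 'I_n.+1};
  sat_sign : nat -> 'I_p -> {RV sat_prob >-> R};
  sat_countP : has_poisson_law (alpha * n.+1%:R) sat_count;
  sat_indexP : forall k j, has_uniform_law (sat_index k j);
  sat_signP : forall k j, is_random_sign (sat_sign k j);
  sat_indep : mutually_independent sat_prob (fun l : sat_label p =>
    match l with
    | SatCount => g_sigma_algebra_preimage sat_count
    | SatIndex k j => g_sigma_algebra_preimage (sat_index k j)
    | SatSign k j => g_sigma_algebra_preimage (sat_sign k j)
    end)
}.

Section free_energy.
Context {R : realType} {p n : nat} {alpha : R}.
Variables (beta : R) (X : sat_disorder p n alpha).

Definition hamiltonian (w : sat_space X) (s : {ffun 'I_n.+1 -> bool}) : R :=
  - \sum_(k < sat_count X w)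
      theta beta (fun j => sat_sign X k j w)
                 (fun j => spin R (s (sat_index X k j w))).

Definition free_energy : \bar R :=
  ((n.+1%:R^-1)%:E *
   'E_(sat_prob X)[fun w => ln (\sum_(s : {ffun 'I_n.+1 -> bool})
                                  expR (- hamiltonian w s))])%E.

End free_energy.

(* Pr[-1,1], as the Borel probability measures on the line carried by [-1,1]. *)
Definition pr_itv (R : realType) : Type :=
  {zeta : probability R R | zeta `[-1, 1]%classic = 1%E}.

Variant rs_label (p : nat) : Type :=
| RSCount
| RSSigns of nat & 'I_p
| RSPoints of nat & 'I_p
| RSSign of 'I_p
| RSPoint of 'I_p.

(* A probability space carrying the randomness of the replica symmetric
   functional at zeta: the Poisson variable, the signs of the theta_k, the
   points z_{j,k} (here rs_points k j), the signs of theta and the points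
   z_j. *)
Record rs_disorder (R : realType) (p : nat) (alpha : R)
    (zeta : probability R R) : Type := RSDisorder {
  rs_display : measure_display;
  rs_space : measurableType rs_display;
  rs_prob : probability rs_space R;
  rs_count : {RV rs_prob >-> nat};
  rs_signs : nat -> 'I_p -> {RV rs_prob >-> R};
  rs_points : nat -> 'I_p -> {RV rs_prob >-> R};
  rs_sign : 'I_p -> {RV rs_prob >-> R};
  rs_point : 'I_p -> {RV rs_prob >-> R};
  rs_countP : has_poisson_law (alpha * p%:R) rs_count;
  rs_signsP : forall k j, is_random_sign (rs_signs k j);
  rs_pointsP : forall k j, has_law zeta (rs_points k j);
  rs_signP : forall j, is_random_sign (rs_sign j);
  rs_pointP : forall j, has_law zeta (rs_point j);
  rs_indep : mutually_independent rs_prob (fun l : rs_label p =>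
    match l with
    | RSCount => g_sigma_algebra_preimage rs_count
    | RSSigns k j => g_sigma_algebra_preimage (rs_signs k j)
    | RSPoints k j => g_sigma_algebra_preimage (rs_points k j)
    | RSSign j => g_sigma_algebra_preimage (rs_sign j)
    | RSPoint j => g_sigma_algebra_preimage (rs_point j)
    end)
}.

Section rs_functional.
Context {R : realType} {p : nat} {alpha : R} {zeta : probability R R}.
Variables (beta : R) (Y : rs_disorder p alpha zeta).

(* theta_k(z_{1,k}, ..., z_{p-1,k}, eps) *)
Definition rs_clause (w : rs_space Y) (k : nat) (eps : bool) : R :=
  theta beta (fun j => rs_signs Y k j w)
    (fun j => if (j < p.-1)%N then rs_points Y k j w else spin R eps).

Definition rs_functional : \bar R :=
  ((ln 2)%:E
   + 'E_(rs_prob Y)[fun w =>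
       ln ((\sum_(eps : bool)
              expR (\sum_(k < rs_count Y w) rs_clause w k eps)) / 2)]
   - ((p%:R - 1) * alpha)%:E *
     'E_(rs_prob Y)[fun w => theta beta (fun j => rs_sign Y j w)
                                        (fun j => rs_point Y j w)])%E.

End rs_functional.

(* Main.v *)
(* Put c = 1 - exp (- beta).  The function N F_N of the rates of the clauses is
   a compound Poisson expectation, and two such expectations compare as soon as
   their generators do.

   Upper bound, for every N: interpolate between the clauses and independent
   cavity fields.  Expanding the logarithms in powers of c and replicating, the
   generator inequality reduces to x^p - p x y^(p-1) + (p-1) y^p >= 0.

   Lower bound: N F_N and (N+1) F_(N+1) both contain the same clauses on N
   spins.  Adding to these either one spin with its clauses or the missing
   clauses on N spins yields, in the difference, the functional P at the
   empirical measure of the magnetizations, up to an error bounded by the mean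
   of the sum over v, w of the covariances |<s_v s_w> - <s_v> <s_w>|, divided
   by N^2.  A covariance is at most the number of walks from v to w using each
   clause at most once, a walk of length k being weighted by c^k; on average
   the walks from v contribute at most 1 / (1 - rho) with
   rho = c (p-1) p alpha, and c <= min (4 beta, 1) gives rho < 1.  Hence the
   increments are at least inf P - o(1), and so is their Cesaro mean F_N. *)
Require Import Defs.
From HB Require Import structures.
From mathcomp Require Import all_boot all_order all_algebra.
From mathcomp Require Import all_classical all_reals all_analysis.
From mathcomp Require Import measurable_realfun.
From mathcomp Require Import zify ring lra.
Set Implicit Arguments.
Unset Strict Implicit.
Unset Printing Implicit Defensive.
Import Order.TTheory GRing.Theory Num.Theory.
Import numFieldNormedType.Exports.
Local Open Scope classical_set_scope.
Local Open Scope ring_scope.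

(** * Compound Poisson expectations *)

(** Energies live in the additive group of functions on configurations, and a Poisson number of
    independent clauses is a jump process in that group. Its expectation is an explicit series of
    finite sums, so both bounds are proved without measure theory, and the given random variables
    are brought in afterwards. In the lower bound, small covariances do not by themselves control
    logarithms of partition functions after Poisson many jumps. The true and the mean-field process
    are therefore driven by the same jumps, and a Lyapunov function of the pair, containing both
    inverse partition functions, is propagated. The covariances enter through Cauchy-Schwarz with a
    free parameter k, which gives an error of order k / (1 - rho) + 1 / (k N): N goes to infinity
    for fixed k. In the decay estimate a spin is flipped by negating its literals; of a clause and
    its flip one is then inert, so that a step of a walk costs one factor c and not two. The infimum
    is over all laws while both bounds handle finitely many points: laws are rounded to a grid for
    the upper bound, and magnetizations are separated into distinct atoms for the lower one. *)

Section tstep.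
Context {R : realType} {S : zmodType}.
Implicit Types (l : seq (R * S)) (f g : S -> R) (s : S).

Definition tstep l f s : R := \sum_(x <- l) x.1 * f (s + x.2).
Definition rate l : R := \sum_(x <- l) x.1.
Definition nonneg_rates l := all (fun x => 0 <= x.1) l.

Lemma iter_linear (T : (S -> R) -> S -> R) m :
  (forall f g s a, T (fun s => f s + a * g s) s = T f s + a * T g s) ->
  (forall f g, f =1 g -> T f =1 T g) ->
  (forall f g s a, iter m T (fun s => f s + a * g s) s =
     iter m T f s + a * iter m T g s) /\
  (forall f g, f =1 g -> iter m T f =1 iter m T g).
Proof.
move=> Tl Te; elim: m => [|m [IH1 IH2]] //=; split.
- move=> f g s a; rewrite -Tl; apply: Te => s'; exact: IH1.
- by move=> f g fg; apply: Te; apply: IH2.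
Qed.

Lemma eq_tstep l f g : f =1 g -> tstep l f =1 tstep l g.
Proof. by move=> fg s; apply: eq_bigr => x _; rewrite fg. Qed.

Lemma tstepD l f g s a :
  tstep l (fun s => f s + a * g s) s = tstep l f s + a * tstep l g s.
Proof.
rewrite /tstep mulr_sumr -big_split /=; apply: eq_bigr => x _; ring.
Qed.

Lemma eq_iter_tstep l m f g : f =1 g -> iter m (tstep l) f =1 iter m (tstep l) g.
Proof. exact: (iter_linear m (@tstepD l) (@eq_tstep l)).2. Qed.

Lemma iter_tstepD l m f g s a : iter m (tstep l) (fun s => f s + a * g s) s =
  iter m (tstep l) f s + a * iter m (tstep l) g s.
Proof. exact: (iter_linear m (@tstepD l) (@eq_tstep l)).1. Qed.

Lemma iter_tstepZ l m f s a : iter m (tstep l) (fun s => a * f s) s =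
  a * iter m (tstep l) f s.
Proof.
have := iter_tstepD l m (fun=> 0) f s a.
rewrite (_ : iter m _ (fun=> 0) s = 0) ?add0r => [<-|].
  by apply: eq_iter_tstep => ?; rewrite add0r.
elim: m s => //= m IH s; rewrite /tstep big1// => x _.
by rewrite IH mulr0.
Qed.

Lemma tstep_cst l a s : tstep l (fun=> a) s = rate l * a.
Proof. by rewrite /tstep /rate mulr_suml. Qed.

Lemma iter_tstep_cst l m a s : iter m (tstep l) (fun=> a) s = rate l ^+ m * a.
Proof.
elim: m s => [|m IH] s /=; first by rewrite expr0 mul1r.
rewrite (@eq_tstep l _ (fun=> rate l ^+ m * a)) // tstep_cst exprS; ring.
Qed.

Lemma tstep_cat l1 l2 f s : tstep (l1 ++ l2) f s = tstep l1 f s + tstep l2 f s.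
Proof. by rewrite /tstep big_cat. Qed.

Lemma rate_cat l1 l2 : rate (l1 ++ l2) = rate l1 + rate l2.
Proof. by rewrite /rate big_cat. Qed.

Lemma rate_ge0 l : nonneg_rates l -> 0 <= rate l.
Proof.
move=> /allP l0; rewrite /rate big_seq; apply: sumr_ge0 => x /l0 //.
Qed.

Lemma tstepC l1 l2 f : tstep l1 (tstep l2 f) =1 tstep l2 (tstep l1 f).
Proof.
move=> s; rewrite /tstep.
under eq_bigr do rewrite mulr_sumr.
rewrite exchange_big /=; apply: eq_bigr => x _; rewrite mulr_sumr.
by apply: eq_bigr => y _; rewrite mulrCA (addrAC s).
Qed.

Lemma iter_tstepC l1 l2 n f :
  tstep l2 (iter n (tstep l1) f) =1 iter n (tstep l1) (tstep l2 f).
Proof.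
elim: n => [|n IH] s //=; rewrite tstepC; apply: eq_tstep => s'; exact: IH.
Qed.

Lemma le_tstep_on (Q : S -> Prop) l f g s : nonneg_rates l ->
  (forall s x, x \in l -> Q s -> Q (s + x.2)) ->
  (forall s, Q s -> f s <= g s) -> Q s -> tstep l f s <= tstep l g s.
Proof.
move=> /allP l0 Qs fg qs; rewrite /tstep big_seq [leRHS]big_seq.
apply: ler_sum => x xl; apply: ler_wpM2l; first exact: l0.
by apply: fg; apply: Qs.
Qed.

Lemma le_iter_tstep_on (Q : S -> Prop) l m f g s : nonneg_rates l ->
  (forall s x, x \in l -> Q s -> Q (s + x.2)) ->
  (forall s, Q s -> f s <= g s) -> Q s ->
  iter m (tstep l) f s <= iter m (tstep l) g s.
Proof.
move=> l0 Qs fg; elim: m s => [|m IH] s qs /=; first exact: fg.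
exact: (@le_tstep_on Q).
Qed.

Lemma le_iter_tstep l m f g s : nonneg_rates l ->
  (forall s, f s <= g s) ->
  iter m (tstep l) f s <= iter m (tstep l) g s.
Proof. by move=> l0 fg; apply: (@le_iter_tstep_on (fun=> True)). Qed.

(** The binomial theorem for the operators [tstep l1] and [tstep l2], which commute because the
    jumps add up in a commutative group. *)
Lemma iter_tstep_cat l1 l2 m f s : iter m (tstep (l1 ++ l2)) f s =
  \sum_(k < m.+1) 'C(m, k)%:R * iter k (tstep l1) (iter (m - k) (tstep l2) f) s.
Proof.
elim: m s => [|m IH] s; first by rewrite big_ord_recl big_ord0 /= bin0 mul1r addr0.
rewrite iterS (@eq_tstep (l1 ++ l2) _ (fun s => \sum_(k < m.+1) 'C(m, k)%:R *
  iter k (tstep l1) (iter (m - k) (tstep l2) f) s)) //.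
have tsum l s' : tstep l (fun s => \sum_(k < m.+1) 'C(m, k)%:R *
    iter k (tstep l1) (iter (m - k) (tstep l2) f) s) s' =
    \sum_(k < m.+1) 'C(m, k)%:R *
    tstep l (iter k (tstep l1) (iter (m - k) (tstep l2) f)) s'.
  rewrite /tstep; under eq_bigr do rewrite mulr_sumr.
  rewrite exchange_big /=; apply: eq_bigr => k _.
  rewrite mulr_sumr; apply: eq_bigr => x _; exact: mulrCA.
rewrite tstep_cat !tsum.
pose u k := iter k (tstep l1) (iter (m.+1 - k) (tstep l2) f) s.
rewrite (eq_bigr (fun k : 'I_m.+1 => 'C(m, k)%:R * u k.+1)) //.
rewrite [X in _ + X](eq_bigr (fun k : 'I_m.+1 => 'C(m, k)%:R * u k)); last first.
  move=> k _; rewrite /u subSn -1?ltnS// iterS; congr (_ * _).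
  by rewrite iter_tstepC.
rewrite -[RHS]/(\sum_(k < m.+2) 'C(m.+1, k)%:R * u k).
rewrite [RHS]big_ord_recl bin0.
rewrite [in RHS](eq_bigr (fun k : 'I_m.+1 => 'C(m, k.+1)%:R * u k.+1 + 'C(m, k)%:R * u k.+1)); last first.
  by move=> k _; rewrite binS natrD mulrDl.
rewrite big_split /= addrA addrC; congr (_ + _).
rewrite big_ord_recl bin0; congr (_ + _).
by rewrite [in RHS]big_ord_recr /= bin_small// mul0r addr0.
Qed.

End tstep.

(** * Diagonal summation of dominated double series *)

Section cauchy_product.
Context {R : realType}.
Implicit Types (A B K : R).

Lemma triangle_sum (V : zmodType) (a : nat -> nat -> V) n :
  \sum_(0 <= m < n) \sum_(k < m.+1) a k (m - k)%N =
  \sum_(k < n) \sum_(0 <= l < n - k) a k l.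
Proof.
elim: n => [|n IH]; first by rewrite big_geq// big_ord0.
rewrite big_nat_recr//= IH.
under [RHS]eq_bigr => k _ do rewrite subSn -1?ltnS// big_nat_recr//=.
rewrite [RHS]big_split /=; congr (_ + _).
by rewrite [RHS]big_ord_recr /= subnn big_geq// addr0.
Qed.

Lemma series_ord (u : R^nat) n : series u n = \sum_(k < n) u k.
Proof. by rewrite seriesEord. Qed.

Lemma series_exp_le A n : 0 <= A -> series (exp_coeff A) n <= expR A.
Proof.
move=> A0; rewrite /expR; apply: nondecreasing_cvgn_le.
  apply: nondecreasing_series => k _ _; exact: exp_coeff_ge0.
exact: is_cvg_series_exp_coeff.
Qed.

(** What the rows contain beyond the triangle is dominated by the corresponding part of exp(A)
    exp(B). The triangle of that product sums to a partial sum of exp(A + B), so the functional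
    equation of exp makes the remainder vanish. *)
Lemma double_series_cvg (a : nat -> nat -> R) (b : nat -> R) K A B :
  0 <= K -> 0 <= A -> 0 <= B ->
  (forall k l, `|a k l| <= K * exp_coeff A k * exp_coeff B l) ->
  (forall k, series (a k) n @[n --> \oo] --> b k) ->
  series b n - series (fun m => \sum_(k < m.+1) a k (m - k)%N) n @[n --> \oo]
    --> (0 : R).
Proof.
move=> K0 A0 B0 aK ab.
have tail k j : `|b k - series (a k) j| <=
    K * exp_coeff A k * (expR B - series (exp_coeff B) j).
  have cb : `|series (a k) n - series (a k) j| @[n --> \oo] -->
      `|b k - series (a k) j|.
    by apply: cvg_norm; apply: cvgB => //; exact: cvg_cst.
  rewrite -(cvg_lim (@Rhausdorff R) cb); apply: limr_le.
    by apply/cvg_ex; eexists; exact: cb.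
  near=> n.
  have jn : (j <= n)%N by near: n; exact: nbhs_infty_ge.
  rewrite sub_series_geq//.
  apply: (le_trans (ler_norm_sum _ _ _)).
  apply: (@le_trans _ _ (\sum_(j <= l < n) K * exp_coeff A k * exp_coeff B l)).
    by apply: ler_sum => l _; exact: aK.
  rewrite -mulr_sumr -sub_series_geq//; apply: ler_wpM2l.
    by rewrite mulr_ge0// exp_coeff_ge0.
  by rewrite lerD2r series_exp_le.
have bnd n : `|series b n - series (fun m => \sum_(k < m.+1) a k (m - k)%N) n| <=
    K * (series (exp_coeff A) n * expR B - series (exp_coeff (A + B)) n).
  have -> : series (exp_coeff (A + B)) n =
      \sum_(k < n) \sum_(0 <= l < n - k) exp_coeff A k * exp_coeff B l.
    rewrite -(@triangle_sum _ (fun k l => exp_coeff A k * exp_coeff B l)).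
    rewrite seriesEnat; apply: eq_bigr => m _.
    rewrite /exp_coeff /= addrC exprDn mulr_suml; apply: eq_bigr => k _ /=.
    have km : (k <= m)%N by rewrite -ltnS.
    rewrite -mulr_natr -(bin_fact km) !natrM.
    have f1 : (k`!%:R : R) != 0 by rewrite pnatr_eq0 -lt0n fact_gt0.
    have f2 : ((m - k)`!%:R : R) != 0 by rewrite pnatr_eq0 -lt0n fact_gt0.
    have f3 : ('C(m, k)%:R : R) != 0 by rewrite pnatr_eq0 -lt0n bin_gt0.
    by field; rewrite f1 f2 f3.
  rewrite [X in _ - X](_ : _ = \sum_(k < n) series (a k) (n - k)%N); last first.
    by rewrite seriesEnat /= triangle_sum; apply: eq_bigr => k _; rewrite seriesEnat.
  rewrite series_ord -sumrB /=.
  apply: (le_trans (ler_norm_sum _ _ _)).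
  apply: (@le_trans _ _ (\sum_(k < n) K * exp_coeff A k * (expR B - series (exp_coeff B) (n - k)%N))).
    by apply: ler_sum => k _; exact: tail.
  rewrite [series _ n]series_ord mulr_suml -sumrB mulr_sumr.
  apply: ler_sum => k _.
  by rewrite -mulr_sumr -mulrBr [leRHS]mulrA.
pose y n := K * (series (exp_coeff A) n * expR B - series (exp_coeff (A + B)) n).
have y0 : y n @[n --> \oo] --> (0 : R).
  rewrite [X in _ --> X](_ : _ = K * (expR A * expR B - expR (A + B))); last first.
    by rewrite expRD subrr mulr0.
  apply: cvgM; first exact: cvg_cst.
  apply: cvgB; last exact: is_cvg_series_exp_coeff.
  apply: cvgM; [exact: is_cvg_series_exp_coeff | exact: cvg_cst].
apply: (@squeeze_cvgr _ _ _ _ (fun n => - y n) y) => //.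
  by apply: nearW => n; rewrite -ler_norml; exact: bnd.
by rewrite -oppr0; exact: cvgN.
Unshelve. all: by end_near. Qed.

End cauchy_product.

(** * The Poisson expectation as the exponential of a jump operator *)

Section PE.
Context {R : realType} {S : zmodType}.
Implicit Types (l : seq (R * S)) (f g : S -> R) (s : S) (nu : S -> R).

(* [PE l f s] is the expectation of [f] at [s] plus the jumps [x.2] of
   independent Poisson processes of rates [x.1], for [x] in [l], at time 1. *)
Definition pterm l f s (m : nat) : R :=
  expR (- rate l) / m`!%:R * iter m (tstep l) f s.

Definition PE l f s : R := limn (series (pterm l f s)).

Lemma norm_poisson_coef (a y : R) m :
  `|expR a / m`!%:R * y| = expR a / m`!%:R * `|y|.
Proof. by rewrite normrM ger0_norm// mulr_ge0 ?expR_ge0 ?invr_ge0. Qed.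

Definition subadd nu :=
  (forall s, 0 <= nu s) /\ (forall s t, nu (s + t) <= nu s + nu t).

(* This class makes the series of [PE] converge absolutely and is stable under
   [PE] itself. *)
Definition egrow nu f := exists C k, [/\ 0 <= C, 0 <= k &
  forall s, `|f s| <= C * expR (k * nu s)].

(** By subadditivity a jump by [x.2] costs at most the factor [expR (k * nu x.2)], whatever the
    current state; hence the geometric growth in [m]. *)
Lemma iter_tstep_bound nu l f C k s m : subadd nu -> 0 <= C -> 0 <= k ->
  (forall s, `|f s| <= C * expR (k * nu s)) ->
  `|iter m (tstep l) f s| <=
    C * expR (k * nu s) * (\sum_(x <- l) `|x.1| * expR (k * nu x.2)) ^+ m.
Proof.
move=> [nu0 nuD] C0 k0 fC; elim: m s => [|m IH] s; first by rewrite expr0 mulr1.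
rewrite iterS /tstep; apply: (le_trans (ler_norm_sum _ _ _)).
set B := \sum_(x <- l) _ in IH *.
have B0 : 0 <= B by apply: sumr_ge0 => x _; rewrite mulr_ge0 ?expR_ge0.
rewrite exprSr mulrA {2}/B mulr_sumr; apply: ler_sum => x _.
rewrite normrM mulrCA; apply: ler_wpM2l => //; apply: (le_trans (IH _)).
rewrite -[leRHS]mulrA [_ ^+ m * _]mulrC mulrA; apply: ler_wpM2r; first exact: exprn_ge0.
rewrite -mulrA; apply: ler_wpM2l => //.
by rewrite -expRD ler_expR -mulrDr; apply: ler_wpM2l.
Qed.

Lemma pterm_bound nu l f s : subadd nu -> egrow nu f ->
  exists K B, [/\ 0 <= K, 0 <= B & forall m, `|pterm l f s m| <= K * exp_coeff B m].
Proof.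
move=> nuP [C [k [C0 k0 fC]]].
exists (expR (- rate l) * (C * expR (k * nu s))), (\sum_(x <- l) `|x.1| * expR (k * nu x.2)).
split.
- by rewrite !mulr_ge0 ?expR_ge0.
- by apply: sumr_ge0 => x _; rewrite mulr_ge0 ?expR_ge0.
move=> m; rewrite /pterm norm_poisson_coef /exp_coeff /=.
apply: (@le_trans _ _ (expR (- rate l) / m`!%:R * (C * expR (k * nu s) *
  (\sum_(x <- l) `|x.1| * expR (k * nu x.2)) ^+ m))).
  apply: ler_wpM2l; first by rewrite mulr_ge0 ?expR_ge0 ?invr_ge0.
  exact: iter_tstep_bound.
by rewrite le_eqVlt; apply/orP; left; apply/eqP; ring.
Qed.

Lemma series_dom_cvg (u v : R^nat) : (forall n, `|u n| <= v n) ->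
  cvgn (series v) -> cvgn (series u).
Proof.
move=> uv cv; apply: normed_cvg; apply: series_le_cvg cv => n //=.
exact: le_trans (uv n).
Qed.

Lemma PE_cvg nu l f s : subadd nu -> egrow nu f ->
  series (pterm l f s) n @[n --> \oo] --> PE l f s.
Proof.
move=> nuP fE; have [K [B [K0 B0 fK]]] := pterm_bound l s nuP fE.
apply: series_dom_cvg fK _.
have -> : (fun m => K * exp_coeff B m) = K *: exp_coeff B by [].
by apply: is_cvg_seriesZ; exact: is_cvg_series_exp_coeff.
Qed.

Lemma PE_lim l f s a : series (pterm l f s) n @[n --> \oo] --> a ->
  PE l f s = a.
Proof. exact: cvg_lim. Qed.

Lemma eq_PE l f g s : f =1 g -> PE l f s = PE l g s.
Proof.
move=> fg; congr (limn (series _)); apply/funext => m.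
by rewrite /pterm (eq_iter_tstep l m fg).
Qed.

(** Only the operator matters, not the list: testing it on the constant 1 recovers the total rate.
    Jumps may thus be merged, split or reindexed. *)
Lemma PE_ext l l' f s : (forall f, tstep l f =1 tstep l' f) ->
  PE l f s = PE l' f s.
Proof.
move=> ll'; congr (limn (series _)); apply/funext => m; rewrite /pterm.
have -> : rate l = rate l'.
  by have := ll' (fun=> 1) 0; rewrite !tstep_cst !mulr1.
congr (_ * _); elim: m s => //= m IH s.
by rewrite ll'; exact: eq_tstep.
Qed.

Lemma PE_le_on nu (Q : S -> Prop) l f g s : subadd nu -> nonneg_rates l ->
  egrow nu f -> egrow nu g ->
  (forall s x, x \in l -> Q s -> Q (s + x.2)) ->
  (forall s, Q s -> f s <= g s) -> Q s -> PE l f s <= PE l g s.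
Proof.
move=> nuP l0 fE gE Qs fg qs.
apply: lim_series_le.
- exact: PE_cvg fE.
- exact: PE_cvg gE.
move=> m; apply: ler_wpM2l; first by rewrite mulr_ge0 ?expR_ge0 ?invr_ge0.
exact: (@le_iter_tstep_on _ _ Q).
Qed.

Lemma PE_le nu l f g s : subadd nu -> nonneg_rates l ->
  egrow nu f -> egrow nu g -> (forall s, f s <= g s) -> PE l f s <= PE l g s.
Proof.
by move=> nuP l0 fE gE fg; apply: (@PE_le_on nu (fun=> True)).
Qed.

Lemma PED nu l f g s a : subadd nu -> egrow nu f -> egrow nu g ->
  PE l (fun s => f s + a * g s) s = PE l f s + a * PE l g s.
Proof.
move=> nuP fE gE; apply: PE_lim.
rewrite (_ : series _ = series (pterm l f s) + a *: series (pterm l g s)).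
  apply: cvgD; first exact: PE_cvg fE.
  by apply: cvgZr; exact: PE_cvg gE.
rewrite -seriesZ -seriesD; congr series; apply/funext => m.
by rewrite /pterm iter_tstepD mulrDr mulrCA.
Qed.

Lemma PE_cst l a s : PE l (fun=> a) s = a.
Proof.
apply: PE_lim.
rewrite (_ : pterm l _ s = (a * expR (- rate l)) *: exp_coeff (rate l)); last first.
  apply/funext => m; rewrite /pterm iter_tstep_cst /exp_coeff /= scalrfctE /GRing.scale /=.
  ring.
rewrite seriesZ [X in _ --> X](_ : _ = (a * expR (- rate l)) *: expR (rate l)).
  by apply: cvgZr; exact: is_cvg_series_exp_coeff.
by rewrite /GRing.scale /= -mulrA -expRD addNr expR0 mulr1.
Qed.

Lemma PE_nil f s : PE [::] f s = f s.
Proof.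
rewrite -[RHS](PE_cst [::] (f s) s); congr (limn (series _)); apply/funext => m.
by rewrite /pterm; case: m => [|m] //=; rewrite /tstep !big_nil.
Qed.

Lemma egrowD nu f g a : subadd nu -> egrow nu f -> egrow nu g ->
  egrow nu (fun s => f s + a * g s).
Proof.
move=> [nu0 _] [C [k [C0 k0 fC]]] [C' [k' [C'0 k'0 gC]]].
exists (C + `|a| * C'), (k + k'); split; [by rewrite addr_ge0 ?mulr_ge0|exact: addr_ge0|].
move=> s; apply: (le_trans (ler_normD _ _)); rewrite mulrDl lerD//.
  apply: (le_trans (fC s)); apply: ler_wpM2l => //.
  by rewrite ler_expR ler_wpM2r// lerDl.
rewrite normrM -mulrA ler_wpM2l//; apply: (le_trans (gC s)); apply: ler_wpM2l => //.
by rewrite ler_expR ler_wpM2r// lerDr.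
Qed.

Lemma egrowM nu f g : egrow nu f -> egrow nu g -> egrow nu (fun s => f s * g s).
Proof.
move=> [C [k [C0 k0 fC]]] [C' [k' [C'0 k'0 gC]]].
exists (C * C'), (k + k'); split; [exact: mulr_ge0|exact: addr_ge0|] => s.
by rewrite normrM mulrDl expRD mulrACA ler_pM.
Qed.

Lemma egrow_cst nu a : egrow nu (fun=> a).
Proof.
by exists `|a|, 0; split => // s; rewrite mul0r expR0 mulr1.
Qed.

Lemma egrow_le nu f g : egrow nu g -> (forall s, `|f s| <= g s) -> egrow nu f.
Proof.
move=> [C [k [C0 k0 gC]]] fg; exists C, k; split => // s.
exact: le_trans (fg s) (le_trans (ler_norm _) (gC s)).
Qed.

Lemma egrow_nu nu : subadd nu -> egrow nu nu.
Proof.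
move=> [nu0 _]; exists 1, 1; split => // s; rewrite !mul1r ger0_norm//.
by apply: le_trans (expR_ge1Dx _); rewrite lerDr.
Qed.

Lemma egrow_shift nu f t : subadd nu -> egrow nu f -> egrow nu (fun s => f (s + t)).
Proof.
move=> [nu0 nuD] [C [k [C0 k0 fC]]]; exists (C * expR (k * nu t)), k; split => //.
  by rewrite mulr_ge0 ?expR_ge0.
move=> s; apply: (le_trans (fC _)); rewrite -mulrA -expRD ler_wpM2l//.
by rewrite ler_expR -mulrDr ler_wpM2l// addrC.
Qed.

Lemma egrow_sum nu (I : Type) (r : seq I) (F : I -> S -> R) : subadd nu ->
  (forall i, egrow nu (F i)) -> egrow nu (fun s => \sum_(i <- r) F i s).
Proof.
move=> nuP FE; elim: r => [|i r IH].
  by apply: egrow_le (egrow_cst nu 0) _ => s; rewrite big_nil normr0.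
have := egrowD 1 nuP (FE i) IH.
by rewrite (_ : (fun s => _) = (fun s => \sum_(j <- i :: r) F j s))//; apply/funext => s; rewrite big_cons mul1r.
Qed.

Lemma PE_sum nu l (I : Type) (r : seq I) (F : I -> S -> R) s : subadd nu ->
  (forall i, egrow nu (F i)) ->
  PE l (fun s => \sum_(i <- r) F i s) s = \sum_(i <- r) PE l (F i) s.
Proof.
move=> nuP FE; elim: r => [|i r IH].
  by rewrite big_nil -[RHS](PE_cst l 0 s); apply: eq_PE => s'; rewrite big_nil.
rewrite big_cons -IH -[X in _ = _ + X]mul1r -(PED (nu := nu))//; last exact: egrow_sum.
by apply: eq_PE => s'; rewrite big_cons mul1r.
Qed.

(** The growth exponent is unchanged by [PE]; only the constant is multiplied. *)
Lemma egrow_PE nu l f : subadd nu -> egrow nu f -> egrow nu (PE l f).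
Proof.
move=> nuP fE; have [C [k [C0 k0 fC]]] := fE.
pose B := \sum_(x <- l) `|x.1| * expR (k * nu x.2).
have B0 : 0 <= B by apply: sumr_ge0 => x _; rewrite mulr_ge0 ?expR_ge0.
exists (expR (- rate l) * C * expR B), k; split => //.
  by rewrite !mulr_ge0 ?expR_ge0.
move=> s.
have cf : `|series (pterm l f s) n| @[n --> \oo] --> `|PE l f s|.
  by apply: cvg_norm; exact: PE_cvg fE.
rewrite -(cvg_lim (@Rhausdorff R) cf); apply: limr_le.
  by apply/cvg_ex; eexists; exact: cf.
apply: nearW => n; rewrite series_ord; apply: (le_trans (ler_norm_sum _ _ _)).
apply: (@le_trans _ _ (expR (- rate l) * C * expR (k * nu s) * series (exp_coeff B) n)).
  rewrite series_ord mulr_sumr; apply: ler_sum => m _.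
  rewrite /pterm norm_poisson_coef /exp_coeff /=.
  apply: (@le_trans _ _ (expR (- rate l) / m`!%:R * (C * expR (k * nu s) * B ^+ m))).
    apply: ler_wpM2l; first by rewrite mulr_ge0 ?expR_ge0 ?invr_ge0.
    exact: iter_tstep_bound.
  by rewrite le_eqVlt; apply/orP; left; apply/eqP; ring.
rewrite -[leRHS]mulrA [expR B * _]mulrC mulrA ler_wpM2l ?series_exp_le//.
by rewrite !mulr_ge0 ?expR_ge0.
Qed.

Lemma cvg_iter_tstep l k (u : nat -> S -> R) f s :
  (forall s, u n s @[n --> \oo] --> f s) ->
  iter k (tstep l) (u n) s @[n --> \oo] --> iter k (tstep l) f s.
Proof.
move=> uf; elim: k s => [|k IH] s; first exact: uf.
rewrite iterS /tstep.
rewrite (_ : (fun n => _) = (fun n => \sum_(x <- l) x.1 * iter k (tstep l) (u n) (s + x.2)))//.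
apply: cvg_big => [|x _]; first exact: add_continuous.
by apply: cvgM; [exact: cvg_cst | exact: IH].
Qed.

Lemma iter_tstep_sum l k (F : nat -> S -> R) n s :
  iter k (tstep l) (fun s => \sum_(i < n) F i s) s =
  \sum_(i < n) iter k (tstep l) (F i) s.
Proof.
elim: n => [|n IH].
  rewrite big_ord0 (@eq_iter_tstep _ _ l k _ (fun=> 0)).
    by rewrite iter_tstep_cst mulr0.
  by move=> ?; rewrite big_ord0.
rewrite big_ord_recr /= -IH -[X in _ = _ + X]mul1r -iter_tstepD.
by apply: eq_iter_tstep => s'; rewrite big_ord_recr /= mul1r.
Qed.

(** Superposition of independent processes, that is, the exponential of a sum of commuting
    operators: the binomial expansion groups the double series along its diagonals. *)
Lemma PE_cat nu l1 l2 f s : subadd nu -> egrow nu f ->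
  PE (l1 ++ l2) f s = PE l1 (PE l2 f) s.
Proof.
move=> nuP fE.
pose a k j := expR (- rate l1) / k`!%:R * (expR (- rate l2) / j`!%:R *
  iter k (tstep l1) (iter j (tstep l2) f) s).
have diag m : pterm (l1 ++ l2) f s m = \sum_(k < m.+1) a k (m - k)%N.
  rewrite /pterm iter_tstep_cat rate_cat opprD expRD mulr_sumr.
  apply: eq_bigr => k _; rewrite /a -(@bin_fact m k) -1?ltnS// !natrM.
  have f1 : (k`!%:R : R) != 0 by rewrite pnatr_eq0 -lt0n fact_gt0.
  have f2 : ((m - k)`!%:R : R) != 0 by rewrite pnatr_eq0 -lt0n fact_gt0.
  have f3 : ('C(m, k)%:R : R) != 0 by rewrite pnatr_eq0 -lt0n bin_gt0 -ltnS.
  by field; rewrite f1 f2 f3.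
have [C [k0 [C0 k00 fC]]] := fE.
pose A l := \sum_(x <- l) `|x.1| * expR (k0 * nu x.2).
have A0 l : 0 <= A l by apply: sumr_ge0 => x _; rewrite mulr_ge0 ?expR_ge0.
pose K := expR (- rate l1) * expR (- rate l2) * C * expR (k0 * nu s).
have K0 : 0 <= K by rewrite !mulr_ge0 ?expR_ge0.
have aK k j : `|a k j| <= K * exp_coeff (A l1) k * exp_coeff (A l2) j.
  rewrite /a !norm_poisson_coef.
  have := @iter_tstep_bound nu l1 (iter j (tstep l2) f) (C * A l2 ^+ j) k0 s k nuP.
  rewrite -/(A l1) => /(_ _ k00) H.
  apply: (@le_trans _ _ (expR (- rate l1) / k`!%:R * (expR (- rate l2) / j`!%:R *
      (C * A l2 ^+ j * expR (k0 * nu s) * A l1 ^+ k)))).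
    do 2![apply: ler_wpM2l; first by rewrite mulr_ge0 ?expR_ge0 ?invr_ge0].
    apply: H; first by rewrite mulr_ge0 ?exprn_ge0.
    by move=> s'; rewrite mulrAC; exact: iter_tstep_bound.
  by rewrite /exp_coeff /= /K le_eqVlt; apply/orP; left; apply/eqP; ring.
have ab k : series (a k) n @[n --> \oo] --> pterm l1 (PE l2 f) s k.
  rewrite (_ : series (a k) = (fun n => expR (- rate l1) / k`!%:R *
      iter k (tstep l1) (fun s => series (pterm l2 f s) n) s)).
    apply: cvgM; first exact: cvg_cst.
    by apply: cvg_iter_tstep => s'; exact: PE_cvg fE.
  apply/funext => n; rewrite series_ord /a -mulr_sumr; congr (_ * _).
  rewrite (@eq_iter_tstep _ _ l1 k _ (fun s => \sum_(j < n) pterm l2 f s j)).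
    rewrite (iter_tstep_sum l1 k (fun j s => pterm l2 f s j)).
    by apply: eq_bigr => j _; rewrite iter_tstepZ.
  by move=> s'; rewrite series_ord.
have H := double_series_cvg K0 (A0 l1) (A0 l2) aK ab; apply: PE_lim.
rewrite (_ : pterm (l1 ++ l2) f s = (fun m => \sum_(k < m.+1) a k (m - k)%N)); last first.
  exact/funext.
have c1 : series (pterm l1 (PE l2 f) s) n @[n --> \oo] --> PE l1 (PE l2 f) s.
  exact: (PE_cvg nuP (egrow_PE l2 nuP fE)).
rewrite -[PE l1 _ s]subr0.
rewrite (_ : series _ = (fun n => series (pterm l1 (PE l2 f) s) n -
  (series (pterm l1 (PE l2 f) s) n -
   series (fun m => \sum_(k < m.+1) a k (m - k)%N) n))); last first.
  by apply/funext => n; rewrite opprB addrC subrK.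
exact: cvgB c1 H.
Qed.

End PE.

Section homomorphism.
Context {R : realType} {S S' : zmodType} (phi : S -> S').
Hypothesis phiD : forall s t, phi (s + t) = phi s + phi t.

Lemma tstep_hom (l : seq (R * S)) m (f : S' -> R) s :
  iter m (tstep [seq (x.1, phi x.2) | x <- l]) f (phi s) =
  iter m (tstep l) (f \o phi) s.
Proof.
elim: m s => // m IH s; rewrite !iterS /tstep big_map; apply: eq_bigr => x _ /=.
by rewrite -phiD IH.
Qed.

(** The additive image of a jump process is the process of the image jumps. This changes the state
    space, and lets two processes be seen as projections of a joint one. *)
Lemma PE_hom (l : seq (R * S)) (f : S' -> R) s :
  PE [seq (x.1, phi x.2) | x <- l] f (phi s) = PE l (f \o phi) s.
Proof.
congr (limn (series _)); apply/funext => m; rewrite /pterm tstep_hom.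
by rewrite /rate big_map.
Qed.

End homomorphism.

(** * Comparison of jump processes *)

Section PE_comparison.
Context {R : realType} {S : zmodType}.
Implicit Types (l : seq (R * S)) (f g D : S -> R) (s : S) (nu : S -> R).

Lemma PE_invariant l f s : (forall s x, x \in l -> f (s + x.2) = f s) ->
  PE l f s = f s.
Proof.
move=> fl; rewrite -[RHS](PE_cst l (f s) s); congr (limn (series _)).
apply/funext => m; rewrite /pterm iter_tstep_cst; congr (_ * _).
elim: m s => [|m IH] s; first by rewrite expr0 mul1r.
rewrite iterS (@eq_tstep _ _ l _ (fun s => rate l ^+ m * f s)) // /tstep exprS.
rewrite /rate mulr_suml [in RHS]mulr_suml big_seq [RHS]big_seq.
by apply: eq_bigr => x xl; rewrite fl// mulrA.
Qed.

Lemma PE_null nu mu l f s : subadd nu -> egrow nu f ->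
  PE ((mu, 0) :: l) f s = PE l f s.
Proof.
move=> nuP fE; rewrite -cat1s (PE_cat (nu := nu))// PE_invariant// => s' x.
by rewrite inE => /eqP -> /=; rewrite addr0.
Qed.

Lemma cvg_series_exp_coeff_deriv (a : R) :
  series (fun m => if m is m'.+1 then exp_coeff a m' else 0) n @[n --> \oo]
  --> expR a.
Proof.
rewrite -cvg_shiftS.
rewrite (_ : (fun n => _) = series (exp_coeff a)); first exact: is_cvg_series_exp_coeff.
by apply/funext => n; rewrite !series_ord big_ord_recl add0r.
Qed.

(* Comparing the generators pointwise replaces the differentiation of the
   interpolation in [t]. *)
Lemma PE_gen nu l0 l1 f k s : subadd nu -> nonneg_rates l0 -> nonneg_rates l1 ->
  egrow nu f ->
  (forall s, tstep l1 f s - rate l1 * f s <= tstep l0 f s - rate l0 * f s + k) ->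
  PE l1 f s <= PE l0 f s + k.
Proof.
move=> nuP l0P l1P fE gen.
(* Null jumps bring both processes to the same total rate, so that the hypothesis on the generators
   becomes an inequality between the jump operators alone. *)
pose l1' := (rate l0, 0) :: l1; pose l0' := (rate l1, 0) :: l0.
have r1 : rate l1' = rate l0 + rate l1 by rewrite /rate big_cons.
have r0 : rate l0' = rate l0 + rate l1 by rewrite /rate big_cons addrC.
have l1'P : nonneg_rates l1' by rewrite /= rate_ge0.
have l0'P : nonneg_rates l0' by rewrite /= rate_ge0.
have gen' s' : tstep l1' f s' <= tstep l0' f s' + 1 * k.
  rewrite /tstep !big_cons /= !addr0 mul1r; have := gen s'; rewrite /tstep; lra.
(* The error at the m-th power is [k] times the derivative of r^m at the total rate r; against the
   Poisson weights it sums to [k]. *)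
have itm m s' : iter m (tstep l1') f s' <= iter m (tstep l0') f s' +
    m%:R * (rate l0 + rate l1) ^+ m.-1 * k.
  elim: m s' => [|m IH] s'; first by rewrite !mul0r addr0.
  rewrite iterSr (le_trans (le_iter_tstep m s' l1'P gen'))//.
  rewrite (@iter_tstepD _ _ l1' m (tstep l0' f) (fun=> k)) mul1r iter_tstep_cst r1.
  rewrite -iter_tstepC iterS.
  have H : tstep l0' (iter m (tstep l1') f) s' <=
      tstep l0' (fun s => iter m (tstep l0') f s +
        1 * (m%:R * (rate l0 + rate l1) ^+ m.-1 * k)) s'.
    by apply: (@le_tstep_on _ _ (fun=> True)) => // s'' _; rewrite mul1r.
  rewrite tstepD tstep_cst r0 mul1r in H.
  apply: (le_trans (lerD H (lexx _))).
  rewrite -addrA lerD2l.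
  case: m {IH H} => [|m]; first by rewrite !mul0r mulr0 add0r expr0 !mul1r.
  by rewrite [(m.+2)%:R]mulrS /= [in leRHS]exprS le_eqVlt exprS; apply/orP; left; apply/eqP; ring.
rewrite -(PE_null (rate l0) l1 s nuP fE) -/l1' -(PE_null (rate l1) l0 s nuP fE) -/l0'.
pose d m := if m is m'.+1 then exp_coeff (rate l0 + rate l1) m' else 0.
pose e := expR (- (rate l0 + rate l1)).
have -> : k = k * e * expR (rate l0 + rate l1).
  by rewrite -mulrA -expRD addNr expR0 mulr1.
have c : series (pterm l0' f s) n + k * e * series d n @[n --> \oo] -->
    PE l0' f s + k * e * expR (rate l0 + rate l1).
  apply: cvgD; first exact: PE_cvg fE.
  by apply: cvgM; [exact: cvg_cst | exact: cvg_series_exp_coeff_deriv].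
rewrite -(cvg_lim (@Rhausdorff R) c); apply: ler_lim.
- exact: PE_cvg fE.
- by apply/cvg_ex; eexists; exact: c.
apply: nearW => n; rewrite !series_ord mulr_sumr -big_split /=.
apply: ler_sum => m _; rewrite /pterm r1 r0 -/e.
have em0 : 0 <= e / m`!%:R by rewrite mulr_ge0 ?expR_ge0 ?invr_ge0.
apply: (le_trans (ler_wpM2l em0 (itm m s))); rewrite mulrDr lerD2l.
case: (nat_of_ord m) {em0} => [|m']; first by rewrite !mul0r !mulr0.
rewrite /d /= /exp_coeff /= factS natrM.
have f1 : (m'`!%:R : R) != 0 by rewrite pnatr_eq0 -lt0n fact_gt0.
have f2 : (m'.+1%:R : R) != 0 by rewrite pnatr_eq0.
rewrite le_eqVlt; apply/orP; left; apply/eqP; rewrite [m'.+1%:R]lock in f2 *.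
by field; rewrite f1 f2.
Qed.

(** [PE_gen] against the empty process, in both directions. *)
Lemma PE_gen_const nu l f k s : subadd nu -> nonneg_rates l -> egrow nu f ->
  (forall s, tstep l f s - rate l * f s = k) -> PE l f s = f s + k.
Proof.
move=> nuP lP fE fk; apply/le_anti/andP; split.
  rewrite -[X in _ <= X + _](PE_nil (R := R)); apply: (PE_gen _ nuP) => //.
  by move=> s'; rewrite fk /tstep /rate !big_nil mul0r subr0 add0r.
rewrite -lerBrDr -[leLHS](PE_nil (R := R)); apply: (PE_gen _ nuP) => //.
by move=> s'; rewrite fk /tstep /rate !big_nil mul0r subr0 subrr.
Qed.

Lemma PE_cat_le nu l l' f s : subadd nu -> nonneg_rates l -> nonneg_rates l' ->
  egrow nu f -> (forall s x, x \in l' -> f (s + x.2) <= f s) ->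
  PE (l ++ l') f s <= PE l f s.
Proof.
move=> nuP lP l'P fE fl'; rewrite -[leRHS]addr0; apply: (PE_gen _ nuP) => //.
  by rewrite /nonneg_rates all_cat; apply/andP.
move=> s'; rewrite tstep_cat rate_cat.
suff : tstep l' f s' <= rate l' * f s' by lra.
rewrite /tstep /rate mulr_suml big_seq [leRHS]big_seq; apply: ler_sum => x xl.
by apply: ler_wpM2l; [move/allP : l'P => /(_ x xl) | exact: fl'].
Qed.

(** Gronwall's inequality for the process: m jumps multiply [D] by at most k^m. The one-step bound
    is asked only on the set [Q], which the jumps preserve. *)
Lemma PE_lyap nu (Q : S -> Prop) l D k s : subadd nu -> nonneg_rates l ->
  egrow nu D -> 0 <= k ->
  (forall s x, x \in l -> Q s -> Q (s + x.2)) ->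
  (forall s, Q s -> tstep l D s <= k * D s) -> Q s ->
  PE l D s <= expR (k - rate l) * D s.
Proof.
move=> nuP lP DE k0 Ql Dk Qs.
have itm m : iter m (tstep l) D s <= k ^+ m * D s.
  elim: m => [|m IH]; first by rewrite expr0 mul1r.
  rewrite iterSr (le_trans (@le_iter_tstep_on _ _ Q l m _ (fun s => k * D s) s lP Ql _ Qs))//.
  by rewrite iter_tstepZ exprS -mulrA ler_wpM2l.
have c : expR (- rate l) * D s * series (exp_coeff k) n @[n --> \oo] -->
    expR (- rate l) * D s * expR k.
  by apply: cvgM; [exact: cvg_cst | exact: is_cvg_series_exp_coeff].
rewrite addrC expRD mulrAC -(cvg_lim (@Rhausdorff R) c); apply: ler_lim.
- exact: PE_cvg DE.
- by apply/cvg_ex; eexists; exact: c.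
apply: nearW => n; rewrite !series_ord mulr_sumr; apply: ler_sum => m _.
apply: (@le_trans _ _ (expR (- rate l) / m`!%:R * (k ^+ m * D s))).
  by apply: ler_wpM2l => //; rewrite mulr_ge0 ?expR_ge0 ?invr_ge0.
by rewrite /exp_coeff /= le_eqVlt; apply/orP; left; apply/eqP; ring.
Qed.

Lemma PE_partial_le nu l f s B : subadd nu -> egrow nu f ->
  (forall n, series (pterm l f s) n <= B) -> PE l f s <= B.
Proof.
move=> nuP fE H; apply: limr_le; last by apply: nearW.
exact: PE_cvg fE.
Qed.

End PE_comparison.

(** * Processes with jumps indexed by a finite type *)

Section jumps.
Context {R : realType} {S : zmodType} {I : finType}.
Implicit Types (lam : I -> R) (J : I -> S).

Definition jumps lam J : seq (R * S) := [seq (lam i, J i) | i <- enum I].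

Lemma tstep_jumps lam J f s : tstep (jumps lam J) f s = \sum_i lam i * f (s + J i).
Proof. by rewrite /tstep big_map big_enum. Qed.

Lemma rate_jumps lam J : rate (jumps lam J) = \sum_i lam i.
Proof. by rewrite /rate big_map big_enum. Qed.

Lemma nonneg_rates_jumps lam J : (forall i, 0 <= lam i) -> nonneg_rates (jumps lam J).
Proof. by move=> l0; apply/allP => x /mapP[i _ ->] /=. Qed.

Lemma mem_jumps lam J x : x \in jumps lam J -> exists i, x = (lam i, J i).
Proof. by move=> /mapP[i _ ->]; exists i. Qed.

Lemma sum_tuple_cons (V : nmodType) m (F : m.+1.-tuple I -> V) :
  \sum_(t : m.+1.-tuple I) F t = \sum_i \sum_(t : m.-tuple I) F [tuple of i :: t].
Proof.
rewrite pair_bigA /= (reindex (fun p : I * m.-tuple I => [tuple of p.1 :: p.2]))//=.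
exists (fun t : m.+1.-tuple I => (thead t, behead_tuple t)) => [[i t] _|t _] /=.
  by rewrite theadE; congr (_, _); exact: val_inj.
by rewrite [RHS]tuple_eta; apply/val_inj.
Qed.

(** This form of the m-th term meets both the counting of walks in m clauses and the law of m random
    labels. *)
Lemma iter_tstep_jumps lam J m f s : iter m (tstep (jumps lam J)) f s =
  \sum_(t : m.-tuple I) (\prod_(i <- t) lam i) * f (s + \sum_(i <- t) J i).
Proof.
elim: m s => [|m IH] s.
  rewrite (big_pred1 [tuple]) => [|t]; last by rewrite (tuple0 t) /=; apply/esym/eqP/val_inj.
  by rewrite /= !big_nil mul1r addr0.
rewrite iterS tstep_jumps sum_tuple_cons; apply: eq_bigr => i _.
rewrite IH mulr_sumr; apply: eq_bigr => t _.
by rewrite /= !big_cons mulrA addrA.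
Qed.

End jumps.

Lemma PE_jumps_hom (R : realType) (S S' : zmodType) (phi : S -> S')
  (I : finType) (lam : I -> R) (J : I -> S) (J' : I -> S') (f : S' -> R) :
  (forall s t, phi (s + t) = phi s + phi t) ->
  (forall i, J' i = phi (J i)) ->
  PE (jumps lam J') f 0 = PE (jumps lam J) (f \o phi) 0.
Proof.
move=> phiD JJ; have phi0 : phi 0 = 0.
  by apply: (@addIr _ (phi 0)); rewrite -phiD !add0r.
rewrite -(PE_hom phiD) phi0; congr (PE _ f 0).
by rewrite /jumps -[RHS]map_comp; apply/eq_map => i /=; rewrite JJ.
Qed.

Definition l1size (R : realType) (W : finType) (s : W -> R) : R := \sum_w `|s w|.

Lemma subadd_l1size (R : realType) (W : finType) : subadd (@l1size R W).
Proof.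
split=> [s|s t]; first exact: sumr_ge0.
by rewrite -big_split /=; apply: ler_sum => w _; exact: ler_normD.
Qed.

Lemma ler_l1size (R : realType) (W : finType) (s : W -> R) w : `|s w| <= l1size s.
Proof. by rewrite /l1size (bigD1 w)//= lerDl sumr_ge0. Qed.

(** * Decay of correlations *)
Section influence.
Context {R : realFieldType} {V : finType} {p : nat}.
Variables (c : R) (c0 : 0 <= c) (c1 : c < 1).
Notation config := {ffun V -> bool}.
Notation clause := {ffun 'I_p -> V * bool}.
Implicit Types (f : config -> R) (h g : V -> bool -> R) (t r : seq clause)
  (a : clause) (v u : V) (b : bool) (s : config) (L : seq (V * bool)).

(** A configuration that matches every literal of [a] is the penalized one: its weight is [1 - c],
    which is exp(- beta) in the application. *)
Definition satisfies a s := [forall j, s (a j).1 == (a j).2].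
Definition clausew a s : R := 1 - c * (satisfies a s)%:R.
Definition gibbsw h t s : R := (\prod_v h v (s v)) * \prod_(a <- t) clausew a s.
Definition gsum f h t : R := \sum_s f s * gibbsw h t s.
Notation gpart h t := (gsum (fun=> 1) h t).
Definition nonneg_field h := forall v b, 0 <= h v b.
(** Unnormalized conditioning on the value [b] at [u]. It produces another field, so bounds that are
    uniform in the field apply to conditioned measures. *)
Definition pin h u b v e : R := if v == u then h v e * (e == b)%:R else h v e.

Lemma nonneg_pin h u b : nonneg_field h -> nonneg_field (pin h u b).
Proof. by move=> h0 v e; rewrite /pin; case: ifP => _; rewrite ?mulr_ge0. Qed.

Lemma clausew_gt0 a s : 0 < clausew a s.
Proof.
rewrite /clausew; case: satisfies; rewrite ?mulr1 ?mulr0 ?subr0//.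
by rewrite subr_gt0.
Qed.

Lemma gibbsw_ge0 h t s : nonneg_field h -> 0 <= gibbsw h t s.
Proof.
move=> h0; apply: mulr_ge0; apply: prodr_ge0 => // a _.
exact/ltW/clausew_gt0.
Qed.

Lemma gpart_ge0 h t : nonneg_field h -> 0 <= gpart h t.
Proof. by move=> h0; apply: sumr_ge0 => s _; rewrite mul1r gibbsw_ge0. Qed.

Lemma le_gsum h t f (f' : config -> R) : nonneg_field h ->
  (forall s, f s <= f' s) -> gsum f h t <= gsum f' h t.
Proof.
by move=> h0 fg; apply: ler_sum => s _; rewrite ler_wpM2r// gibbsw_ge0.
Qed.

Lemma gsum_null f h t : nonneg_field h -> gpart h t = 0 -> gsum f h t = 0.
Proof.
move=> h0 /psumr_eq0P/= H; apply: big1 => s _.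
have := H _ s isT; rewrite mul1r => -> => [|s' _]; first by rewrite mulr0.
by rewrite mul1r gibbsw_ge0.
Qed.

Lemma gpart_gt0_indep h t r : nonneg_field h -> 0 < gpart h t -> 0 < gpart h r.
Proof.
move=> h0 Z0; rewrite lt0r gpart_ge0// andbT; apply/eqP => /psumr_eq0P/= H.
move: Z0; rewrite /gsum big1 ?ltxx// => s _; rewrite mul1r.
have {}H : gibbsw h r s = 0.
  have := H _ s isT; rewrite mul1r; apply=> s' _.
  by rewrite mul1r gibbsw_ge0.
move/eqP : H; rewrite /gibbsw mulf_eq0 => /orP[/eqP ->|]; first by rewrite mul0r.
rewrite prodf_seq_eq0 => /hasP[a _] /=.
by rewrite gt_eqF// clausew_gt0.
Qed.

Lemma prod_pin h u b s :
  \prod_v pin h u b v (s v) = (s u == b)%:R * \prod_v h v (s v).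
Proof.
rewrite (bigD1 u)//= [in RHS](bigD1 u)//= /pin eqxx mulrA [_%:R * _]mulrC.
by congr (_ * _); apply: eq_bigr => v /negbTE ->.
Qed.

Lemma gsum_pin f h u b t :
  gsum f (pin h u b) t = gsum (fun s => f s * (s u == b)%:R) h t.
Proof.
by apply: eq_bigr => s _; rewrite /gibbsw prod_pin -!mulrA.
Qed.

Lemma gsum_pinD f h u b t :
  gsum f h t = gsum f (pin h u b) t + gsum f (pin h u (~~ b)) t.
Proof.
rewrite !gsum_pin -big_split; apply: eq_bigr => s _ /=.
by rewrite -mulrDl -mulrDr; case: (s u); case: b; rewrite /= ?addr0 ?add0r mulr1.
Qed.

Definition pins h L := foldl (fun h l => pin h l.1 l.2) h L.

Lemma nonneg_pins h L : nonneg_field h -> nonneg_field (pins h L).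
Proof. by elim: L h => //= l L IH h h0; apply/IH/nonneg_pin. Qed.

Lemma gsum_pins f h L t : gsum f (pins h L) t =
  gsum (fun s => f s * (all (fun l => s l.1 == l.2) L)%:R) h t.
Proof.
elim: L h f => [|[u b] L IH] h f /=.
  by apply: eq_bigr => s _; rewrite mulr1.
rewrite IH gsum_pin; apply: eq_bigr => s _; congr (_ * _).
by rewrite -mulrA andbC -natrM mulnb.
Qed.

Lemma gpart_pins_le h L t : nonneg_field h -> gpart (pins h L) t <= gpart h t.
Proof.
move=> h0; rewrite gsum_pins; apply: le_gsum => // s.
by rewrite mul1r; case: all.
Qed.

Lemma pin_null f h u b t : h u b = 0 -> gsum f (pin h u b) t = 0.
Proof.
move=> hu; rewrite gsum_pin; apply: big1 => s _.
have [su|] := eqVneq (s u) b; last by rewrite mulr0 mul0r.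
by rewrite /gibbsw (bigD1 u)//= su hu !mul0r mulr0.
Qed.

(* Changing the field at one vertex moves the Gibbs average of [f] by at most
   [D] at that vertex; the average is never divided out, so that null fields
   need no special treatment. *)
Definition influence_bound f t (D : V -> R) :=
  forall h g v, nonneg_field h -> nonneg_field g ->
  (forall u, u != v -> h u =1 g u) ->
  `|gsum f h t * gpart g t - gsum f g t * gpart h t| <=
    D v * (gpart h t * gpart g t).

(** One literal is pinned at a time. The average under the opposite pin is within [D u] of the
    average under the pin, which induction compares with the fully pinned one. The factor
    [gpart h t - gpart (pins h L) t], the mass that pinning discards, is kept because [clause_bound]
    cancels it against a denominator. *)
Lemma pins_bound f t D h v b L : (forall v, 0 <= D v) -> influence_bound f t D ->
  nonneg_field h -> h v (~~ b) = 0 ->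
  `|gsum f h t * gpart (pins h L) t - gsum f (pins h L) t * gpart h t| <=
  (\sum_(l <- L | l.1 != v) D l.1) *
    (gpart (pins h L) t * (gpart h t - gpart (pins h L) t)).
Proof.
move=> D0 tD; elim: L h => [|[u e] L IH] h h0 hv /=.
  by rewrite big_nil mul0r subrr normr0.
set h1 := pin h u e; set h0' := pin h u (~~ e).
have h1P : nonneg_field h1 by exact: nonneg_pin.
have h0P : nonneg_field h0' by exact: nonneg_pin.
have h1v : h1 v (~~ b) = 0 by rewrite /h1 /pin; case: ifP; rewrite hv ?mul0r.
have {IH} := IH h1 h1P h1v.
set K := \sum_(l <- L | _) _; set ZL := gpart (pins h1 L) t.
set AL := gsum f (pins h1 L) t.
have K0 : 0 <= K by rewrite /K; apply: sumr_ge0 => l _; exact: D0.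
have ZL0 : 0 <= ZL by apply/gpart_ge0/nonneg_pins.
have ZL1 : ZL <= gpart h1 t by exact: gpart_pins_le.
rewrite big_cons (gsum_pinD f h u e) (gsum_pinD (fun=> 1) h u e) -/h1 -/h0'.
have : K <= (if u != v then D u + K else K) by case: ifP => _; rewrite ?lerDr.
set K' := (if _ then _ else _) => KK'.
set A1 := gsum f h1 t; set Z1 := gpart h1 t in ZL1 *.
set A0 := gsum f h0' t; set Z0 := gpart h0' t => H1.
have Z00 : 0 <= Z0 by exact: gpart_ge0.
have [ZLz|ZLp] := eqVneq ZL 0.
  have -> : AL = 0 by apply: gsum_null => //; exact: nonneg_pins.
  by rewrite ZLz mul0r mulr0 mul0r subrr normr0 mulr0.
have {}ZLp : 0 < ZL by rewrite lt0r ZLp.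
have Z1p : 0 < Z1 by exact: lt_le_trans ZL1.
suff H0 : `|A0 * ZL - AL * Z0| <= K' * (ZL * Z0).
  rewrite (_ : _ - _ = (A1 * ZL - AL * Z1) + (A0 * ZL - AL * Z0)); last by ring.
  apply: (le_trans (ler_normD _ _)).
  rewrite (_ : K' * (ZL * (Z1 + Z0 - ZL)) = K' * (ZL * (Z1 - ZL)) + K' * (ZL * Z0)); last by ring.
  apply: lerD => //; apply: (le_trans H1); apply: ler_wpM2r => //.
  by rewrite mulr_ge0// subr_ge0.
(* At [v] the field already fixes the spin, so one of the two pins has no mass and [v] contributes
   nothing to the bound. *)
have [uv|uv] := eqVneq u v.
  have [eb|eb] := eqVneq e b.
    have z0 f' : gsum f' h0' t = 0 by apply: pin_null; rewrite uv eb.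
    by rewrite /A0 /Z0 !z0 mul0r !mulr0 subrr normr0.
  have : Z1 = 0.
    apply: pin_null; rewrite uv -hv; congr (h v _).
    by move: eb; case: (e); case: (b).
  by move=> z; rewrite z ltxx in Z1p.
have H2 : `|A0 * Z1 - A1 * Z0| <= D u * (Z0 * Z1).
  by apply: tD => // w /negbTE wu e'; rewrite /h0' /h1 /pin wu.
have K'E : K' = D u + K by rewrite /K' uv.
rewrite -(ler_pM2r Z1p) -[X in _ * X <= _](gtr0_norm Z1p) -normrM.
rewrite (_ : _ * Z1 = (A0 * Z1 - A1 * Z0) * ZL + Z0 * (A1 * ZL - AL * Z1)); last by ring.
apply: (le_trans (ler_normD _ _)).
rewrite [X in X + _]normrM [X in _ + X]normrM (ger0_norm ZL0) (ger0_norm Z00).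
apply: (@le_trans _ _ (D u * (Z0 * Z1) * ZL + Z0 * (K * (ZL * (Z1 - ZL))))).
  by apply: lerD; [apply: ler_wpM2r | apply: ler_wpM2l].
rewrite K'E -subr_ge0.
rewrite (_ : _ - _ = Z0 * K * ZL * ZL); last by ring.
by rewrite !mulr_ge0.
Qed.

Definition literals a : seq (V * bool) := [seq a j | j <- enum 'I_p].

Lemma satisfiesE a s : satisfies a s = all (fun l => s l.1 == l.2) (literals a).
Proof.
rewrite /satisfies all_map; apply/forallP/allP => H j; last exact: H (mem_enum _ j).
by move=> _; exact: H.
Qed.

Lemma gsum_cons f h a t :
  gsum f h (a :: t) = gsum f h t - c * gsum f (pins h (literals a)) t.
Proof.
rewrite gsum_pins /gsum mulr_sumr -sumrB; apply: eq_bigr => s _.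
rewrite /gibbsw big_cons {1}/clausew satisfiesE; ring.
Qed.

(** A new clause subtracts [c] times the sums pinned at its literals. The new partition function is
    at least the mass discarded by pinning, and this gives the constant [c] where a crude bound
    would give [c / (1 - c)]. *)
Lemma clause_bound f t D h v b a : (forall v, 0 <= D v) ->
  influence_bound f t D -> nonneg_field h -> h v (~~ b) = 0 ->
  `|gsum f h (a :: t) * gpart h t - gsum f h t * gpart h (a :: t)| <=
  c * (\sum_(j | (a j).1 != v) D (a j).1) * (gpart h (a :: t) * gpart h t).
Proof.
move=> D0 tD h0 hv.
have := pins_bound (literals a) D0 tD h0 hv.
rewrite !gsum_cons big_map big_enum_cond/=.
set K := \sum_(j | _) _; set L := literals a.
set A := gsum f h t; set Z := gpart h t; set AL := gsum f _ t; set ZL := gpart _ t.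
have K0 : 0 <= K by apply: sumr_ge0.
have ZL0 : 0 <= ZL by apply/gpart_ge0/nonneg_pins.
have ZLZ : ZL <= Z by exact: gpart_pins_le.
move=> H.
rewrite (_ : _ - _ = c * (A * ZL - AL * Z)); last by ring.
rewrite normrM ger0_norm// -mulrA ler_wpM2l//; apply: (le_trans H).
rewrite ler_wpM2l// mulrC ler_pM// ?subr_ge0//.
by rewrite lerD2l lerN2 ler_piMl// ltW.
Qed.

Definition flip v s : config := [ffun u => if u == v then ~~ s u else s u].

Definition flipc v a : clause :=
  [ffun j => ((a j).1, if (a j).1 == v then ~~ (a j).2 else (a j).2)].

Lemma flipK v : involutive (flip v).
Proof. by move=> s; apply/ffunP => u; rewrite !ffunE; case: eqP; rewrite ?negbK. Qed.

Lemma satisfies_flip v a s : satisfies (flipc v a) s = satisfies a (flip v s).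
Proof.
apply: eq_forallb => j; rewrite !ffunE /=; case: ifP => // _.
by case: (s _); case: (a j).2.
Qed.

Lemma flipc_notin v a : [forall j, (a j).1 != v] -> flipc v a = a.
Proof.
move=> /forallP av; apply/ffunP => j; rewrite ffunE (negbTE (av j)).
by case: (a j).
Qed.

Lemma flipcK1 v a j : (flipc v a j).1 = (a j).1.
Proof. by rewrite ffunE. Qed.

(** Trades a change of the spin at [v] for a change of the clauses: [v] stays pinned to true, and
    its literals are negated. *)
Lemma gsum_flip f h v t : (forall b, h v b = 1) ->
  gsum f (pin h v false) t =
  gsum (f \o flip v) (pin h v true) [seq flipc v a | a <- t].
Proof.
move=> hv; rewrite !gsum_pin /gsum (reindex_inj (can_inj (flipK v))) /=.
apply: eq_bigr => s _; rewrite ffunE eqxx; congr (_ * _ * _).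
  by case: (s v).
rewrite /gibbsw big_map; congr (_ * _).
  apply: eq_bigr => u _; rewrite ffunE; have [->|//] := eqVneq u v.
  by rewrite !hv.
by apply: eq_bigr => a _; rewrite /clausew satisfies_flip.
Qed.

Lemma gsum_perm f h t r : perm_eq t r -> gsum f h t = gsum f h r.
Proof.
by move=> tr; apply: eq_bigr => s _; rewrite /gibbsw (perm_big _ tr).
Qed.

Lemma gsum_cons_unsat f h v t a : h v false = 0 ->
  [exists j, a j == (v, false)] -> gsum f h (a :: t) = gsum f h t.
Proof.
move=> hv /existsP[j /eqP aj]; apply: eq_bigr => s _; rewrite /gibbsw big_cons.
case sv : (s v); last by rewrite (bigD1 v)//= sv hv !mul0r.
rewrite {1}/clausew (_ : satisfies a s = false) ?mulr0 ?subr0 ?mul1r//.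
by apply/negbTE/forallPn; exists j; rewrite aj sv.
Qed.

(** If [v] occurs in [a], then [a] or its flip contains the literal (v, false) and has weight 1 on
    every configuration with [v] true. Exchanging the two therefore amounts to inserting at most one
    clause, hence the single factor [c]. *)
Lemma flip_clause_bound f t D h v a : (forall v, 0 <= D v) ->
  influence_bound f t D -> nonneg_field h -> h v false = 0 -> 0 < gpart h t ->
  `|gsum f h (a :: t) / gpart h (a :: t) -
    gsum f h (flipc v a :: t) / gpart h (flipc v a :: t)| <=
  c * ([exists j, (a j).1 == v]%:R * \sum_(j | (a j).1 != v) D (a j).1).
Proof.
move=> D0 tD h0 hv Z0.
have [/existsP[j /eqP aj]|] := boolP [exists j, (a j).1 == v]; last first.
  rewrite negb_exists => /flipc_notin ->.
  by rewrite subrr normr0 mul0r mulr0.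
rewrite mul1r.
have hv' : h v (~~ true) = 0 by [].
have cb a' := clause_bound a' D0 tD h0 hv'.
have div_bound a' : (forall j, (a' j).1 = (a j).1) ->
    `|gsum f h (a' :: t) / gpart h (a' :: t) - gsum f h t / gpart h t| <=
    c * \sum_(j | (a j).1 != v) D (a j).1.
  move=> a'a; have Za' : 0 < gpart h (a' :: t) by exact: gpart_gt0_indep Z0.
  have ZZ : 0 < gpart h (a' :: t) * gpart h t by rewrite mulr_gt0.
  rewrite -(ler_pM2r ZZ) -[X in _ * X <= _](gtr0_norm ZZ) -normrM.
  rewrite (_ : (_ - _) * _ = gsum f h (a' :: t) * gpart h t - gsum f h t * gpart h (a' :: t)).
    apply: (le_trans (cb a')).
    rewrite le_eqVlt; apply/orP; left; apply/eqP; congr (c * _ * _).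
    by apply: eq_big => [k|k _]; rewrite a'a.
  by field; rewrite !gt_eqF.
case aj2 : (a j).2.
- rewrite (@gsum_cons_unsat f h v t (flipc v a))//; last first.
    by apply/existsP; exists j; rewrite ffunE aj eqxx aj2.
  rewrite (@gsum_cons_unsat (fun=> 1) h v t (flipc v a))//; last first.
    by apply/existsP; exists j; rewrite ffunE aj eqxx aj2.
  exact: div_bound.
- have aex : [exists j, a j == (v, false)].
    by apply/existsP; exists j; rewrite -aj -aj2 -surjective_pairing.
  rewrite distrC (gsum_cons_unsat _ _ hv aex) (gsum_cons_unsat _ _ hv aex).
  by apply: div_bound => k; rewrite flipcK1.
Qed.

End influence.

(** * Influence of a spin as a sum over walks *)

Section decorrelation.
Context {R : realFieldType} {V : finType} {p : nat}.
Variables (c : R) (c0 : 0 <= c) (c1 : c < 1).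
Notation config := {ffun V -> bool}.
Notation clause := {ffun 'I_p -> V * bool}.
Notation index := {ffun 'I_p -> V}.

Definition clause_index (a : clause) : index := [ffun j => (a j).1].

Definition remove_nth (T : Type) k (t : seq T) := take k t ++ drop k.+1 t.

(* A weighted count of the walks from [v] that use each clause of [t] at most
   once; [n] is the size of [t]. *)
Fixpoint influence (delta : V -> R) n (t : seq index) (v : V) : R :=
  delta v + (if n is n'.+1 then
    c * \sum_(k < size t)
      let a := nth [ffun=> v] t k in
      [exists j, a j == v]%:R *
      \sum_(j | a j != v) influence delta n' (remove_nth k t) (a j)
  else 0).

Lemma influence_ge0 delta n t v : (forall v, 0 <= delta v) ->
  0 <= influence delta n t v.
Proof.
move=> d0; elim: n t v => [|n IH] t v /=; first by rewrite addr0.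
rewrite addr_ge0// mulr_ge0// sumr_ge0// => k _.
by rewrite mulr_ge0// sumr_ge0.
Qed.

Lemma telescope_norm (u d : nat -> R) n :
  (forall k, (k < n)%N -> `|u k - u k.+1| <= d k) ->
  `|u 0%N - u n| <= \sum_(k < n) d k.
Proof.
elim: n => [|n IH] H; first by rewrite subrr normr0 big_ord0.
rewrite big_ord_recr /= (_ : _ - _ = (u 0%N - u n) + (u n - u n.+1)); last by ring.
apply: (le_trans (ler_normD _ _)); apply: lerD; last exact: H.
by apply: IH => k kn; apply: H; rewrite ltnS ltnW.
Qed.

Notation gpart h t := (gsum c (fun=> 1) h t).

(** Telescoping: the clauses are flipped one after the other. When the k-th is flipped, the others
    have the same vertices as [remove_nth k t] and differ from it only by signs, so [D] is required
    to depend on the vertices alone. *)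
Lemma flip_clauses_bound (f : config -> R) (D : seq clause -> V -> R) h v t :
  nonneg_field h -> h v false = 0 -> 0 < gpart h t ->
  (forall k, (k < size t)%N -> forall r, map clause_index r =
      map clause_index (remove_nth k t) ->
    (forall v, 0 <= D r v) /\ influence_bound c f r (D r)) ->
  (forall r r', map clause_index r = map clause_index r' -> D r =1 D r') ->
  `|gsum c f h t / gpart h t - gsum c f h (map (flipc v) t) / gpart h (map (flipc v) t)| <=
  \sum_(k < size t) c * ([exists j, clause_index (nth [ffun=> (v, true)] t k) j == v]%:R *
    \sum_(j | clause_index (nth [ffun=> (v, true)] t k) j != v)
       D (remove_nth k t) (clause_index (nth [ffun=> (v, true)] t k) j)).
Proof.
move=> h0 hv Z0 IH Dext.
pose mid k := map (flipc v) (take k t) ++ drop k t.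
pose x0 : clause := [ffun=> (v, true)].
have := @telescope_norm (fun k => gsum c f h (mid k) / gpart h (mid k))
  (fun k => c * ([exists j, clause_index (nth x0 t k) j == v]%:R *
    \sum_(j | clause_index (nth x0 t k) j != v)
       D (remove_nth k t) (clause_index (nth x0 t k) j))) (size t).
have m0 : mid 0%N = t by rewrite /mid take0 drop0.
have mn : mid (size t) = map (flipc v) t.
  by rewrite /mid take_size drop_size cats0.
rewrite /= m0 mn; apply=> k kt.
pose a := nth x0 t k; pose r := map (flipc v) (take k t) ++ drop k.+1 t.
have p1 : perm_eq (mid k) (a :: r).
  by rewrite /mid (drop_nth x0)// -cat_rcons -cats1 -catA perm_catCA /=.
have p2 : perm_eq (mid k.+1) (flipc v a :: r).
  rewrite /mid (take_nth x0)// map_rcons -cats1 -catA perm_catCA /=.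
  by rewrite perm_refl.
rewrite !(gsum_perm c _ _ p1) !(gsum_perm c _ _ p2).
have rE : map clause_index r = map clause_index (remove_nth k t).
  rewrite /r /remove_nth !map_cat -map_comp; congr (_ ++ _).
  by apply: eq_map => b; apply/ffunP => j; rewrite /= !ffunE.
have [D0 rD] := IH k kt r rE.
have := flip_clause_bound c0 c1 a D0 rD h0 hv (gpart_gt0_indep c1 r h0 Z0).
move=> /le_trans; apply; rewrite le_eqVlt; apply/orP; left; apply/eqP.
congr (c * ((nat_of_bool _)%:R * _)).
  by apply: eq_existsb => j; rewrite ffunE.
by apply: eq_big => j; rewrite ffunE// => _; exact: Dext.
Qed.

(** The sums are linear in the two field values at [v]. The cross difference for two fields is
    therefore a 2 by 2 determinant of these values times the cross difference for the two pins. *)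
Lemma influence_bound_pinned f (t : seq clause) (D : V -> R) : (forall v, 0 <= D v) ->
  (forall h v, nonneg_field h -> (forall b, h v b = 1) ->
    `|gsum c f (pin h v true) t * gpart (pin h v false) t -
      gsum c f (pin h v false) t * gpart (pin h v true) t| <=
    D v * (gpart (pin h v true) t * gpart (pin h v false) t)) ->
  influence_bound c f t D.
Proof.
move=> D0 pinned.
move=> h h' v h0 h'0 hh'.
pose g u b := if u == v then 1 else h u b.
have g0 : nonneg_field g by move=> u b; rewrite /g; case: ifP.
have gh k f' : (forall u, u != v -> h u =1 k u) -> gsum c f' k t =
    k v true * gsum c f' (pin g v true) t + k v false * gsum c f' (pin g v false) t.
  move=> hk; rewrite !gsum_pin /gsum !mulr_sumr -big_split; apply: eq_bigr => s _ /=.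
  have -> : gibbsw c k t s = k v (s v) * gibbsw c g t s.
    rewrite /gibbsw mulrA; congr (_ * _).
    rewrite (bigD1 v)//= [in RHS](bigD1 v)//= {1}/g eqxx mul1r; congr (_ * _).
    by apply: eq_bigr => u uv; rewrite /g (negbTE uv) hk.
  by case: (s v); rewrite /= !(mulr0, mulr1, mul0r, addr0, add0r); ring.
have gv b : g v b = 1 by rewrite /g eqxx.
have := pinned g v g0 gv.
rewrite !(gh h)// !(gh h')//.
have : 0 <= gpart (pin g v true) t by apply/gpart_ge0/nonneg_pin.
have : 0 <= gpart (pin g v false) t by apply/gpart_ge0/nonneg_pin.
set A1 := gsum c f _ t; set A2 := gsum c f _ t.
set Z1 := gpart (pin g v true) t; set Z2 := gpart (pin g v false) t => Z20 Z10 H.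
have := h0 v true; have := h0 v false; have := h'0 v true; have := h'0 v false.
move: (h v true) (h v false) (h' v true) (h' v false) => x y x' y' y'0 x'0 y0 x0.
rewrite (_ : _ - _ = (x * y' - y * x') * (A1 * Z2 - A2 * Z1)); last by ring.
rewrite normrM; apply: (@le_trans _ _ ((x * y' + y * x') * (D v * (Z1 * Z2)))).
  apply: ler_pM => //; apply: (le_trans (ler_normB _ _)).
  by rewrite !ger0_norm// mulr_ge0.
rewrite -subr_ge0 (_ : _ - _ = D v * (x * x' * Z1 * Z1 + y * y' * Z2 * Z2)); last by ring.
by rewrite mulr_ge0// addr_ge0// !mulr_ge0.
Qed.

Lemma pinned_flip_bound (f : config -> R) h v (t : seq clause) e d :
  (forall s, `|f s - f (flip v s)| <= e) ->
  nonneg_field h -> (forall b, h v b = 1) ->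
  (0 < gpart (pin h v true) t ->
    `|gsum c f (pin h v true) t / gpart (pin h v true) t -
    gsum c f (pin h v true) (map (flipc v) t) /
      gpart (pin h v true) (map (flipc v) t)| <= d) ->
  `|gsum c f (pin h v true) t * gpart (pin h v false) t -
    gsum c f (pin h v false) t * gpart (pin h v true) t| <=
  (e + d) * (gpart (pin h v true) t * gpart (pin h v false) t).
Proof.
move=> fd h0 hv; rewrite !gsum_flip//; set hp := pin h v true.
have hp0 : nonneg_field hp by exact: nonneg_pin.
have := gpart_ge0 c1 t hp0; rewrite le_eqVlt => /orP[/eqP Z0 _|Z0 /(_ Z0)].
  by rewrite -Z0 (gsum_null c1 _ hp0 (esym Z0)) !(mul0r, mulr0) subrr normr0.
set ft := map (flipc v) t.
have Zf : 0 < gpart hp ft by exact: gpart_gt0_indep Z0.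
have : `|gsum c f hp ft - gsum c (f \o flip v) hp ft| <= e * gpart hp ft.
  rewrite /gsum -sumrB mulr_sumr; apply: (le_trans (ler_norm_sum _ _ _)).
  apply: ler_sum => s _; rewrite mul1r -mulrBl normrM.
  by rewrite (ger0_norm (gibbsw_ge0 c1 _ _ hp0)) ler_wpM2r// gibbsw_ge0.
rewrite (_ : gsum c ((fun=> 1) \o flip v) hp ft = gpart hp ft)//.
move: (gsum c f hp t) (gsum c f hp ft) (gsum c (f \o flip v) hp ft) (gpart hp t) (gpart hp ft) Z0 Zf.
move=> A B B' Z Z' Z0 Z'0 H1 H2.
have ZZ : 0 < Z * Z' by exact: mulr_gt0.
rewrite (_ : _ - _ = (A / Z - B / Z') * (Z * Z') + (B - B') * Z); last first.
  by field; rewrite !gt_eqF.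
apply: (le_trans (ler_normD _ _)); rewrite [leLHS]addrC [leRHS]mulrDl; apply: lerD.
  rewrite normrM (gtr0_norm Z0) (mulrC Z Z') mulrA; apply: ler_wpM2r => //.
  exact: ltW.
by rewrite normrM (gtr0_norm ZZ); apply: ler_wpM2r => //; exact: ltW.
Qed.

Lemma influence_ext delta n t v : influence delta n t v = delta v +
  (if n is n'.+1 then
    \sum_(k < size t) c * (
      [exists j, nth [ffun=> v] t k j == v]%:R *
      \sum_(j | nth [ffun=> v] t k j != v)
        influence delta n' (remove_nth k t) (nth [ffun=> v] t k j))
  else 0).
Proof. by case: n => //= n; rewrite mulr_sumr. Qed.

(** Induction on the number of clauses: a flip at [v] acts through a clause that contains [v] on the
    other vertices of this clause, and their influence is measured in the system from which the
    clause has been removed. *)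
Lemma influence_boundP (f : config -> R) delta : (forall v, 0 <= delta v) ->
  (forall v s, `|f s - f (flip v s)| <= delta v) ->
  forall n t, size t = n ->
  influence_bound c f t (influence delta n [seq clause_index a | a <- t]).
Proof.
move=> d0 fd; elim=> [|n IH] t tn; apply: influence_bound_pinned.
- by move=> v; exact: influence_ge0.
- move=> h v h0 hv; apply: pinned_flip_bound => // _.
  by move/size0nil : tn => -> /=; rewrite subrr normr0.
- by move=> v; exact: influence_ge0.
move=> h v h0 hv; rewrite influence_ext; apply: pinned_flip_bound => // Z0.
have hp0 : nonneg_field (pin h v true) by exact: nonneg_pin.
have hpv : pin h v true v false = 0 by rewrite /pin eqxx mulr0.
apply: le_trans (flip_clauses_bound
  (D := fun r => influence delta n (map clause_index r)) hp0 hpv Z0 _ _) _.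
- move=> k kt r rE; split=> [u|]; first exact: influence_ge0.
  apply: IH; have := congr1 size rE; rewrite !size_map => ->.
  rewrite /remove_nth size_cat size_take size_drop kt tn; lia.
- by move=> r r' ->.
rewrite size_map le_eqVlt; apply/orP; left; apply/eqP; apply: eq_bigr => k _.
rewrite (nth_map [ffun=> (v, true)])//.
by rewrite /remove_nth !map_cat map_take map_drop.
Qed.

End decorrelation.
Lemma sum_ffun_marginal (R : comPzRingType) (J T : finType) (g : T -> R) (j : J) :
  #|T|%:R * (\sum_(a : {ffun J -> T}) g (a j)) =
  #|{ffun J -> T}|%:R * \sum_x g x.
Proof.
pose F (j' : J) (x : T) := if j' == j then g x else 1.
have : \prod_j' \sum_x F j' x = \sum_(a : {ffun J -> T}) \prod_j' F j' (a j').
  exact: bigA_distr_bigA.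
rewrite (bigD1 j)//= [in LHS]/F eqxx => H.
rewrite [X in _ * X = _](eq_bigr (fun f : {ffun J -> T} => \prod_i F i (f i))); last first.
  move=> a _; rewrite (bigD1 j)//= /F eqxx big1 ?mulr1// => i.
  by move=> /negbTE ->.
rewrite -H card_ffun (cardD1 j) inE /= add1n expnS natrM -mulrA; congr (_ * _).
rewrite mulrC; congr (_ * _).
rewrite (eq_bigr (fun=> #|T|%:R)); last first.
  by move=> i /negbTE ij; rewrite -sum1_card natr_sum; apply: eq_bigr => x _; rewrite /F ij.
rewrite prodr_const natrX; congr (_ ^+ _).
by apply: eq_card => i; rewrite !inE andbT.
Qed.

(** Extracting the k-th entry is a bijection onto pairs of an entry and a shorter tuple; in
    probabilistic terms, the removed clause is independent of the others, for each of the [m.+1]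
    positions. *)
Lemma sum_tuple_remove (V : nmodType) (I : finType) m (x0 : I) (F : I -> seq I -> V) :
  \sum_(t : m.+1.-tuple I) \sum_(k < m.+1) F (nth x0 t k) (remove_nth k t) =
  (\sum_(a : I) \sum_(t : m.-tuple I) F a t) *+ m.+1.
Proof.
rewrite exchange_big /= -[m.+1 in RHS]card_ord -sumr_const.
apply: eq_bigr => k _; move: (nat_of_ord k) (ltn_ord k) => {}k.
elim: k m F => [|k IH] m F km; rewrite sum_tuple_cons.
  apply: eq_bigr => a _; apply: eq_bigr => t _.
  by rewrite /remove_nth /= drop0.
case: m km => // m km.
rewrite [RHS](eq_bigr (fun a => \sum_i \sum_(t : m.-tuple I) F a (i :: t))); last first.
  by move=> a _; rewrite sum_tuple_cons.
rewrite [RHS]exchange_big /=; apply: eq_bigr => i _.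
by rewrite -(IH m (fun a t => F a (i :: t))).
Qed.

(** * Mean influence and covariances over random clauses *)

Section expected_influence.
Context {R : realFieldType} {V : finType} {p : nat}.
Variables (c : R) (c0 : 0 <= c) (c1 : c < 1).
Notation config := {ffun V -> bool}.
Notation clause := {ffun 'I_p -> V * bool}.
Notation index := {ffun 'I_p -> V}.

(** A walk leaves through some slot [j] of its first clause, and its starting vertex sits in one of
    the [p.-1] other slots; summing over the start thus costs this factor. *)
Lemma sum_influence delta n (t : seq index) (x0 : index) :
  (forall v, 0 <= delta v) -> size t = n.+1 ->
  \sum_v influence c delta n.+1 t v <= \sum_v delta v +
    c * (p.-1)%:R * \sum_(k < n.+1) \sum_j
      influence c delta n (remove_nth k t) (nth x0 t k j).
Proof.
move=> d0 tn; rewrite /= big_split /= lerD2l -mulr_sumr -mulrA ler_wpM2l//.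
rewrite exchange_big /= tn mulr_sumr; apply: ler_sum => k _.
rewrite (eq_bigr (fun v => \sum_j ([exists j', nth x0 t k j' == v] && (nth x0 t k j != v))%:R *
    influence c delta n (remove_nth k t) (nth x0 t k j))); last first.
  move=> v _; rewrite (set_nth_default x0) ?tn// mulr_sumr big_mkcond /=.
  apply: eq_bigr => j _; rewrite -mulnb natrM -mulrA.
  by case: ifP => _; rewrite ?mul1r ?mul0r ?mulr0.
rewrite exchange_big /= mulr_sumr; apply: ler_sum => j _.
rewrite -mulr_suml; apply: ler_wpM2r; first exact: influence_ge0.
set a := nth x0 t k.
apply: (@le_trans _ _ (\sum_v \sum_(j' | j' != j) (a j' == v)%:R)).
  apply: ler_sum => v _.
  have [/andP[/existsP[j' /eqP aj'] ajv]|_] := boolP (_ && _); last by rewrite sumr_ge0.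
  rewrite (bigD1 j')/= ?aj' ?eqxx ?lerDl ?sumr_ge0//.
  by apply: contraNneq ajv => <-; rewrite aj'.
rewrite exchange_big /= (eq_bigr (fun=> 1)); last first.
  move=> j' _; rewrite (bigD1 (a j'))//= eqxx big1 ?addr0// => v.
  by rewrite eq_sym => /negbTE ->.
by rewrite sumr_const (eq_card (B := predC1 j))// cardC1 card_ord.
Qed.

(* Bounds the mean of [influence] over [m] independent uniform clauses: a walk
   has [m] choices for its first clause, [m - 1] for the next, and so on. *)
Fixpoint walk_count (D r : R) m : R :=
  D + (if m is m'.+1 then m%:R * r * walk_count D r m' else 0).

(** The clause removed by the first step is uniform and independent of the rest, so each of its [p]
    slots restarts the walk at a uniform vertex. Together with the [p.-1] slots of the start, a step
    has weight [c * (p * p.-1)%:R / #|V|%:R] per available clause. *)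
Lemma sum_tuple_influence delta m : (0 < #|V|)%N -> (forall v, 0 <= delta v) ->
  \sum_(t : m.-tuple clause) \sum_v
    influence c delta m (map (@clause_index V p) t) v <=
  #|clause|%:R ^+ m *
    walk_count (\sum_v delta v) (c * (p * p.-1)%:R / #|V|%:R) m.
Proof.
move=> V0 d0; have V0' : (#|V|%:R : R) != 0 by rewrite pnatr_eq0 -lt0n.
elim: m => [|m IH].
  rewrite expr0 mul1r /= addr0 (big_pred1 [tuple]) => [|t].
    by apply: ler_sum => v _; rewrite /= addr0.
  by rewrite (tuple0 t) /=; apply/esym/eqP/val_inj.
set X := \sum_(t : m.-tuple clause) _ in IH.
have [v0 _] : exists v : V, v \in V by apply/card_gt0P.
pose x0 : clause := [ffun=> (v0, true)].
apply: (@le_trans _ _ (\sum_(t : m.+1.-tuple clause) (\sum_v delta v +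
  c * (p.-1)%:R * \sum_(k < m.+1) \sum_j influence c delta m
    (map (@clause_index V p) (remove_nth k t)) (nth x0 t k j).1))).
  apply: ler_sum => t _.
  apply: le_trans (sum_influence (clause_index x0) d0 _) _.
    by rewrite size_map size_tuple.
  rewrite lerD2l le_eqVlt; apply/orP; left; apply/eqP; congr (_ * _).
  apply: eq_bigr => k _; apply: eq_bigr => j _.
  rewrite (nth_map x0) ?size_tuple// ffunE.
  by rewrite /remove_nth map_cat map_take map_drop.
rewrite big_split /= sumr_const card_tuple -mulr_sumr.
rewrite (@sum_tuple_remove _ _ m x0 (fun a t => \sum_j
   influence c delta m (map (@clause_index V p) t) (a j).1)).
have -> : \sum_(a : clause) \sum_(t : m.-tuple clause) \sum_j
   influence c delta m (map (@clause_index V p) t) (a j).1 =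
   p%:R * (#|clause|%:R / #|V|%:R) * X.
  rewrite exchange_big /= /X mulr_sumr; apply: eq_bigr => t _.
  rewrite exchange_big /= (eq_bigr (fun=> (#|clause|%:R / #|V|%:R) *
     \sum_v influence c delta m (map (@clause_index V p) t) v)); last first.
    move=> j _; set g := influence _ _ _ _.
    have := sum_ffun_marginal (fun x : V * bool => g x.1) j.
    rewrite card_prod card_bool natrM /=.
    have -> : \sum_(x : V * bool) g x.1 = (\sum_v g v) * 2%:R.
      rewrite -(pair_bigA _ (fun (v : V) (b : bool) => g v)) /= mulr_suml.
      by apply: eq_bigr => v _; rewrite sumr_const card_bool mulr_natr.
    by move=> H; apply: (mulfI V0'); apply: (@mulIf _ 2%:R);
      rewrite ?pnatr_eq0// mulrAC H; field.
  by rewrite sumr_const card_ord -[LHS]mulr_natl mulrA.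
rewrite mulrDr -[X in X + _]mulr_natl natrX lerD2l.
rewrite [leLHS](_ : _ = #|clause|%:R * (m.+1%:R * (c * (p * p.-1)%:R / #|V|%:R)) * X); last first.
  by rewrite -[X in _ * X]mulr_natl natrM; field.
rewrite [leRHS](_ : _ = #|clause|%:R * (m.+1%:R * (c * (p * p.-1)%:R / #|V|%:R)) *
  (#|clause|%:R ^+ m * walk_count (\sum_v delta v) (c * (p * p.-1)%:R / #|V|%:R) m)).
  by apply: ler_wpM2l; [rewrite !mulr_ge0 ?invr_ge0 ?ler0n | exact: IH].
by rewrite exprS; ring.
Qed.

Definition one_field (v : V) (b : bool) : R := 1.
Definition gibbs_avg f (t : seq clause) : R :=
  gsum c f one_field t / gsum c (fun=> 1) one_field t.
Definition spinw v (s : config) : R := (s v)%:R.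
Definition covsum (t : seq clause) : R := \sum_v \sum_w
  `|gibbs_avg (fun s => spinw v s * spinw w s) t -
    gibbs_avg (spinw v) t * gibbs_avg (spinw w) t|.

Lemma one_fieldP : nonneg_field one_field.
Proof. by move=> v b; rewrite /one_field. Qed.

Lemma gpart_one_gt0 (t : seq clause) : 0 < gsum c (fun=> 1) one_field t.
Proof.
apply: (gpart_gt0_indep c1 (t := [::])); first exact: one_fieldP.
rewrite /gsum (eq_bigr (fun=> 1)); last first.
  by move=> s _; rewrite /gibbsw big_nil big1 ?mulr1.
by rewrite sumr_const ltr0n card_ffun card_bool expn_gt0.
Qed.

(** Times the square of the partition function, the covariance is the cross difference of the sums
    of [spinw w] under the two pins of [v]. The product of the two pinned masses is at most that
    square. *)
Lemma cov_influence v w (t : seq clause) :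
  `|gibbs_avg (fun s => spinw v s * spinw w s) t -
    gibbs_avg (spinw v) t * gibbs_avg (spinw w) t| <=
  influence c (fun u => (u == w)%:R) (size t) (map (@clause_index V p) t) v.
Proof.
have H : forall (u : V) s, `|spinw w s - spinw w (flip u s)| <= (u == w)%:R.
  move=> u s; rewrite /spinw ffunE eq_sym; case: eqP => _; last by rewrite subrr normr0.
  by case: (s w); rewrite /= ?subr0 ?sub0r ?normrN normr1.
have dw0 (u : V) : 0 <= (u == w)%:R :> R by [].
have h1 : nonneg_field (pin one_field v true) by apply: nonneg_pin; exact: one_fieldP.
have h2 : nonneg_field (pin one_field v false) by apply: nonneg_pin; exact: one_fieldP.
set D := influence _ _ _ _ v.
have : `|gsum c (spinw w) (pin one_field v true) t * gsum c (fun=> 1) (pin one_field v false) t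
   - gsum c (spinw w) (pin one_field v false) t * gsum c (fun=> 1) (pin one_field v true) t|
   <= D * (gsum c (fun=> 1) (pin one_field v true) t *
           gsum c (fun=> 1) (pin one_field v false) t).
  by apply: (influence_boundP c0 c1 dw0 H) => // u uv b; rewrite /pin (negbTE uv).
have D0 : 0 <= D by exact: influence_ge0.
have CE : gsum c (spinw w) (pin one_field v true) t =
    gsum c (fun s => spinw v s * spinw w s) one_field t.
  rewrite gsum_pin; apply: eq_bigr => s _; congr (_ * _); rewrite mulrC.
  by congr (_ * _); rewrite /spinw; case: (s v).
have BE : gsum c (fun=> 1) (pin one_field v true) t = gsum c (spinw v) one_field t.
  rewrite gsum_pin; apply: eq_bigr => s _; congr (_ * _); rewrite mul1r.
  by rewrite /spinw; case: (s v).
have AE := gsum_pinD c (spinw w) one_field v true t.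
have ZE := gsum_pinD c (fun=> 1) one_field v true t.
have B0 : 0 <= gsum c (fun=> 1) (pin one_field v true) t by exact: gpart_ge0.
have B'0 : 0 <= gsum c (fun=> 1) (pin one_field v false) t by exact: gpart_ge0.
rewrite /gibbs_avg; have := gpart_one_gt0 t; rewrite ZE AE /= -CE -BE.
move: (gsum c (spinw w) (pin one_field v true) t) (gsum c (spinw w) (pin one_field v false) t).
move: (gsum c _ (pin one_field v true) t) (gsum c _ (pin one_field v false) t) B0 B'0.
move=> B B' B0 B'0 C C' Z0 H1.
have ZZ : 0 < (B + B') * (B + B') by rewrite mulr_gt0.
rewrite -(ler_pM2r ZZ) -[X in _ * X <= _](gtr0_norm ZZ) -normrM.
rewrite (_ : (_ - _) * _ = C * B' - C' * B); last by field; rewrite gt_eqF.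
apply: (le_trans H1); rewrite ler_wpM2l// -subr_ge0.
rewrite (_ : _ - _ = B * B + B' * B' + B * B'); last by ring.
by rewrite !addr_ge0// mulr_ge0.
Qed.

Lemma sum_tuple_covsum m : (0 < #|V|)%N ->
  \sum_(t : m.-tuple clause) covsum t <=
  #|clause|%:R ^+ m *
    (#|V|%:R * walk_count 1 (c * (p * p.-1)%:R / #|V|%:R) m).
Proof.
move=> V0.
apply: (@le_trans _ _ (\sum_(t : m.-tuple clause) \sum_w \sum_v
    influence c (fun u => (u == w)%:R) m (map (@clause_index V p) t) v)).
  apply: ler_sum => t _; rewrite /covsum exchange_big /=.
  apply: ler_sum => w _; apply: ler_sum => v _.
  by have := cov_influence v w t; rewrite size_tuple.
rewrite exchange_big /= mulrCA.
have -> : #|V|%:R * (#|clause|%:R ^+ m * walk_count 1 (c * (p * p.-1)%:R / #|V|%:R) m) =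
   \sum_(w : V) (#|clause|%:R ^+ m * walk_count 1 (c * (p * p.-1)%:R / #|V|%:R) m).
  by rewrite sumr_const -[RHS]mulr_natl.
apply: ler_sum => w _.
have -> : walk_count 1 (c * (p * p.-1)%:R / #|V|%:R) m =
    walk_count (\sum_(u : V) (u == w)%:R) (c * (p * p.-1)%:R / #|V|%:R) m.
  congr walk_count; rewrite (bigD1 w)//= eqxx big1 ?addr0// => u.
  by move=> /negbTE ->.
exact: sum_tuple_influence.
Qed.

End expected_influence.

(** * The interpolation bound *)
Lemma weighted_AMGM (R : realFieldType) q (x y : R) : 0 <= x -> 0 <= y ->
  0 <= x ^+ q.+1 - q.+1%:R * (x * y ^+ q) + q%:R * y ^+ q.+1.
Proof.
move=> x0 y0; elim: q => [|q IH].
  by rewrite !expr1 expr0 mulr1 mul1r mul0r subrr addr0.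
rewrite (_ : _ + _ = x * (x ^+ q.+1 - q.+1%:R * (x * y ^+ q) + q%:R * y ^+ q.+1)
  + q.+1%:R * (y ^+ q * (x - y) ^+ 2)); last first.
  by rewrite !exprS -(natr1 q.+1) -(natr1 q); ring.
apply: addr_ge0; apply: mulr_ge0 => //.
by apply: mulr_ge0; [exact: exprn_ge0 | exact: sqr_ge0].
Qed.

(** * Uniform truncation of the logarithmic series *)

Section log_series.
Context {R : realType}.

(** The derivative of the polynomial is a finite geometric sum, which cancels all of -1 / (1 - x)
    but its tail. *)
Lemma is_derive_ln_remainder M (x : R) : x < 1 ->
  is_derive x 1 (fun x : R => ln (1 - x) + \sum_(n < M) x ^+ n.+1 / n.+1%:R)
    (- (x ^+ M / (1 - x))).
Proof.
move=> x1; have x0 : 1 - x != 0 by rewrite subr_eq0 eq_sym lt_eqF.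
elim: M => [|M IH].
  rewrite (_ : (fun x : R => _) = @ln R \o (fun x => 1 - x)); last first.
    by apply/funext => y /=; rewrite big_ord0 addr0.
  have l : is_derive (1 - x) 1 (@ln R) (1 - x)^-1.
    by apply: is_derive1_ln; rewrite subr_gt0.
  have l' : is_derive x 1 (fun x : R => 1 - x) (-1).
    by rewrite -[X in is_derive _ _ _ X]sub0r; apply: is_deriveB.
  have := @is_derive1_comp R (@ln R) (fun x => 1 - x) x _ _ l l'.
  by rewrite mulrN1 expr0 mul1r.
rewrite (_ : (fun x : R => _) = (fun x : R => ln (1 - x) + \sum_(n < M) x ^+ n.+1 / n.+1%:R)
   + (M.+1%:R^-1 : R) *: (fun x : R => x ^+ M.+1)); last first.
  apply/funext => y; rewrite big_ord_recr /= addrA; congr (_ + _).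
  by rewrite /GRing.scale /= mulrC.
have d1 : is_derive x 1 (fun x : R => x ^+ M.+1) (M.+1%:R *: x ^+ M).
    have := @is_deriveX R R id M.+1 x 1 1 (is_derive_id x 1).
    rewrite (_ : id ^+ M.+1 = fun x : R => x ^+ M.+1); last by rewrite exprfctE.
    by rewrite /GRing.scale /= mulr1.
apply: is_derive_eq.
by rewrite /GRing.scale /= mulKf ?pnatr_eq0// exprS; field.
Qed.

Lemma ln1B_remainder (c y : R) M : c < 1 -> 0 <= y -> y <= c ->
  `|ln (1 - y) + \sum_(n < M) y ^+ n.+1 / n.+1%:R| <= c ^+ M / (1 - c).
Proof.
move=> c1 y0 yc.
have c0 : 0 <= c by exact: le_trans yc.
have y1 : y < 1 by exact: le_lt_trans c1.
pose f x : R := ln (1 - x) + \sum_(n < M) x ^+ n.+1 / n.+1%:R.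
have fd (x : R) : x < 1 -> is_derive x 1 f (- (x ^+ M / (1 - x))).
  exact: is_derive_ln_remainder.
have [x||] := @MVT_segment R f (fun x => - (x ^+ M / (1 - x))) 0 y y0.
- by rewrite in_itv /= => /andP[_ xy]; apply: fd; exact: lt_trans y1.
- apply: derivable_within_continuous => x; rewrite in_itv /= => /andP[_ xy].
  by case: (fd x (le_lt_trans xy y1)).
move=> x; rewrite in_itv /= => /andP[x0 xy].
have -> : f 0 = 0.
  rewrite /f subr0 ln1 add0r big1// => n _; rewrite exprS !mul0r //.
rewrite !subr0 => fy; rewrite -/(f y) fy mulNr normrN.
have xc : x <= c by exact: le_trans yc.
have x1 : x < 1 by exact: le_lt_trans c1.
rewrite ger0_norm; last by rewrite !mulr_ge0 ?exprn_ge0 ?invr_ge0// subr_ge0 ltW.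
rewrite -[leRHS]mulr1; apply: ler_pM => //; last exact: ltW.
  by rewrite !mulr_ge0 ?exprn_ge0 ?invr_ge0// subr_ge0 ltW.
apply: ler_pM.
- exact: exprn_ge0.
- by rewrite invr_ge0 subr_ge0 ltW.
- by apply: lerXn2r => //; rewrite nnegrE.
- by rewrite lef_pV2 ?posrE ?subr_gt0// lerD2l lerN2.
Qed.

Lemma cvg_ln_remainder (c : R) : 0 <= c -> c < 1 ->
  forall e, 0 < e -> exists M, c ^+ M / (1 - c) <= e.
Proof.
move=> c0 c1 e e0.
have : c ^+ n @[n --> \oo] --> (0 : R) by apply: cvg_expr; rewrite ger0_norm.
have e1 : 0 < e * (1 - c) by rewrite mulr_gt0// subr_gt0.
move=> /cvgr0_norm_le /(_ _ e1) [M _ /(_ M)] /= /(_ (leqnn M)).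
rewrite ger0_norm ?exprn_ge0// => H; exists M.
by rewrite ler_pdivrMr// subr_gt0.
Qed.

End log_series.
Lemma sum_ffun_prod (R : comPzRingType) (J T : finType) (F : T -> R) :
  \sum_(a : {ffun J -> T}) \prod_j F (a j) = (\sum_x F x) ^+ #|J|.
Proof.
rewrite -[RHS]prodr_const -[RHS](big_enum_cond _ _ predT) /= big_enum.
by rewrite (bigA_distr_bigA (fun _ => F)).
Qed.

Lemma expr_sum_ffun (R : comPzRingType) (T : finType) (F : T -> R) n :
  (\sum_x F x) ^+ n = \sum_(a : {ffun 'I_n -> T}) \prod_j F (a j).
Proof. by rewrite sum_ffun_prod card_ord. Qed.

(** * The generator inequality of the interpolation *)

Section franz_leone.
Context {R : realType} {W X Y : finType} {q : nat}.
Variables (c : R) (c0 : 0 <= c) (c1 : c < 1).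
Variables (g : W -> R) (g0 : forall s, 0 <= g s) (g1 : \sum_s g s = 1).
Variables (mu : X -> R) (mu0 : forall x, 0 <= mu x) (mu1 : \sum_x mu x = 1).
Variables (nu : Y -> R) (nu0 : forall y, 0 <= nu y) (nu1 : \sum_y nu y = 1).
Variables (h : X -> W -> R) (h01 : forall x s, 0 <= h x s <= 1).
Variables (k : Y -> R) (k01 : forall y, 0 <= k y <= 1).

(** Averages of clauses with all, one or none of their slots in the system, the other slots carrying
    external points. *)
Let full (a : {ffun 'I_q.+1 -> X}) := \sum_s g s * \prod_j h (a j) s.
Let mixed (x : X) (b : {ffun 'I_q -> Y}) := (\sum_s g s * h x s) * \prod_j k (b j).
Let free (b : {ffun 'I_q.+1 -> Y}) := \prod_j k (b j).

(* The moments of the clause averages are computed with [n] replicas; [Q] is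
   the multi-overlap and [m] its counterpart for the external law. *)
Lemma franz_leone_moment n :
  0 <= (\sum_(a : {ffun 'I_q.+1 -> X}) (\prod_j mu (a j)) * full a ^+ n)
     - q.+1%:R * (\sum_x \sum_(b : {ffun 'I_q -> Y}) mu x * (\prod_j nu (b j)) * mixed x b ^+ n)
     + q%:R * (\sum_(b : {ffun 'I_q.+1 -> Y}) (\prod_j nu (b j)) * free b ^+ n).
Proof.
pose Q (t : {ffun 'I_n -> W}) := \sum_x mu x * \prod_l h x (t l).
pose m := \sum_y nu y * k y ^+ n.
pose G (t : {ffun 'I_n -> W}) := \prod_l g (t l).
have Q0 t : 0 <= Q t.
  apply: sumr_ge0 => x _; rewrite mulr_ge0//; apply: prodr_ge0 => l _.
  by case/andP : (h01 x (t l)).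
have m0 : 0 <= m.
  apply: sumr_ge0 => y _; rewrite mulr_ge0// exprn_ge0//.
  by case/andP : (k01 y).
have G1 : \sum_t G t = 1 by rewrite sum_ffun_prod g1 expr1n.
have E1 : \sum_(a : {ffun 'I_q.+1 -> X}) (\prod_j mu (a j)) * full a ^+ n = \sum_t G t * Q t ^+ q.+1.
  under eq_bigr do rewrite /full expr_sum_ffun mulr_sumr.
  rewrite exchange_big /=; apply: eq_bigr => t _.
  rewrite -[X in Q t ^+ X]card_ord -sum_ffun_prod mulr_sumr.
  apply: eq_bigr => a _; rewrite [in LHS]big_split [in RHS]big_split /= mulrCA; congr (_ * (_ * _)).
  by rewrite exchange_big.
have E2 : \sum_x \sum_(b : {ffun 'I_q -> Y}) mu x * (\prod_j nu (b j)) * mixed x b ^+ n =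
    (\sum_t G t * Q t) * m ^+ q.
  under eq_bigr do under eq_bigr do rewrite /mixed exprMn mulrACA.
  under eq_bigr do rewrite -mulr_sumr.
  rewrite -mulr_suml; congr (_ * _).
    under eq_bigr do rewrite expr_sum_ffun mulr_sumr.
    rewrite exchange_big /=; apply: eq_bigr => t _.
    rewrite /Q mulr_sumr; apply: eq_bigr => x _.
    by rewrite big_split /= mulrCA.
  rewrite -[q in RHS]card_ord -sum_ffun_prod; apply: eq_bigr => b _.
  by rewrite -prodrXl big_split.
have E3 : \sum_(b : {ffun 'I_q.+1 -> Y}) (\prod_j nu (b j)) * free b ^+ n = m ^+ q.+1.
  rewrite -[q.+1 in RHS]card_ord -sum_ffun_prod; apply: eq_bigr => b _.
  by rewrite /free -prodrXl big_split.
have E2' : (\sum_t G t * Q t) * m ^+ q = \sum_t G t * (Q t * m ^+ q).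
  by rewrite mulr_suml; apply: eq_bigr => t _; rewrite mulrA.
have E3' : m ^+ q.+1 = \sum_t G t * m ^+ q.+1 by rewrite -mulr_suml G1 mul1r.
rewrite E1 E2 E2' E3 E3' !mulr_sumr -sumrB -big_split /=.
apply: sumr_ge0 => t _.
rewrite (_ : _ + _ = G t * (Q t ^+ q.+1 - q.+1%:R * (Q t * m ^+ q) + q%:R * m ^+ q.+1)); last by ring.
by rewrite mulr_ge0 ?weighted_AMGM// prodr_ge0.
Qed.

Lemma sum_remainder (I : finType) (w z : I -> R) M : (forall i, 0 <= w i) ->
  \sum_i w i = 1 -> (forall i, 0 <= z i <= 1) ->
  `|\sum_i w i * ln (1 - c * z i) +
    \sum_(n < M) c ^+ n.+1 / n.+1%:R * \sum_i w i * z i ^+ n.+1| <= c ^+ M / (1 - c).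
Proof.
move=> w0 w1 z01.
have -> : \sum_(n < M) c ^+ n.+1 / n.+1%:R * \sum_i w i * z i ^+ n.+1 =
    \sum_i w i * \sum_(n < M) (c * z i) ^+ n.+1 / n.+1%:R.
  under eq_bigr do rewrite mulr_sumr.
  rewrite exchange_big /=; apply: eq_bigr => i _; rewrite mulr_sumr.
  by apply: eq_bigr => n _; rewrite exprMn; ring.
rewrite -big_split /=; apply: (le_trans (ler_norm_sum _ _ _)).
rewrite -[leRHS]mul1r -[X in _ <= X * _]w1 mulr_suml; apply: ler_sum => i _.
rewrite -mulrDr normrM ger0_norm// ler_wpM2l//.
have /andP[z0 z1] := z01 i.
by apply: ln1B_remainder => //; [exact: mulr_ge0 | exact: ler_piMr].
Qed.

Lemma prod01 (J : finType) (F : J -> R) : (forall j, 0 <= F j <= 1) ->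
  0 <= \prod_j F j <= 1.
Proof.
move=> F01; apply/andP; split.
  by apply: prodr_ge0 => j _; case/andP : (F01 j).
by apply: prodr_ile1 => j _; exact: F01.
Qed.

Lemma avg01 (F : W -> R) : (forall s, 0 <= F s <= 1) ->
  0 <= \sum_s g s * F s <= 1.
Proof.
move=> F01; apply/andP; split.
  by apply: sumr_ge0 => s _; rewrite mulr_ge0//; case/andP : (F01 s).
rewrite -[leRHS]g1; apply: ler_sum => s _; rewrite ler_piMr//.
by case/andP : (F01 s).
Qed.

(** The three logarithms are truncated at a common order. [franz_leone_moment] then applies to each
    power separately, with the nonnegative coefficients [c ^+ n.+1 / n.+1%:R]; the minus sign of the
    series reverses the inequality. *)
Lemma franz_leone :
  (\sum_(a : {ffun 'I_q.+1 -> X}) (\prod_j mu (a j)) *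
     ln (1 - c * \sum_s g s * \prod_j h (a j) s))
  - q.+1%:R * (\sum_(xb : X * {ffun 'I_q -> Y}) mu xb.1 * (\prod_j nu (xb.2 j)) *
     ln (1 - c * ((\sum_s g s * h xb.1 s) * \prod_j k (xb.2 j))))
  + q%:R * (\sum_(b : {ffun 'I_q.+1 -> Y}) (\prod_j nu (b j)) *
     ln (1 - c * \prod_j k (b j))) <= 0.
Proof.
apply/ler_addgt0Pl => e e0; rewrite addr0.
(* The three remainders enter with the weights 1, [q.+1] and [q], in total [2 * q.+1]. *)
have e'0 : 0 < e / (2 * q.+1%:R) by rewrite divr_gt0// mulr_gt0.
have [M HM] := cvg_ln_remainder c0 c1 e'0.
have wm (I J : finType) (w : I -> R) : (forall i, 0 <= w i) -> \sum_i w i = 1 ->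
    (forall b : {ffun J -> I}, 0 <= \prod_j w (b j)) /\
    \sum_(b : {ffun J -> I}) \prod_j w (b j) = 1.
  by move=> w0 w1; split=> [b|]; [exact: prodr_ge0 | rewrite sum_ffun_prod w1 expr1n].
have [M0 M1] := wm _ ('I_q.+1 : finType) _ mu0 mu1.
have [N0 N1] := wm _ ('I_q : finType) _ nu0 nu1.
have [N'0 N'1] := wm _ ('I_q.+1 : finType) _ nu0 nu1.
have r1 := @sum_remainder _ _ full M M0 M1 (fun a => avg01 (fun s => prod01 (fun j => h01 (a j) s))).
have r3 := @sum_remainder _ _ free M N'0 N'1 (fun b => prod01 (fun j => k01 (b j))).
have r2 := @sum_remainder _ (fun xb : X * {ffun 'I_q -> Y} => mu xb.1 * \prod_j nu (xb.2 j))
  (fun xb => mixed xb.1 xb.2) M.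
have {}r2 : `|\sum_(xb : X * {ffun 'I_q -> Y}) mu xb.1 * (\prod_j nu (xb.2 j)) * ln (1 - c * mixed xb.1 xb.2) +
    \sum_(n < M) c ^+ n.+1 / n.+1%:R * \sum_(xb : X * {ffun 'I_q -> Y}) mu xb.1 * (\prod_j nu (xb.2 j)) * mixed xb.1 xb.2 ^+ n.+1|
    <= c ^+ M / (1 - c).
  apply: r2 => [[x b]||[x b]] /=; first exact: mulr_ge0.
    rewrite -(pair_bigA _ (fun x (b : {ffun 'I_q -> Y}) => mu x * \prod_j nu (b j))) /=.
    under eq_bigr do rewrite -mulr_sumr N1 mulr1.
    exact: mu1.
  have /andP[a0 a1] := avg01 (h01 x).
  have /andP[b0 b1] := prod01 (fun j => k01 (b j)).
  by rewrite /mixed mulr_ge0//= mulr_ile1.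
move: r1 r2 r3; rewrite -/full -/free.
set S1 := \sum_a _ * ln _; set S2 := \sum_xb _ * ln _; set S3 := \sum_b _ * ln _.
set T1 := \sum_(n < M) _; set T2 := \sum_(n < M) _; set T3 := \sum_(n < M) _.
have T0 : 0 <= T1 - q.+1%:R * T2 + q%:R * T3.
  rewrite /T1 /T2 /T3 !mulr_sumr -sumrB -big_split /=.
  apply: sumr_ge0 => n _.
  have := franz_leone_moment n.+1.
  rewrite (pair_bigA _ (fun x (b : {ffun 'I_q -> Y}) => mu x * (\prod_j nu (b j)) * mixed x b ^+ n.+1)) /=.
  set u := \sum_a _; set v := \sum_p _; set w := \sum_b _ => uvw.
  rewrite (_ : _ + _ = c ^+ n.+1 / n.+1%:R * (u - q.+1%:R * v + q%:R * w)); last by ring.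
  by rewrite mulr_ge0// mulr_ge0 ?exprn_ge0.
rewrite !ler_norml => /andP[_ r1] /andP[r2 _] /andP[_ r3].
have q0 : 0 <= q%:R :> R by [].
have q10 : 0 <= q.+1%:R :> R by [].
have H2 := ler_wpM2l q10 r2; have H3 := ler_wpM2l q0 r3.
rewrite ler_pdivlMr ?mulr_gt0// in HM.
move: T0 r1 H2 H3 HM; set C := c ^+ M / (1 - c).
rewrite -!(natr1 q); lra.
Qed.

End franz_leone.

(** * Gibbs measures of general energies *)

Section gibbs.
Context {R : realType} {W : finType}.
Implicit Types (H K : W -> R).

(** The sign convention is that of - H_N: energies are exponentiated with a plus sign, and those of
    clauses are nonpositive. *)
Definition partf H : R := \sum_s expR (H s).
Definition logZ H : R := ln (partf H).
Definition gibbs H s : R := expR (H s) / partf H.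

Context (W0 : (0 < #|W|)%N).

Lemma partf_gt0 H : 0 < partf H.
Proof.
have /card_gt0P[s0 _] := W0.
rewrite /partf (bigD1 s0)//= ltr_wpDr ?expR_gt0//.
by apply: sumr_ge0 => s _; exact: expR_ge0.
Qed.

Lemma gibbs_ge0 H s : 0 <= gibbs H s.
Proof. by rewrite mulr_ge0 ?expR_ge0// invr_ge0 ltW// partf_gt0. Qed.

Lemma gibbs_sum1 H : \sum_s gibbs H s = 1.
Proof. by rewrite -mulr_suml divff// gt_eqF// partf_gt0. Qed.

Lemma partfD H K : partf (H + K) = partf H * \sum_s gibbs H s * expR (K s).
Proof.
rewrite mulr_sumr; apply: eq_bigr => s _; rewrite expRD /gibbs.
by field; rewrite gt_eqF// partf_gt0.
Qed.

Lemma gibbs_avg_gt0 H K : 0 < \sum_s gibbs H s * expR (K s).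
Proof. by have := partf_gt0 (H + K); rewrite partfD pmulr_rgt0// partf_gt0. Qed.

Lemma logZD H K : logZ (H + K) = logZ H + ln (\sum_s gibbs H s * expR (K s)).
Proof.
by rewrite /logZ partfD lnM// posrE ?partf_gt0// gibbs_avg_gt0.
Qed.

Lemma le_logZ H K : (forall s, H s <= K s) -> logZ H <= logZ K.
Proof.
move=> HK; rewrite /logZ ler_ln ?posrE ?partf_gt0//.
by apply: ler_sum => s _; rewrite ler_expR.
Qed.

Lemma logZ_cst H (a : R) : logZ (fun s => H s + a) = logZ H + a.
Proof.
rewrite /logZ /partf; under eq_bigr do rewrite expRD.
by rewrite -mulr_suml lnM ?posrE ?expR_gt0 ?partf_gt0// expRK.
Qed.

Lemma logZ_bound H : `|logZ H| <= ln #|W|%:R + l1size H.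
Proof.
have l0 : 0 <= ln (#|W|%:R : R) by rewrite ln_ge0// ler1n.
have E (a : R) : logZ (fun=> a) = ln #|W|%:R + a.
  rewrite (_ : (fun=> a) = fun s : W => 0 + a); last by apply/funext => s; rewrite add0r.
  rewrite (logZ_cst (fun=> 0)); congr (_ + _); rewrite /logZ /partf.
  by rewrite (eq_bigr (fun=> 1)) ?sumr_const// => s _; rewrite expR0.
rewrite ler_norml; apply/andP; split; last first.
  rewrite -E; apply: le_logZ => s; exact: le_trans (ler_norm _) (ler_l1size _ _).
apply: (@le_trans _ _ (logZ (fun=> - l1size H))); first by rewrite E; lra.
apply: le_logZ => s; rewrite lerNl; apply: le_trans (ler_l1size H s).
by rewrite -normrN ler_norm.
Qed.

Lemma egrow_logZ : egrow (@l1size R W) logZ.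
Proof.
have P := @subadd_l1size R W.
apply: (@egrow_le _ _ _ _ (fun H => ln #|W|%:R + 1 * l1size H)).
  by apply: egrowD => //; [exact: egrow_cst | exact: egrow_nu].
by move=> H; rewrite mul1r; exact: logZ_bound.
Qed.

End gibbs.

Lemma gen_jumps (R : realType) (S : zmodType) (I : finType) (lam : I -> R) (J : I -> S) f s :
  \sum_i lam i * (f (s + J i) - f s) =
  tstep (jumps lam J) f s - rate (jumps lam J) * f s.
Proof.
rewrite tstep_jumps rate_jumps mulr_suml -sumrB.
by apply: eq_bigr => i _; rewrite mulrBr.
Qed.

Section literals.
Context {R : realType}.

(* The factor (1 + J y) / 2 of theta for the sign J = [spin R b]. *)
Definition lit (b : bool) (y : R) : R := (1 + spin R b * y) / 2.

Lemma lit_spin b e : lit b (spin R e) = (b == e)%:R.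
Proof. by rewrite /lit /spin; case: b; case: e => /=; lra. Qed.

Lemma lit01 b y : -1 <= y <= 1 -> 0 <= lit b y <= 1.
Proof. by rewrite /lit /spin => /andP[]; case: b => ? ?; apply/andP; split; lra. Qed.

Lemma lit_spin01 b e : 0 <= lit b (spin R e) <= 1.
Proof. by rewrite lit_spin; case: (_ == _); rewrite ?ler01 ?lexx. Qed.

End literals.

Lemma ln_prod (R : realType) (I : finType) (F : I -> R) :
  (forall i, 0 < F i) -> ln (\prod_i F i) = \sum_i ln (F i).
Proof.
move=> F0; suff [_ ->//] : 0 < \prod_i F i /\ ln (\prod_i F i) = \sum_i ln (F i).
apply: (big_rec2 (fun y x => 0 < x /\ ln x = y)); first by rewrite ln1.
move=> i y x _ [x0 <-]; split; first exact: mulr_gt0.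
by rewrite lnM ?posrE.
Qed.

(** * The model and the interpolation *)

Section model.
Context {R : realType} (q : nat) (beta : R) (beta0 : 0 < beta).

Definition cbeta : R := 1 - expR (- beta).
Notation c := cbeta.

Lemma cbeta_ge0 : 0 <= c.
Proof. by rewrite subr_ge0 expR_le1 oppr_le0 ltW. Qed.

Lemma cbeta_lt1 : c < 1.
Proof. by rewrite /cbeta ltrBlDr ltrDl expR_gt0. Qed.

Lemma oneB_cbeta : 1 - c = expR (- beta).
Proof. by rewrite /cbeta opprB addrC subrK. Qed.

Lemma weight_gt0 y : y <= 1 -> 0 < 1 - c * y.
Proof.
move=> y1; rewrite subr_gt0; apply: le_lt_trans cbeta_lt1.
by apply: ler_piMr => //; exact: cbeta_ge0.
Qed.

Lemma weight_bounds y : 0 <= y <= 1 -> - beta <= ln (1 - c * y) <= 0.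
Proof.
move=> /andP[y0 y1]; have w0 := weight_gt0 y1; apply/andP; split.
  rewrite -[X in X <= _]expRK ler_ln ?posrE ?expR_gt0// -oneB_cbeta.
  by rewrite lerD2l lerN2 ler_piMr// cbeta_ge0.
by apply: ln_le0; rewrite gerBl mulr_ge0// cbeta_ge0.
Qed.

Definition clause_energy (V : finType) (a : {ffun 'I_q.+1 -> V * bool})
  (s : {ffun V -> bool}) : R :=
  ln (1 - c * \prod_j lit (a j).2 (spin R (s (a j).1))).

Definition sat_rates (V : finType) (M : R) (a : {ffun 'I_q.+1 -> V * bool}) : R :=
  M / #|{ffun 'I_q.+1 -> V * bool}|%:R.

(* [Phi V (alpha N)] is N F_N for N = #|V|. *)
Definition Phi (V : finType) (M : R) : R :=
  PE (jumps (@sat_rates V M) (@clause_energy V)) (@logZ R {ffun V -> bool}) 0.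

Section field.
Context {I : finType} (w x : I -> R).

(** A clause with a single slot in the system, of sign [l.1]; the spins in its [q] other slots are
    replaced by external values [x]. *)
Definition field_energy (l : bool * {ffun 'I_q -> I * bool}) (e : bool) : R :=
  ln (1 - c * (lit l.1 (spin R e) * \prod_j lit (l.2 j).2 (x (l.2 j).1))).

Definition field_rates (r : R) (l : bool * {ffun 'I_q -> I * bool}) : R :=
  r / 2 * \prod_j (w (l.2 j).1 / 2).

Definition cavity (r : R) : R :=
  PE (jumps (field_rates r) field_energy) (fun h => ln (partf h / 2)) 0.

Definition etheta : R := \sum_(b : {ffun 'I_q.+1 -> I * bool})
  (\prod_j (w (b j).1 / 2)) * ln (1 - c * \prod_j lit (b j).2 (x (b j).1)).

(* The functional P at the law of [x] under the weights [w]. *)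
Definition Pdisc (alpha : R) : R :=
  ln 2 + cavity (alpha * q.+1%:R) - q%:R * alpha * etheta.

End field.

Lemma egrow_ln_half : egrow (@l1size R bool) (fun h : bool -> R => ln (partf h / 2)).
Proof.
have b0 : (0 < #|{: bool}|)%N by rewrite card_bool.
apply: (@egrow_le _ _ _ _ (fun H => 2 * ln 2 + 1 * l1size H)).
  have P := @subadd_l1size R bool.
  by apply: egrowD => //; [exact: egrow_cst | exact: egrow_nu].
move=> h; rewrite ln_div ?posrE ?partf_gt0//.
apply: (le_trans (ler_normB _ _)).
have := logZ_bound b0 h; rewrite card_bool mul1r => /lerD; rewrite /logZ.
move=> /(_ _ _ (lexx `|ln 2|)) /le_trans; apply.
by rewrite [`|ln 2|]ger0_norm ?ln_ge0 ?ler1n//; lra.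
Qed.

Lemma cavity_logZ (I : finType) (w x : I -> R) r :
  PE (jumps (field_rates w r) (field_energy x)) (@logZ R bool) 0 =
  ln 2 + cavity w x r.
Proof.
have b0 : (0 < #|{: bool}|)%N by rewrite card_bool.
pose fl := jumps (field_rates w r) (field_energy x).
rewrite /cavity -(PE_cst fl (ln 2) 0).
have -> : PE fl (@logZ R bool) 0 = PE fl (fun h => ln (partf h / 2) + 1 * ln 2) 0.
  apply: eq_PE => h; rewrite mul1r ln_div ?posrE ?partf_gt0//.
  by rewrite subrK.
rewrite (PED _ _ _ (@subadd_l1size R bool)) ?mul1r 1?addrC//; last exact: egrow_cst.
exact: egrow_ln_half.
Qed.

Lemma sum_pair_bool (I : finType) (w : I -> R) : \sum_i w i = 1 ->
  \sum_(y : I * bool) w y.1 / 2 = 1.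
Proof.
move=> w1; rewrite -(pair_bigA _ (fun i (b : bool) => w i / 2)) /= -[RHS]w1.
by apply: eq_bigr => i _; rewrite big_bool /=; lra.
Qed.

Section upper_bound.
Context {V I : finType} (V0 : (0 < #|V|)%N) (alpha : R) (alpha0 : 0 < alpha).
Variables (w x : I -> R) (w0 : forall i, 0 <= w i) (w1 : \sum_i w i = 1).
Variable (x1 : forall i, -1 <= x i <= 1).
Notation config := {ffun V -> bool}.

Lemma config_gt0 : (0 < #|{ffun V -> bool}|)%N.
Proof. by rewrite card_ffun card_bool expn_gt0. Qed.

(* Independent fields at the vertices; the fields at one vertex have the law of
   the cavity field in [Pdisc]. *)
Definition site_rates (l : (V * bool) * {ffun 'I_q -> I * bool}) : R :=
  field_rates w (alpha * q.+1%:R) (l.1.2, l.2).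
Definition site_field (l : (V * bool) * {ffun 'I_q -> I * bool}) (u : V * bool) : R :=
  if u.1 == l.1.1 then field_energy x (l.1.2, l.2) u.2 else 0.
Definition site_energy (l : (V * bool) * {ffun 'I_q -> I * bool}) (s : config) : R :=
  field_energy x (l.1.2, l.2) (s l.1.1).

Lemma field_rates_ge0 r l : 0 <= r -> 0 <= field_rates w r l.
Proof.
move=> r0; rewrite /field_rates mulr_ge0 ?divr_ge0//.
by apply: prodr_ge0 => j _; rewrite divr_ge0.
Qed.

(** These energies are sums over vertices, so the partition function is a product over vertices. The
    factor at [v] feels only the jumps at [v]; all others are null jumps for it. *)
Lemma sites_decouple :
  PE (jumps site_rates site_energy) (@logZ R config) 0 =
  #|V|%:R * (ln 2 + cavity w x (alpha * q.+1%:R)).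
Proof.
pose psi (g : V * bool -> R) : config -> R := fun s => \sum_v g (v, s v).
rewrite (@PE_jumps_hom _ _ _ psi _ _ site_field); last 2 first.
- by move=> g g'; apply/funext => s; rewrite /psi /= big_split.
- move=> [[v b] xi]; apply/funext => s; rewrite /psi (bigD1 v)//= /site_field /= eqxx.
  by rewrite big1 ?addr0// => u /negbTE ->.
pose phi v (g : V * bool -> R) : bool -> R := fun e => g (v, e).
have b0 : (0 < #|{: bool}|)%N by rewrite card_bool.
rewrite (@eq_PE _ _ _ _ (fun g => \sum_v logZ (phi v g))); last first.
  move=> g /=; rewrite -ln_prod => [|v]; last exact: partf_gt0.
  rewrite /logZ /partf (bigA_distr_bigA (fun v e => expR (g (v, e)))) /=.
  by congr (ln _); apply: eq_bigr => s _; rewrite /psi expR_sum.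
have Ev v : egrow (@l1size R (V * bool)%type) (fun g => logZ (phi v g)).
  apply: (@egrow_le _ _ _ _ (fun H => ln 2 + 1 * l1size H)).
    have P := @subadd_l1size R (V * bool)%type.
    by apply: egrowD => //; [exact: egrow_cst | exact: egrow_nu].
  move=> g; apply: (le_trans (logZ_bound b0 _)); rewrite card_bool lerD2l mul1r.
  rewrite /l1size [leRHS](eq_bigr (fun u => `|g (u.1, u.2)|)); last by case.
  rewrite -(pair_bigA _ (fun v e => `|g (v, e)|)) (bigD1 v)//= lerDl.
  by apply: sumr_ge0 => u _; apply: sumr_ge0.
rewrite (PE_sum _ _ _ (@subadd_l1size R (V * bool)%type) Ev).
rewrite (eq_bigr (fun=> ln 2 + cavity w x (alpha * q.+1%:R))); last first.
  move=> v _.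
  have := @PE_jumps_hom _ _ _ (phi v) _ site_rates site_field
    (fun l => phi v (site_field l)) (@logZ R bool) (fun _ _ => erefl) (fun _ => erefl).
  rewrite /comp => <-.
  pose mu := \sum_(l | l.1.1 != v) site_rates l.
  pose fl := jumps (field_rates w (alpha * q.+1%:R)) (field_energy x).
  rewrite (@PE_ext _ _ _ ((mu, 0) :: fl)); last first.
    move=> f s; rewrite tstep_jumps /tstep big_cons addr0 -/(tstep fl f s) tstep_jumps /=.
    rewrite addrC (bigID (fun l => l.1.1 == v)) /=; congr (_ + _); last first.
      rewrite /mu mulr_suml; apply: eq_bigr => l lv; congr (_ * f _).
      apply/funext => e; rewrite /phi /site_field /= eq_sym (negbTE lv).
      exact: addr0.
    rewrite (reindex (fun l : bool * {ffun 'I_q -> I * bool} => ((v, l.1), l.2))) /=; last first.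
      exists (fun l => (l.1.2, l.2)) => [[b xi] _ //|[[u b] xi]] /=.
      by rewrite inE => /eqP /= ->.
    apply: eq_big => [l|[b xi] _]; first by rewrite eqxx.
    rewrite /site_rates /=; congr (_ * f _); apply/funext => e.
    by rewrite /phi /site_field /= eqxx.
  rewrite (PE_null _ _ _ (@subadd_l1size R bool) (egrow_logZ b0)).
  exact: cavity_logZ.
by rewrite sumr_const mulr_natl.
Qed.

Lemma card_clause : (#|{ffun 'I_q.+1 -> V * bool}|%:R : R) = (#|V|%:R * 2) ^+ q.+1.
Proof. by rewrite card_ffun card_prod card_bool card_ord natrX natrM. Qed.

(** At any energy [H] the increments of [logZ] are logarithms of Gibbs averages, so the comparison
    of the two generators is [franz_leone] for the Gibbs measure of [H]. The clauses with external
    points only do not depend on [H] and give the constant term with [etheta]. *)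
Lemma Phi_le_Pdisc :
  Phi V (alpha * #|V|%:R) <= #|V|%:R * Pdisc w x alpha.
Proof.
have V0r : 0 < (#|V|%:R : R) by rewrite ltr0n.
have W0 := config_gt0.
have -> : #|V|%:R * Pdisc w x alpha = PE (jumps site_rates site_energy)
    (@logZ R config) 0 + - (q%:R * (alpha * #|V|%:R) * etheta w x).
  by rewrite sites_decouple /Pdisc; ring.
apply: (PE_gen _ (@subadd_l1size R config)).
- apply: nonneg_rates_jumps => l; apply: field_rates_ge0.
  by rewrite mulr_ge0 // ltW.
- apply: nonneg_rates_jumps => a; rewrite /sat_rates divr_ge0// mulr_ge0//.
  exact: ltW.
- exact: egrow_logZ.
move=> H; rewrite -!gen_jumps.
pose mu (u : V * bool) : R := (#|V|%:R * 2)^-1.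
pose nu (y : I * bool) : R := w y.1 / 2.
have mu0 u : 0 <= mu u by rewrite invr_ge0 mulr_ge0.
have mu1 : \sum_u mu u = 1.
  by rewrite sumr_const card_prod card_bool -[LHS]mulr_natl natrM divff// gt_eqF// mulr_gt0.
have nu0 y : 0 <= nu y by rewrite divr_ge0.
have h01 (u : V * bool) (s : config) := @lit_spin01 R u.2 (s u.1).
have k01 (y : I * bool) : 0 <= lit y.2 (x y.1) <= 1 by exact: lit01.
have FL := @franz_leone R _ _ _ q _ cbeta_ge0 cbeta_lt1 _ (gibbs_ge0 W0 H) (gibbs_sum1 W0 H)
  _ mu0 mu1 _ nu0 (sum_pair_bool w1)
  (fun u s => lit u.2 (spin R (s u.1))) h01 (fun y => lit y.2 (x y.1)) k01.
have aV0 : 0 <= alpha * #|V|%:R by rewrite mulr_ge0 // ltW.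
have step (K X : config -> R) : (forall s, K s = ln (1 - c * X s)) ->
    (forall s, 0 <= X s <= 1) ->
    logZ (H + K) - logZ H = ln (1 - c * \sum_s gibbs H s * X s).
  move=> KX X01; rewrite logZD// addrC addKr; congr ln.
  rewrite -[X in X - _](gibbs_sum1 W0 H) mulr_sumr -sumrB; apply: eq_bigr => s _.
  rewrite KX lnK ?posrE; first by ring.
  by apply: weight_gt0; case/andP : (X01 s).
have := ler_wpM2l aV0 FL; rewrite mulr0.
set S1 := \sum_(a : {ffun 'I_q.+1 -> V * bool}) _.
set S2 := \sum_xb _; set S3 := \sum_b _.
rewrite (_ : S3 = etheta w x)//.
have -> : \sum_i sat_rates (alpha * #|V|%:R) i * (logZ (H + clause_energy i) - logZ H) =
    alpha * #|V|%:R * S1.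
  rewrite /S1 mulr_sumr; apply: eq_bigr => a _.
  rewrite (step _ (fun s => \prod_j lit (a j).2 (spin R (s (a j).1))))//; last first.
    by move=> s; apply: prod01 => j; exact: h01.
  rewrite mulrA /sat_rates prodr_const card_ord card_clause exprVn //.
have -> : \sum_i site_rates i * (logZ (H + site_energy i) - logZ H) =
    alpha * #|V|%:R * (q.+1%:R * S2).
  rewrite /S2 !mulr_sumr; apply: eq_bigr => -[[v b] xi] _.
  rewrite (step _ (fun s => lit b (spin R (s v)) * \prod_j lit (xi j).2 (x (xi j).1)))//; last first.
    move=> s; have /andP[a0 a1] := h01 (v, b) s.
    have /andP[b0 b1] := prod01 (fun j => k01 (xi j)).
    by rewrite mulr_ge0//= mulr_ile1.
  rewrite (_ : \sum_s _ = (\sum_s gibbs H s * lit b (spin R (s v))) *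
    \prod_j lit (xi j).2 (x (xi j).1)); last first.
    by rewrite mulr_suml; apply: eq_bigr => s _; rewrite mulrA.
  rewrite /=; set L := ln _.
  by rewrite /site_rates /field_rates /mu /nu /=; field; rewrite gt_eqF.
by move=> ?; lra.
Qed.

End upper_bound.
End model.

(** * Mean-field approximation of the cavity fields *)
Lemma sum_ffun_cons (V : nmodType) (X : finType) r (F : {ffun 'I_r.+1 -> X} -> V) :
  \sum_xi F xi = \sum_y \sum_(xi : {ffun 'I_r -> X})
    F [ffun j => oapp xi y (unlift ord0 j)].
Proof.
rewrite pair_bigA /= (reindex (fun p : X * {ffun 'I_r -> X} =>
  [ffun j => oapp p.2 p.1 (unlift ord0 j)]))//=.
exists (fun xi : {ffun 'I_r.+1 -> X} => (xi ord0, [ffun j => xi (lift ord0 j)])).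
  move=> [y xi] _ /=; rewrite ffunE unlift_none /=; congr (_, _).
  by apply/ffunP => j; rewrite !ffunE liftK.
move=> xi _ /=; apply/ffunP => j; rewrite ffunE.
by case: unliftP => [i ->|->] //=; rewrite ffunE.
Qed.

Section weak_correlation.
Context {R : realType} {W : finType} (g : W -> R).
Hypotheses (g0 : forall s, 0 <= g s) (g1 : \sum_s g s = 1).
Notation avg F := (\sum_s g s * F s).

Lemma avg_norm_le1 (G : W -> R) : (forall s, `|G s| <= 1) -> `|avg G| <= 1.
Proof.
move=> G1; apply: (le_trans (ler_norm_sum _ _ _)); rewrite -[leRHS]g1.
by apply: ler_sum => s _; rewrite normrM ger0_norm// ler_piMr.
Qed.

Lemma variance_ge0 (F : W -> R) : 0 <= avg (fun s => F s ^+ 2) - avg F ^+ 2.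
Proof.
have -> : avg (fun s => F s ^+ 2) - avg F ^+ 2 = avg (fun s => (F s - avg F) ^+ 2).
  set m := avg F.
  rewrite [RHS](eq_bigr (fun s => g s * F s ^+ 2 - 2 * m * (g s * F s) + m ^+ 2 * g s)); last first.
    by move=> s _; ring.
  by rewrite big_split /= sumrB -!mulr_sumr g1 -/m; ring.
by apply: sumr_ge0 => s _; rewrite mulr_ge0// sqr_ge0.
Qed.

(* Cauchy-Schwarz for [G] against the signed sum of the [f v]. *)
Lemma sum_cov_le (V : finType) (f : V -> W -> R) (G : W -> R) k : 0 < k ->
  (forall s, `|G s| <= 1) ->
  \sum_v `|avg (fun s => G s * f v s) - avg G * avg (f v)| <=
  (k * (\sum_v \sum_w `|avg (fun s => f v s * f w s) - avg (f v) * avg (f w)|) + k^-1) / 2.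
Proof.
move=> k0 G1; pose cv v := avg (fun s => G s * f v s) - avg G * avg (f v).
pose e v : R := Num.sg (cv v).
pose F s := \sum_v e v * f v s.
have EF : avg F = \sum_v e v * avg (f v).
  rewrite /F; under eq_bigr do rewrite mulr_sumr.
  rewrite exchange_big /=; apply: eq_bigr => v _; rewrite mulr_sumr.
  by apply: eq_bigr => s _; rewrite mulrCA.
have EGF : avg (fun s => G s * F s) = \sum_v e v * avg (fun s => G s * f v s).
  rewrite /F; under eq_bigr do rewrite !mulr_sumr.
  rewrite exchange_big /=; apply: eq_bigr => v _; rewrite mulr_sumr.
  by apply: eq_bigr => s _; ring.
have EFF : avg (fun s => F s ^+ 2) =
    \sum_v \sum_w e v * e w * avg (fun s => f v s * f w s).
  transitivity (avg (fun s => \sum_v \sum_w e v * e w * (f v s * f w s))).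
    apply: eq_bigr => s _; congr (_ * _); rewrite expr2 /F mulr_suml.
    by apply: eq_bigr => v _; rewrite mulr_sumr; apply: eq_bigr => w _; ring.
  under eq_bigr do rewrite mulr_sumr.
  rewrite exchange_big /=; apply: eq_bigr => v _.
  under eq_bigr do rewrite mulr_sumr.
  rewrite exchange_big /=; apply: eq_bigr => w _.
  by rewrite mulr_sumr; apply: eq_bigr => s _; ring.
have cov1 : \sum_v `|cv v| = avg (fun s => G s * F s) - avg G * avg F.
  rewrite EGF EF mulr_sumr -sumrB; apply: eq_bigr => v _.
  rewrite normrEsg -/(e v) /cv mulrBr.
  by congr (_ - _); rewrite mulrCA.
have varF : avg (fun s => F s ^+ 2) - avg F ^+ 2 <=
    \sum_v \sum_w `|avg (fun s => f v s * f w s) - avg (f v) * avg (f w)|.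
  rewrite EFF EF expr2 mulr_suml -sumrB; apply: ler_sum => v _.
  rewrite mulr_sumr -sumrB; apply: ler_sum => w _.
  rewrite (_ : _ - _ = e v * e w * (avg (fun s => f v s * f w s) - avg (f v) * avg (f w))); last by ring.
  apply: (le_trans (ler_norm _)); rewrite normrM ler_piMl// normrM.
  have sg1 v' : `|e v'| <= 1 by rewrite /e normr_sg lern1 leq_b1.
  by rewrite mulr_ile1.
have varG : avg (fun s => G s ^+ 2) - avg G ^+ 2 <= 1.
  apply: (@le_trans _ _ (avg (fun s => G s ^+ 2))); first by rewrite gerBl sqr_ge0.
  apply: le_trans (ler_norm _) _; apply: avg_norm_le1 => s.
  by rewrite normrX expr_le1.
(* Expanded, this is k^2 Var F - 2 k Cov(F, G) + Var G >= 0; the parameter [k] weighs Var F, the sum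
   of covariances, against Var G, which is at most 1. *)
have := variance_ge0 (fun s => k * F s - G s).
have -> : avg (fun s => (k * F s - G s) ^+ 2) - avg (fun s => k * F s - G s) ^+ 2 =
   k ^+ 2 * (avg (fun s => F s ^+ 2) - avg F ^+ 2)
   - 2 * k * (avg (fun s => G s * F s) - avg G * avg F)
   + (avg (fun s => G s ^+ 2) - avg G ^+ 2).
  have -> : avg (fun s => k * F s - G s) = k * avg F - avg G.
    by rewrite mulr_sumr -sumrB; apply: eq_bigr => s _; ring.
  have -> : avg (fun s => (k * F s - G s) ^+ 2) = k ^+ 2 * avg (fun s => F s ^+ 2)
      - 2 * k * avg (fun s => G s * F s) + avg (fun s => G s ^+ 2).
    by rewrite !mulr_sumr -sumrB -big_split; apply: eq_bigr => s _ /=; ring.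
  ring.
rewrite -cov1; move: varF varG.
set VF := avg (fun s => F s ^+ 2) - _; set VG := _ - avg G ^+ 2.
set C := \sum_v \sum_w _; set T := \sum_v `|_|; move=> vF vG vv.
rewrite -(ler_pM2l k0) (_ : k * (_ / 2) = (k ^+ 2 * C + 1) / 2); last first.
  by field; rewrite gt_eqF.
have : k ^+ 2 * VF <= k ^+ 2 * C by apply: ler_wpM2l => //; exact: sqr_ge0.
rewrite -/T; lra.
Qed.

(* Independent uniform factors [h y] decouple one at a time from everything
   else, the previous factors being absorbed in [G]. *)
Lemma random_product_decouple (X : finType) (h : X -> W -> R) B r :
  (forall y s, 0 <= h y s <= 1) -> 0 <= B ->
  (forall G : W -> R, (forall s, `|G s| <= 1) ->
    \sum_y `|avg (fun s => G s * h y s) - avg G * avg (h y)| <= #|X|%:R * B) ->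
  forall G : W -> R, (forall s, `|G s| <= 1) ->
  \sum_(xi : {ffun 'I_r -> X}) `|avg (fun s => G s * \prod_j h (xi j) s) -
     avg G * \prod_j avg (h (xi j))| <= #|X|%:R ^+ r * (r%:R * B).
Proof.
move=> h01 B0 HB; elim: r => [|r IH] G G1.
  rewrite mul0r mulr0 big1// => xi _; rewrite big_ord0 mulr1.
  rewrite (eq_bigr (fun s => g s * G s)) ?subrr ?normr0// => s _.
  by rewrite big_ord0 mulr1.
rewrite sum_ffun_cons.
apply: (@le_trans _ _ (\sum_y \sum_(xi : {ffun 'I_r -> X}) (
   `|avg (fun s => (G s * h y s) * \prod_j h (xi j) s) -
     avg (fun s => G s * h y s) * \prod_j avg (h (xi j))| +
   `|avg (fun s => G s * h y s) - avg G * avg (h y)|))).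
  apply: ler_sum => y _; apply: ler_sum => xi _.
  rewrite big_ord_recl ffunE unlift_none /=.
  under [X in _ * (_ * X)]eq_bigr do rewrite ffunE liftK /=.
  have -> : avg (fun s => G s * \prod_j h ([ffun j => oapp xi y (unlift ord0 j)] j) s) =
      avg (fun s => (G s * h y s) * \prod_j h (xi j) s).
    apply: eq_bigr => s _; congr (_ * _); rewrite big_ord_recl ffunE unlift_none /= mulrA.
    by congr (_ * _); apply: eq_bigr => j _; rewrite ffunE liftK.
  set P := \prod_j avg _.
  have /andP[P0 P1] : 0 <= P <= 1.
    by apply: prod01 => j; apply: avg01 => // s; exact: h01.
  set a := avg (fun s => (G s * h y s) * \prod_j h (xi j) s).
  set b := avg (fun s => G s * h y s); set hy := avg (h y); set m := avg G.
  have -> : a - m * (hy * P) = (a - b * P) + (b - m * hy) * P by ring.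
  apply: (le_trans (ler_normD _ _)); rewrite lerD2l normrM ler_piMr//.
  by rewrite ger0_norm.
under eq_bigr do rewrite big_split /= sumr_const.
rewrite big_split /= sumrMnl -[X in _ + X]mulr_natl card_ffun card_ord natrX.
apply: (@le_trans _ _ (\sum_(y : X) #|X|%:R ^+ r * (r%:R * B) + #|X|%:R ^+ r * (#|X|%:R * B))).
  apply: lerD; last by rewrite ler_wpM2l ?exprn_ge0// HB.
  apply: ler_sum => y _; apply: (IH (fun s => G s * h y s)) => s.
  rewrite normrM mulr_ile1//; case/andP : (h01 y s) => ? ?.
  by rewrite ger0_norm.
rewrite sumr_const -[X in X + _]mulr_natl exprS -(natr1 r).
by rewrite le_eqVlt; apply/orP; left; apply/eqP; ring.
Qed.

End weak_correlation.
Lemma subadd_pair (R : realType) (S T : zmodType) (n1 : S -> R) (n2 : T -> R) :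
  subadd n1 -> subadd n2 -> subadd (fun st : S * T => n1 st.1 + n2 st.2).
Proof.
move=> [a0 aD] [b0 bD]; split=> [st|s t]; first exact: addr_ge0.
by rewrite [leRHS]addrACA; apply: lerD; [exact: aD | exact: bD].
Qed.

(** A symmetric form, without knowing which argument is larger: the inverses of both partition
    functions can be followed along the process. *)
Lemma ln_dist_le (R : realType) (a b : R) : 0 < a -> 0 < b ->
  `|ln a - ln b| <= `|a - b| * (a^-1 + b^-1).
Proof.
have half (x y : R) : 0 < x -> 0 < y -> ln x - ln y <= `|x - y| * (x^-1 + y^-1).
  move=> x0 y0; rewrite -ln_div ?posrE// (_ : x / y = 1 + (x - y) / y); last first.
    by field; rewrite gt_eqF.
  apply: le_trans (le_ln1Dx _) _.
    by rewrite mulrBl divff ?gt_eqF// ltrBrDr addNr divr_gt0.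
  apply: (le_trans (ler_norm _)); rewrite normrM normfV (gtr0_norm y0).
  by rewrite ler_wpM2l// lerDr invr_ge0 ltW.
move=> a0 b0; rewrite ler_norml half// andbT lerNl opprB.
by apply: le_trans (half _ _ b0 a0) _; rewrite distrC (addrC b^-1).
Qed.

(** * Coupling of the true and the mean-field energies *)

Section cavity_process.
Context {R : realType} (beta : R) (beta0 : 0 < beta).
Context {V E U : finType} (V0 : (0 < #|V|)%N) (E0 : (0 < #|E|)%N).
Variables (u : U -> E -> R) (u01 : forall i e, 0 <= u i e <= 1) (r : nat).
Variables (tau : R) (tau0 : 0 <= tau) (k : R) (k0 : 0 < k).
Notation config := {ffun V -> bool}.
Variable H : config -> R.
Notation c := (cbeta beta).
Notation label := (U * {ffun 'I_r -> V * bool})%type.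
Notation avg F := (\sum_s gibbs H s * F s).

Definition magnetization (v : V) : R := avg (fun s : config => spin R (s v)).

Definition spin_cov : R := \sum_(v : V) \sum_(w : V)
  `|avg (fun s : config => (s v)%:R * (s w)%:R) -
    avg (fun s : config => (s v)%:R) * avg (fun s : config => (s w)%:R)|.

(** [E] is the state space of what is added to the system and [u] the literal that it contributes.
    Later [bool] stands for a new spin, and [unit] with literal 1 for no spin at all, so that the
    clause lies entirely in [V]. *)
Definition mixed_energy (l : label) (se : config * E) : R :=
  ln (1 - c * (u l.1 se.2 * \prod_j lit (l.2 j).2 (spin R (se.1 (l.2 j).1)))).

Definition mean_energy (l : label) (e : E) : R :=
  ln (1 - c * (u l.1 e * \prod_j lit (l.2 j).2 (magnetization (l.2 j).1))).

(** The partition function on [config * E] of [H] plus [A], divided by the one of [H]. *)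
Definition mixpart (A : config * E -> R) : R := \sum_e avg (fun s : config => expR (A (s, e))).

Let W0 : (0 < #|{ffun V -> bool}|)%N := config_gt0.
Let g0 := gibbs_ge0 W0 H.
Let g1 := gibbs_sum1 W0 H.
Let h (y : V * bool) (s : config) : R := lit y.2 (spin R (s y.1)).
Let h01 y s : 0 <= h y s <= 1. Proof. exact: lit_spin01. Qed.

Lemma avg_lit y : avg (h y) = lit y.2 (magnetization y.1).
Proof.
rewrite /h /lit /magnetization mulr_sumr -[X in X + _]g1 -big_split mulr_suml.
by apply: eq_bigr => s _ /=; rewrite [RHS]mulrC; ring.
Qed.

Lemma magnetization_bounds v : -1 <= magnetization v <= 1.
Proof.
rewrite -ler_norml; apply: (avg_norm_le1 g0 g1) => s.
by rewrite /spin; case: ifP; rewrite ?normrN normr1.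
Qed.

(** The bound of [sum_cov_le] per vertex: the mean price of decoupling one random literal. *)
Let eta := (k * spin_cov + k^-1) / 2 / #|V|%:R.

Lemma spin_cov_ge0 : 0 <= spin_cov.
Proof. by apply: sumr_ge0 => v _; apply: sumr_ge0. Qed.

Lemma eta_ge0 : 0 <= eta.
Proof.
have k0' := ltW k0; apply: divr_ge0 => //; apply: divr_ge0 => //.
by rewrite addr_ge0 ?invr_ge0// mulr_ge0 ?spin_cov_ge0.
Qed.

(** The two literals of a vertex sum to 1, so their covariances with [G] are opposite and each
    vertex counts twice. *)
Lemma literal_cov (G : config -> R) : (forall s, `|G s| <= 1) ->
  \sum_y `|avg (fun s : config => G s * h y s) - avg G * avg (h y)| <=
  #|{: V * bool}|%:R * eta.
Proof.
move=> G1.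
have -> : \sum_y `|avg (fun s : config => G s * h y s) - avg G * avg (h y)| =
   2 * \sum_v `|avg (fun s : config => G s * (s v)%:R) - avg G * avg (fun s : config => (s v)%:R)|.
  rewrite -(pair_bigA _ (fun v b => `|avg (fun s : config => G s * h (v, b) s) - avg G * avg (h (v, b))|)) /=.
  rewrite mulr_sumr; apply: eq_bigr => v _; rewrite big_bool /=.
  have hT s : h (v, true) s = (s v)%:R by rewrite /h /= lit_spin; case: (s v).
  have hF s : h (v, false) s = 1 - (s v)%:R.
    by rewrite /h /= lit_spin; case: (s v); rewrite /= ?subrr ?subr0.
  have -> : avg (h (v, true)) = avg (fun s : config => (s v)%:R).
    by apply: eq_bigr => s _; rewrite hT.
  have -> : avg (h (v, false)) = 1 - avg (fun s : config => (s v)%:R).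
    rewrite -[X in X - _]g1 -sumrB; apply: eq_bigr => s _.
    by rewrite hF mulrBr mulr1.
  have -> : avg (fun s : config => G s * h (v, true) s) = avg (fun s : config => G s * (s v)%:R).
    by apply: eq_bigr => s _; rewrite hT.
  have -> : avg (fun s : config => G s * h (v, false) s) = avg G - avg (fun s : config => G s * (s v)%:R).
    rewrite -sumrB; apply: eq_bigr => s _.
    by rewrite hF; ring.
  rewrite (_ : avg G - _ - _ = - (avg (fun s : config => G s * (s v)%:R) -
    avg G * avg (fun s : config => (s v)%:R))); last by ring.
  by rewrite normrN; ring.
rewrite card_prod card_bool natrM /eta.
have := sum_cov_le g0 g1 (fun (v : V) (s : config) => (s v)%:R) k0 G1.
set S := \sum_v `|_|; move=> HS.
rewrite [leRHS](_ : _ = 2 * ((k * spin_cov + k^-1) / 2)); last first.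
  by field; rewrite pnatr_eq0 -lt0n V0 gt_eqF.
by rewrite ler_wpM2l.
Qed.

Let b := #|E|%:R * (r%:R * eta).
Let gap (A : config * E -> R) (f : E -> R) : R :=
  \sum_e `|avg (fun s : config => expR (A (s, e))) - expR (f e)|.
(** The Lyapunov function. By [ln_dist_le] it dominates the difference of the two logarithms, and
    the constant [b] in it absorbs what a jump adds to the gap. *)
Let D (Af : (config * E -> R) * (E -> R)) : R :=
  (gap Af.1 Af.2 + b) * ((mixpart Af.1)^-1 + (partf Af.2)^-1).

Lemma decoupling_ge0 : 0 <= b.
Proof. by do 2!apply: mulr_ge0 => //; exact: eta_ge0. Qed.

Lemma gap_ge0 A f : 0 <= gap A f.
Proof. exact: sumr_ge0. Qed.

Lemma mixpart_gt0 A : 0 < mixpart A.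
Proof.
have /card_gt0P[e0 _] := E0; rewrite /mixpart (bigD1 e0)//= ltr_wpDr//.
  by apply: sumr_ge0 => e _; apply: ltW; exact: gibbs_avg_gt0.
exact: gibbs_avg_gt0.
Qed.

Lemma lyapunov_ge0 Af : 0 <= D Af.
Proof.
by rewrite mulr_ge0// addr_ge0 ?gap_ge0 ?decoupling_ge0// invr_ge0 ltW// ?mixpart_gt0 ?partf_gt0.
Qed.

Lemma field01 (x : V -> R) (l : label) e : (forall v, -1 <= x v <= 1) ->
  0 <= u l.1 e * \prod_j lit (l.2 j).2 (x (l.2 j).1) <= 1.
Proof.
move=> x1; have /andP[u0 u1] := u01 l.1 e.
have /andP[p0 p1] : 0 <= \prod_j lit (l.2 j).2 (x (l.2 j).1) <= 1.
  by apply: prod01 => j; exact: lit01.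
by rewrite mulr_ge0//= mulr_ile1.
Qed.

Lemma mixed01 (l : label) s e :
  0 <= u l.1 e * \prod_j lit (l.2 j).2 (spin R (s (l.2 j).1)) <= 1.
Proof.
by apply: (field01 (x := fun v => spin R (s v))) => v; rewrite /spin; case: (s v); lra.
Qed.

Lemma mean01 (l : label) e :
  0 <= u l.1 e * \prod_j lit (l.2 j).2 (magnetization (l.2 j).1) <= 1.
Proof. exact/field01/magnetization_bounds. Qed.

Lemma expR_mixed l se : expR (mixed_energy l se) =
  1 - c * (u l.1 se.2 * \prod_j h (l.2 j) se.1).
Proof.
rewrite lnK// posrE; apply: weight_gt0 => //.
by case/andP : (mixed01 l se.1 se.2).
Qed.

Lemma expR_mean l e : expR (mean_energy l e) =
  1 - c * (u l.1 e * \prod_j avg (h (l.2 j))).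
Proof.
rewrite lnK ?posrE; last first.
  by apply: weight_gt0 => //; case/andP : (mean01 l e).
by congr (1 - c * (_ * _)); apply: eq_bigr => j _; rewrite avg_lit.
Qed.

(** A jump brings in a random product of literals, which decouples from everything else on average
    over the labels. As [A] is nonpositive, [expR A] is bounded by 1 and can play the role of [G] in
    [random_product_decouple]. *)
Lemma gap_step A f : (forall se, A se <= 0) ->
  \sum_l tau * gap (A + mixed_energy l) (f + mean_energy l) <=
  tau * #|{: label}|%:R * (gap A f + b).
Proof.
move=> A0; rewrite -mulr_sumr -mulrA ler_wpM2l//.
pose err xi e := `|avg (fun s : config => expR (A (s, e)) * \prod_j h (xi j) s) -
  avg (fun s : config => expR (A (s, e))) * \prod_(j < r) avg (h (xi j))|.
apply: (@le_trans _ _ (\sum_(l : label) (gap A f + \sum_e err l.2 e))).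
  apply: ler_sum => -[i xi] _; rewrite /gap -big_split; apply: ler_sum => e _ /=.
  have -> : avg (fun s : config => expR ((A + mixed_energy (i, xi)) (s, e))) =
      avg (fun s : config => expR (A (s, e))) - c * u i e *
      avg (fun s : config => expR (A (s, e)) * \prod_j h (xi j) s).
    rewrite mulr_sumr -sumrB; apply: eq_bigr => s _.
    by rewrite expRD expR_mixed /=; ring.
  have -> : expR ((f + mean_energy (i, xi)) e) =
      expR (f e) * (1 - c * (u i e * \prod_j avg (h (xi j)))).
    by rewrite expRD expR_mean.
  rewrite /err /=; set P := \prod_(j < r) avg (h (xi j)).
  set m' := avg (fun s : config => expR (A (s, e)) * \prod_j h (xi j) s).
  set m := avg (fun s : config => expR (A (s, e))).
  have /andP[P0 P1] : 0 <= P <= 1.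
    by apply: prod01 => j; apply: (avg01 g0 g1) => s; exact: h01.
  have /andP[u0 u1] := u01 i e.
  have c0 := cbeta_ge0 beta0; have c1 := ltW (cbeta_lt1 beta).
  have -> : m - c * u i e * m' - expR (f e) * (1 - c * (u i e * P)) =
     (m - expR (f e)) * (1 - c * (u i e * P)) - c * u i e * (m' - m * P) by ring.
  apply: (le_trans (ler_normB _ _)); apply: lerD.
    rewrite normrM ler_piMr//.
    have uP : 0 <= u i e * P <= 1 by rewrite mulr_ge0//= mulr_ile1.
    have /andP[? ?] := uP.
    rewrite ger0_norm; first by rewrite gerBl mulr_ge0.
    by rewrite subr_ge0 mulr_ile1.
  rewrite normrM ler_piMl// ger0_norm ?mulr_ge0// mulr_ile1//.
rewrite big_split /= sumr_const -[X in X + _]mulr_natl mulrDr lerD2l.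
rewrite exchange_big /= /b.
have -> : #|{: label}|%:R * (#|E|%:R * (r%:R * eta)) =
   \sum_(e : E) #|{: label}|%:R * (r%:R * eta).
  by rewrite sumr_const -[RHS]mulr_natl mulrCA.
apply: ler_sum => e _.
rewrite -(pair_bigA _ (fun (i : U) (xi : {ffun 'I_r -> V * bool}) => err xi e)) /=.
rewrite card_prod natrM -mulrA.
rewrite sumr_const -[leLHS]mulr_natl ler_wpM2l// card_ffun card_ord natrX.
have Ge1 s : `|expR (A (s, e))| <= 1 by rewrite ger0_norm ?expR_ge0// expR_le1.
exact: (random_product_decouple g0 g1 r h01 eta_ge0 literal_cov Ge1).
Qed.

Lemma weight_shrink y : 0 <= y <= 1 -> expR (- beta) <= 1 - c * y.
Proof.
move=> /andP[y0 y1]; rewrite -oneB_cbeta lerD2l lerN2 ler_piMr//.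
exact: cbeta_ge0.
Qed.

Lemma mixpart_step A l : (mixpart (A + mixed_energy l))^-1 <= expR beta * (mixpart A)^-1.
Proof.
rewrite -[expR beta]invrK -expRN -invfM lef_pV2 ?posrE ?mulr_gt0 ?expR_gt0 ?mixpart_gt0//.
rewrite /mixpart mulr_sumr; apply: ler_sum => e _; rewrite mulr_sumr.
apply: ler_sum => s _; rewrite mulrCA ler_wpM2l// expRD mulrC ler_wpM2l ?expR_ge0//.
by rewrite expR_mixed weight_shrink// mixed01.
Qed.

Lemma partf_step f l : (partf (f + mean_energy l))^-1 <= expR beta * (partf f)^-1.
Proof.
rewrite -[expR beta]invrK -expRN -invfM lef_pV2 ?posrE ?mulr_gt0 ?expR_gt0 ?partf_gt0//.
rewrite /partf mulr_sumr; apply: ler_sum => e _.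
rewrite expRD mulrC ler_wpM2l ?expR_ge0// lnK ?weight_shrink ?mean01//.
by rewrite posrE; apply: weight_gt0 => //; case/andP : (mean01 l e).
Qed.

(** The same label moves both components. *)
Let joint := jumps (fun=> tau) (fun l : label => (mixed_energy l, mean_energy l)).
Let size (Af : (config * E -> R) * (E -> R)) := l1size Af.1 + l1size Af.2.

Lemma subadd_size : subadd size.
Proof. by apply: subadd_pair; exact: subadd_l1size. Qed.

(** On average over the labels the gap grows by at most [b], so its sum with [b] at most doubles;
    each inverse partition function grows by at most the factor exp(beta). *)
Lemma lyapunov_step Af : (forall se, Af.1 se <= 0) ->
  tstep joint D Af <= (2 * expR beta * (tau * #|{: label}|%:R)) * D Af.
Proof.
case: Af => A f A0; rewrite tstep_jumps.
set X := (mixpart A)^-1 + (partf f)^-1.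
have X0 : 0 <= X by rewrite addr_ge0// invr_ge0 ltW// ?mixpart_gt0 ?partf_gt0.
apply: (@le_trans _ _ (\sum_(l : label) tau *
  ((gap (A + mixed_energy l) (f + mean_energy l) + b) * (expR beta * X)))).
  apply: ler_sum => l _; rewrite ler_wpM2l// /D /= ler_wpM2l//.
    by rewrite addr_ge0 ?gap_ge0 ?decoupling_ge0.
  by rewrite /X mulrDr lerD ?mixpart_step ?partf_step.
under eq_bigr do rewrite mulrA mulrDr.
rewrite -mulr_suml big_split /= sumr_const.
have := gap_step f A0; set S := \sum_l _ => HS.
rewrite -[X in _ + X]mulr_natl /D /= -/X.
set L := #|{: label}|%:R in HS *.
rewrite (_ : 2 * _ * _ * _ = (2 * (tau * L) * (gap A f + b)) * (expR beta * X)); last by ring.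
rewrite ler_wpM2r ?mulr_ge0 ?expR_ge0//.
have g00 := gap_ge0 A f; have b0 := decoupling_ge0.
have : 0 <= tau * L * gap A f by rewrite !mulr_ge0.
have : L * (tau * b) = tau * L * b by ring.
move=> ->; move: HS; rewrite mulrDr; lra.
Qed.

Lemma avg_expR_bound (A : config * E -> R) e : avg (fun s : config => expR (A (s, e))) <= expR (l1size A).
Proof.
rewrite -[leRHS]mul1r -[X in _ <= X * _]g1 mulr_suml; apply: ler_sum => s _.
by rewrite ler_wpM2l// ler_expR (le_trans (ler_norm _))// ler_l1size.
Qed.

Lemma mixpartV_bound (A : config * E -> R) : (mixpart A)^-1 <= expR (l1size A).
Proof.
have /card_gt0P[e0 _] := E0.
rewrite -[leRHS]invrK lef_pV2 ?posrE ?mixpart_gt0 ?invr_gt0 ?expR_gt0// -expRN.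
rewrite /mixpart (bigD1 e0)//= ler_wpDr//.
  by apply: sumr_ge0 => e _; apply: ltW; exact: gibbs_avg_gt0.
rewrite -[leLHS]mul1r -[X in X * _ <= _]g1 mulr_suml; apply: ler_sum => s _.
by rewrite ler_wpM2l// ler_expR lerNl (le_trans (ler_norm _))// normrN ler_l1size.
Qed.

Lemma partfV_bound (f : E -> R) : (partf f)^-1 <= expR (l1size f).
Proof.
have /card_gt0P[e0 _] := E0.
rewrite -[leRHS]invrK lef_pV2 ?posrE ?partf_gt0 ?invr_gt0 ?expR_gt0// -expRN.
rewrite /partf (bigD1 e0)//= ler_wpDr//.
  by apply: sumr_ge0 => e _; exact: expR_ge0.
by rewrite ler_expR lerNl (le_trans (ler_norm _))// normrN ler_l1size.
Qed.

Lemma egrow_lyapunov : egrow size D.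
Proof.
have sP := subadd_size.
have eE : egrow size (fun Af => expR (size Af)).
  exists 1, 1; split => // Af; rewrite mul1r mul1r ger0_norm//; exact: expR_ge0.
apply: (@egrow_le _ _ _ _ (fun Af => ((2 * #|E|%:R) * expR (size Af) + 1 * b) * (2 * expR (size Af)))).
  apply: egrowM; last by apply: egrowM => //; exact: egrow_cst.
  apply: egrowD => //; last exact: egrow_cst.
  by apply: egrowM => //; exact: egrow_cst.
move=> [A f]; rewrite ger0_norm ?lyapunov_ge0// /D /=.
have sA : expR (l1size A) <= expR (size (A, f)).
  by rewrite ler_expR /size /= lerDl sumr_ge0.
have sf : expR (l1size f) <= expR (size (A, f)).
  by rewrite ler_expR /size /= lerDr sumr_ge0.
apply: ler_pM.
- by rewrite addr_ge0 ?gap_ge0 ?decoupling_ge0.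
- by rewrite addr_ge0// invr_ge0 ltW// ?mixpart_gt0 ?partf_gt0.
- rewrite mul1r lerD2r [leRHS](_ : _ = \sum_(e : E) 2 * expR (size (A, f))); last first.
    by rewrite sumr_const -[RHS]mulr_natl mulrA (mulrC 2).
  apply: ler_sum => e _; apply: (le_trans (ler_normB _ _)).
  rewrite (ger0_norm (expR_ge0 _)) ger0_norm; last first.
    by apply: ltW; exact: gibbs_avg_gt0.
  rewrite mulr2n mulrDl mul1r lerD//.
    exact: le_trans (avg_expR_bound _ _) sA.
  apply: le_trans sf; rewrite ler_expR.
  exact: le_trans (ler_norm _) (ler_l1size _ _).
- rewrite mulr2n mulrDl mul1r lerD//.
    exact: le_trans (mixpartV_bound _) sA.
  exact: le_trans (partfV_bound _) sf.
Qed.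

Lemma ln_abs_bound (y : R) : 0 < y -> `|ln y| <= y + y^-1.
Proof.
move=> y0; have yV0 : 0 < y^-1 by rewrite invr_gt0.
have := ln_sublinear y0; have := ln_sublinear yV0.
by rewrite lnV ?posrE// ler_norml => ? ?; apply/andP; split; lra.
Qed.

Lemma egrow_mixpart : egrow size (fun Af => ln (mixpart Af.1)).
Proof.
have eE : egrow size (fun Af => expR (size Af)).
  by exists 1, 1; split => // Af; rewrite !mul1r ger0_norm// expR_ge0.
apply: (@egrow_le _ _ _ _ (fun Af => (#|E|%:R + 1) * expR (size Af))).
  by apply: egrowM => //; exact: egrow_cst.
move=> [A f]; apply: (le_trans (ln_abs_bound (mixpart_gt0 _))).
have sA : expR (l1size A) <= expR (size (A, f)).
  by rewrite ler_expR /size /= lerDl sumr_ge0.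
rewrite mulrDl mul1r; apply: lerD; last exact: le_trans (mixpartV_bound _) sA.
apply: (@le_trans _ _ (\sum_(e : E) expR (size (A, f)))).
  by apply: ler_sum => e _; exact: le_trans (avg_expR_bound _ _) sA.
by rewrite sumr_const [leRHS]mulr_natl.
Qed.

Lemma egrow_partf : egrow size (fun Af => ln (partf Af.2)).
Proof.
apply: (@egrow_le _ _ _ _ (fun Af => ln #|E|%:R + 1 * size Af)).
  by apply: egrowD; [exact: subadd_size|exact: egrow_cst|exact/egrow_nu/subadd_size].
move=> [A f]; rewrite mul1r; apply: (le_trans (logZ_bound E0 f)).
by rewrite lerD2l /size /= lerDr sumr_ge0.
Qed.

Lemma ln_gap_le Af : `|ln (mixpart Af.1) - ln (partf Af.2)| <= D Af.
Proof.
apply: (le_trans (ln_dist_le (mixpart_gt0 _) (partf_gt0 E0 _))).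
rewrite ler_wpM2r//; first by rewrite addr_ge0// invr_ge0 ltW// ?mixpart_gt0 ?partf_gt0.
apply: (@le_trans _ _ (gap Af.1 Af.2)); last by rewrite lerDl decoupling_ge0.
by rewrite -sumrB ler_norm_sum.
Qed.

Lemma lyapunov_zero : D (0, 0) = 2 * (r%:R * eta).
Proof.
have m e : avg (fun s : config => expR ((0 : config * E -> R) (s, e))) = 1.
  by rewrite -[RHS]g1; apply: eq_bigr => s _; rewrite expR0 mulr1.
have p e : expR ((0 : E -> R) e) = 1 by exact: expR0.
rewrite /D /= /gap big1 ?add0r => [|e _]; last by rewrite m p subrr normr0.
have E0' : (#|E|%:R : R) != 0 by rewrite pnatr_eq0 -lt0n.
have -> : mixpart 0 = #|E|%:R.
  by rewrite /mixpart (eq_bigr (fun=> 1)) ?sumr_const// => e _; exact: m.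
have -> : partf (0 : E -> R) = #|E|%:R.
  by rewrite /partf (eq_bigr (fun=> 1)) ?sumr_const// => e _; exact: p.
by rewrite /b; move: (r%:R * eta) => z; field.
Qed.

(** Both processes start at 0, where the gap vanishes and only the constant [b] remains in [D];
    [PE_lyap] propagates this value on the invariant set where the first energy is nonpositive. *)
Lemma cavity_estimate :
  `|PE (jumps (fun=> tau) mixed_energy) (fun A => ln (mixpart A)) 0 -
    PE (jumps (fun=> tau) mean_energy) (fun f => ln (partf f)) 0| <=
  expR (2 * expR beta * (tau * #|{: label}|%:R)) * (2 * (r%:R * eta)).
Proof.
have sP := subadd_size.
rewrite (@PE_jumps_hom _ _ _ (fun Af : (config * E -> R) * (E -> R) => Af.1) _ _
  (fun l : label => (mixed_energy l, mean_energy l)) mixed_energy)//.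
rewrite (@PE_jumps_hom _ _ _ (fun Af : (config * E -> R) * (E -> R) => Af.2) _ _
  (fun l : label => (mixed_energy l, mean_energy l)) mean_energy)//.
rewrite -/joint /comp.
have jP : nonneg_rates joint by exact: nonneg_rates_jumps.
have DB : PE joint D 0 <= expR (2 * expR beta * (tau * #|{: label}|%:R)) * (2 * (r%:R * eta)).
  apply: le_trans (PE_lyap (Q := fun Af => forall se, Af.1 se <= 0)
    (k := 2 * expR beta * (tau * #|{: label}|%:R)) sP jP egrow_lyapunov _ _ _ _) _.
  - by rewrite !mulr_ge0// expR_ge0.
  - move=> Af x /mem_jumps[l ->] A0 se /=; rewrite -[leRHS]addr0; apply: lerD => //.
    by case/andP : (weight_bounds beta0 (mixed01 l se.1 se.2)).
  - by move=> Af; exact: lyapunov_step.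
  - by move=> se.
  rewrite -[0]/(0, 0) lyapunov_zero; apply: ler_wpM2r.
    by do 2!apply: mulr_ge0 => //; exact: eta_ge0.
  by rewrite ler_expR lerBlDr lerDl rate_ge0.
set F1 := PE joint _ 0; set F2 := PE joint _ 0.
have e1 := egrow_mixpart; have e2 := egrow_partf.
have H1 : F1 + -1 * F2 <= PE joint D 0.
  rewrite -(PED _ _ _ sP e1 e2); apply: PE_le sP jP (egrowD _ sP e1 e2) egrow_lyapunov _ => Af.
  by rewrite mulN1r; apply: le_trans (ler_norm _) (ln_gap_le Af).
have H2 : F2 + -1 * F1 <= PE joint D 0.
  rewrite -(PED _ _ _ sP e2 e1); apply: PE_le sP jP (egrowD _ sP e2 e1) egrow_lyapunov _ => Af.
  by rewrite mulN1r; apply: le_trans (ler_norm _) _; rewrite distrC ln_gap_le.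
by apply: le_trans DB; rewrite ler_norml; apply/andP; split; lra.
Qed.

End cavity_process.

(** * Adding one spin *)
Lemma bernoulli_lower (R : realFieldType) (d : R) n : 0 <= d -> d <= 1 ->
  1 - n%:R * d <= (1 - d) ^+ n.
Proof.
move=> d0 d1; elim: n => [|n IH]; first by rewrite mul0r subr0 expr0.
rewrite exprS; apply: (@le_trans _ _ ((1 - d) * (1 - n%:R * d))).
  rewrite -subr_ge0 -(natr1 n) (_ : _ - _ = n%:R * (d * d)); last by ring.
  by rewrite !mulr_ge0.
by rewrite ler_wpM2l// subr_ge0.
Qed.

Lemma bernoulli_upper (R : realFieldType) (d : R) n : 0 <= d -> d <= 1 ->
  (1 - d) ^+ n <= 1 - n%:R * d + n%:R ^+ 2 * d ^+ 2.
Proof.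
move=> d0 d1; elim: n => [|n IH]; first by rewrite mul0r subr0 expr0 expr0n /= mul0r addr0.
rewrite exprS; apply: (@le_trans _ _ ((1 - d) * (1 - n%:R * d + n%:R ^+ 2 * d ^+ 2))).
  by rewrite ler_wpM2l// subr_ge0.
rewrite -subr_ge0 -(natr1 n) (_ : _ - _ = (n%:R + 1) * d ^+ 2 + n%:R ^+ 2 * d ^+ 3); last by ring.
by rewrite addr_ge0// mulr_ge0// ?exprn_ge0// addr_ge0.
Qed.

Lemma walk_count_ge0 (R : realFieldType) (D r : R) m : 0 <= D -> 0 <= r ->
  0 <= walk_count D r m.
Proof.
move=> D0 r0; elim: m => [|m IH] /=; first by rewrite addr0.
by rewrite addr_ge0// !mulr_ge0.
Qed.

(** The Poisson weight at m times m is [L] times the weight at m - 1. Since each step of a walk uses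
    up a clause, the partial sums therefore satisfy the linear recursion W <= 1 + L r W. *)
Lemma poisson_walk_count (R : realType) (L r rho : R) n : 0 <= L -> 0 <= r ->
  L * r <= rho -> rho < 1 ->
  \sum_(m < n) expR (- L) / m`!%:R * L ^+ m * walk_count 1 r m <= (1 - rho)^-1.
Proof.
move=> L0 r0 Lr rho1; 
pose W n := \sum_(m < n) expR (- L) / m`!%:R * L ^+ m * walk_count 1 r m.
have t0 m : 0 <= expR (- L) / m`!%:R * L ^+ m.
  by rewrite !mulr_ge0 ?expR_ge0 ?invr_ge0 ?exprn_ge0.
have w0 m := @walk_count_ge0 R 1 r m ler01 r0.
have W0 k : 0 <= W k by apply: sumr_ge0 => m _; rewrite mulr_ge0.
have WS k : W k <= W k.+1 by rewrite /W big_ord_recr /= lerDl mulr_ge0.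
have mass k : \sum_(m < k) expR (- L) / m`!%:R * L ^+ m <= 1.
  have := series_exp_le k L0; rewrite series_ord => H.
  rewrite [leRHS](_ : _ = expR (- L) * expR L); last by rewrite -expRD addNr expR0.
  rewrite (eq_bigr (fun m : 'I_k => expR (- L) * exp_coeff L m)).
    by rewrite -mulr_sumr ler_wpM2l ?expR_ge0.
  by move=> m _; rewrite /exp_coeff /=; ring.
have rec k : W k <= 1 + L * r * W k.
  case: k => [|k]; first by rewrite /W big_ord0 mulr0 addr0.
  apply: (@le_trans _ _ (1 + L * r * W k)); last first.
    by rewrite lerD2l ler_wpM2l ?mulr_ge0.
  rewrite {1}/W.
  rewrite (eq_bigr (fun m : 'I_k.+1 => expR (- L) / m`!%:R * L ^+ m +
     expR (- L) / m`!%:R * L ^+ m * (if nat_of_ord m is m'.+1 then m%:R * r * walk_count 1 r m' else 0))); last first.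
    by move=> m _; case: (nat_of_ord m) => [|m'] /=; rewrite mulrDr mulr1.
  rewrite big_split /=; apply: lerD; first exact: mass.
  rewrite big_ord_recl mulr0 add0r /W mulr_sumr; apply: ler_sum => m _.
  rewrite lift0 factS natrM exprS.
  have f1 : (m`!%:R : R) != 0 by rewrite pnatr_eq0 -lt0n fact_gt0.
  have f2 : (m.+1%:R : R) != 0 by rewrite pnatr_eq0.
  rewrite le_eqVlt; apply/orP; left; apply/eqP.
  have E (x y a b w : R) : x != 0 -> y != 0 ->
      a / (x * y) * (L * b) * (x * r * w) = L * r * (a / y * b * w).
    by move=> x0 y0; field; rewrite x0 y0.
  exact: E.
rewrite -/(W n) -[leRHS]mul1r ler_pdivlMr ?subr_gt0//.
have := rec n; have : L * r * W n <= rho * W n by rewrite ler_wpM2r.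
lra.
Qed.

Section PE_shift.
Context {R : realType} {S : zmodType}.

Lemma PE_shift (l : seq (R * S)) (f : S -> R) s :
  PE l f s = PE l (fun t => f (s + t)) 0.
Proof.
congr (limn (series _)); apply/funext => m; congr (_ * _).
rewrite -[in LHS](addr0 s); elim: m 0 => [//|m IH] t.
by rewrite !iterS /tstep; apply: eq_bigr => x _; rewrite -addrA IH.
Qed.

Lemma egrow_comp (S' : zmodType) (nu : S -> R) (nu' : S' -> R) (phi : S -> S') f K :
  0 <= K -> (forall s, nu' (phi s) <= K * nu s) ->
  egrow nu' f -> egrow nu (f \o phi).
Proof.
move=> K0 H [C [k [C0 k0 fC]]]; exists C, (k * K); split => //; first exact: mulr_ge0.
move=> s; apply: (le_trans (fC _)); rewrite ler_wpM2l// ler_expR -mulrA.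
by rewrite ler_wpM2l.
Qed.

Lemma egrow_bounded (nu : S -> R) f C : 0 <= C -> (forall s, `|f s| <= C) -> egrow nu f.
Proof. by move=> C0 fC; apply: egrow_le (egrow_cst nu C) _. Qed.

End PE_shift.

Section logZ_steps.
Context {R : realType} {W : finType} (W0 : (0 < #|W|)%N).

Lemma logZ_ge (H K : W -> R) b : (forall s, - b <= K s) -> logZ H - b <= logZ (H + K).
Proof.
move=> Kb; rewrite -logZ_cst//; apply: le_logZ => // s.
by rewrite lerD2l.
Qed.

Lemma PE_logZ_ge l b H : nonneg_rates l ->
  (forall x, x \in l -> forall s, - b <= x.2 s) ->
  logZ H - b * rate l <= PE l (@logZ R W) H.
Proof.
move=> lP lb; rewrite lerBlDr -[leLHS](PE_nil (R := R)).
apply: (PE_gen _ (@subadd_l1size R W)) => //; first exact: egrow_logZ.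
move=> K; rewrite {1}/tstep {1}/rate !big_nil mul0r subr0.
suff : rate l * (logZ K - b) <= tstep l (@logZ R W) K by lra.
rewrite /tstep /rate mulr_suml big_seq [leRHS]big_seq; apply: ler_sum => x xl.
apply: ler_wpM2l; first by move/allP : lP => /(_ x xl).
by apply: logZ_ge; exact: lb.
Qed.

End logZ_steps.

(** * Clauses sorted by their occurrences of the new spin *)

Section clause_split.
Context {R : realType} {V : finType} (V0 : (0 < #|V|)%N) (q : nat).
Notation clause W := {ffun 'I_q.+1 -> W * bool}.
Notation blabel := (('I_q.+1 * bool) * {ffun 'I_q -> V * bool})%type.

(* The new spin is [None]; a boundary clause contains it exactly once, in the
   slot [l.1.1] with the sign [l.1.2]. *)
Definition inner (a : clause V) : clause (option V) :=
  [ffun j => (Some (a j).1, (a j).2)].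

Definition boundary (l : blabel) : clause (option V) :=
  [ffun j => if unlift l.1.1 j is Some i then (Some (l.2 i).1, (l.2 i).2)
             else (None, l.1.2)].

Definition is_inner (a : clause (option V)) := [forall j, (a j).1 != None].
Definition is_boundary j0 (a : clause (option V)) :=
  ((a j0).1 == None) && [forall j, (j != j0) ==> ((a j).1 != None)].

(** The indicator of the clauses with the new spin in at least two slots. As a complement it makes
    both the splitting of sums and the counting linear identities. *)
Definition rest (a : clause (option V)) : R :=
  1 - (is_inner a)%:R - \sum_j (is_boundary j a)%:R.

Lemma rest_ge0 a : 0 <= rest a.
Proof.
rewrite /rest; have [/forallP ia|_] := boolP (is_inner a).
  rewrite big1 ?subr0 ?subrr// => j _.
  by rewrite /is_boundary (negbTE (ia j)).
rewrite subr0 subr_ge0.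
have [/existsP[j bj]|] := boolP [exists j, is_boundary j a]; last first.
  rewrite negb_exists => /forallP H; rewrite big1// => j _.
  by rewrite (negbTE (H j)).
rewrite (bigD1 j)//= bj big1 ?addr0// => i ij.
rewrite /is_boundary; move: bj => /andP[_ /forallP/(_ i)].
by rewrite ij /= => /negbTE ->.
Qed.

Lemma sum_inner (F : clause (option V) -> R) :
  \sum_(a | is_inner a) F a = \sum_a F (inner a).
Proof.
have /card_gt0P[v0 _] := V0.
rewrite (reindex inner) /=.
  apply: eq_bigl => a; apply/forallP => j; by rewrite ffunE.
exists (fun a => [ffun j => (odflt v0 (a j).1, (a j).2)]) => [a _|a].
  by apply/ffunP => j; rewrite !ffunE /=; case: (a j).
rewrite inE => /forallP ia; apply/ffunP => j; rewrite !ffunE.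
by have := ia j; case: (a j) => [[v|] b].
Qed.

Lemma sum_boundary (F : clause (option V) -> R) j0 :
  \sum_(a | is_boundary j0 a) F a = \sum_b \sum_xi F (boundary ((j0, b), xi)).
Proof.
have /card_gt0P[v0 _] := V0.
rewrite pair_bigA (reindex (fun l => boundary ((j0, l.1), l.2))) /=.
  apply: eq_bigl => -[b xi]; rewrite /is_boundary ffunE /= unlift_none eqxx /=.
  apply/forallP => j; apply/implyP; rewrite ffunE /=.
  by case: unliftP => [i ->|->]; rewrite ?eqxx.
exists (fun a => ((a j0).2, [ffun i => (odflt v0 (a (lift j0 i)).1, (a (lift j0 i)).2)])).
  move=> [b xi] _ /=; rewrite ffunE /= unlift_none; congr (_, _).
  by apply/ffunP => i; rewrite !ffunE /= liftK /=; case: (xi i).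
move=> a; rewrite inE => /andP[/eqP a0 /forallP ia]; apply/ffunP => j.
rewrite ffunE /=; case: unliftP => [i ji|->]; last by rewrite -a0; case: (a j0).
rewrite ffunE -ji /=; have := ia j.
by rewrite {1}ji eq_sym neq_lift /=; case: (a j) => [[v|] b].
Qed.

Lemma sum_clause_split (F : clause (option V) -> R) :
  \sum_a F a = \sum_a F (inner a) + \sum_l F (boundary l) + \sum_a rest a * F a.
Proof.
have -> : \sum_(l : blabel) F (boundary l) = \sum_j0 \sum_(a | is_boundary j0 a) F a.
  rewrite -(pair_bigA _ (fun jb xi => F (boundary (jb, xi)))) /=.
  rewrite -(pair_bigA _ (fun j0 b => \sum_xi F (boundary (j0, b, xi)))) /=.
  by apply: eq_bigr => j0 _; rewrite sum_boundary.
rewrite -sum_inner (big_mkcond is_inner).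
under [X in _ + X + _]eq_bigr do rewrite big_mkcond.
rewrite exchange_big /= -!big_split /=; apply: eq_bigr => a _.
rewrite /rest 2!mulrBl mul1r mulr_suml.
have -> : \sum_j (if is_boundary j a then F a else 0) = \sum_j (is_boundary j a)%:R * F a.
  by apply: eq_bigr => j _; case: ifP => _; rewrite ?mul1r ?mul0r.
by case: ifP => _; rewrite ?mul1r ?mul0r; ring.
Qed.

Lemma sum_rest : \sum_a rest a = ((#|V|%:R + 1) * 2) ^+ q.+1 - (#|V|%:R * 2) ^+ q.+1
  - (q.+1%:R * 2) * (#|V|%:R * 2) ^+ q.
Proof.
have := sum_clause_split (fun=> 1).
have cardc (W : finType) n : (#|{ffun 'I_n -> W * bool}|%:R : R) = (#|W|%:R * 2) ^+ n.
  by rewrite card_ffun card_prod card_bool card_ord natrX natrM.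
rewrite !sumr_const !card_prod card_bool card_ord cardc cardc card_option.
under eq_bigr do rewrite mulr1.
rewrite !natrM cardc -(natr1 #|V|) => ->.
by ring.
Qed.

End clause_split.

(** * Adding one spin or the missing clauses *)

Section spin_addition.
Context {R : realType} (q : nat) (beta : R) (beta0 : 0 < beta).
Context {V : finType} (V0 : (0 < #|V|)%N).
Notation config := {ffun V -> bool}.
Notation config' := {ffun option V -> bool}.
Notation clause := {ffun 'I_q.+1 -> V * bool}.

(** The slot [jb.1] of the new spin belongs to the label but leaves the energy unchanged; it only
    multiplies the rate by [q.+1]. *)
Definition cavity_lit (jb : 'I_q.+1 * bool) (e : bool) : R := lit jb.2 (spin R e).

Lemma cavity_lit01 jb e : 0 <= cavity_lit jb e <= 1.
Proof. exact: lit_spin01. Qed.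

Definition unglue (s : config') : config * bool :=
  ([ffun v => s (Some v)], s None).
Definition glue (se : config * bool) : config' :=
  [ffun o => if o is Some v then se.1 v else se.2].

Lemma glueK : cancel glue unglue.
Proof.
move=> [s e]; rewrite /unglue /glue ffunE; congr (_, _).
by apply/ffunP => v; rewrite !ffunE.
Qed.

Lemma unglueK : cancel unglue glue.
Proof. by move=> s; apply/ffunP => -[v|]; rewrite !ffunE. Qed.

Lemma logZ_unglue (A : config * bool -> R) : logZ (A \o unglue) = logZ A.
Proof.
congr (ln _); rewrite /partf (reindex glue) /=.
  by apply: eq_bigr => se _; rewrite glueK.
by exists unglue => ? _; [exact: glueK | exact: unglueK].
Qed.

Lemma clause_energy_inner (a : clause) s :
  clause_energy beta (inner a) s = clause_energy beta a (unglue s).1.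
Proof.
congr (ln (1 - _ * _)); apply: eq_bigr => j _.
by rewrite !ffunE.
Qed.

Lemma clause_energy_boundary l s :
  clause_energy beta (@boundary V q l) s = mixed_energy beta cavity_lit l (unglue s).
Proof.
case: l => -[j0 b] xi; congr (ln (1 - _ * _)).
rewrite (bigD1_ord j0) //= ffunE /= unlift_none /=; congr (_ * _).
by apply: eq_bigr => i _; rewrite !ffunE /= liftK.
Qed.

Lemma clause_energy_bounds (V' : finType) (a : {ffun 'I_q.+1 -> V' * bool}) s :
  - beta <= clause_energy beta a s <= 0.
Proof.
apply: weight_bounds => //; apply: prod01 => j; exact: lit_spin01.
Qed.

Variables (rr : R) (rr0 : 0 <= rr).

Definition spread (H : config -> R) (se : config * bool) : R := H se.1.

Definition add_spin (H : config -> R) : R :=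
  PE (jumps (fun=> rr) (@mixed_energy R beta V bool _ cavity_lit q)) (@logZ R (config * bool)%type) (spread H).

Let W0 : (0 < #|{ffun V -> bool}|)%N := config_gt0.
Let WB0 : (0 < #|{: config * bool}|)%N.
Proof. by rewrite card_prod card_bool muln_gt0 W0. Qed.

Lemma l1size_spread H : l1size (spread H) <= 2 * l1size H.
Proof.
rewrite /l1size -(pair_bigA _ (fun (s : config) (e : bool) => `|H s|)) /= mulr_sumr.
by apply: ler_sum => s _; rewrite big_bool /= mulr_natl mulr2n.
Qed.

Lemma egrow_add_spin : egrow (@l1size R config) add_spin.
Proof.
apply: (egrow_comp (phi := spread) (nu' := @l1size R (config * bool)%type) (K := 2)) => //.
- exact: l1size_spread.
- by apply: egrow_PE (@subadd_l1size R _) _; exact: egrow_logZ.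
Qed.

Lemma add_spinE H : add_spin H = logZ H +
  PE (jumps (fun=> rr) (@mixed_energy R beta V bool _ cavity_lit q)) (fun A => ln (mixpart H A)) 0.
Proof.
have sP := @subadd_l1size R (config * bool)%type.
have E A : logZ (spread H + A) = logZ H + ln (mixpart H A).
  rewrite /logZ -lnM ?posrE ?partf_gt0//; last first.
    by apply: mixpart_gt0; rewrite ?card_bool.
  congr ln; rewrite /mixpart mulr_sumr /partf.
  rewrite [LHS](eq_bigr (fun p => expR ((spread H + A) (p.1, p.2)))); last by case.
  rewrite -(pair_bigA _ (fun s e => expR ((spread H + A) (s, e)))) exchange_big /=.
  apply: eq_bigr => e _; rewrite -/(partf H) mulr_sumr.
  apply: eq_bigr => s _; rewrite expRD /gibbs /spread /=.
  by field; rewrite gt_eqF// partf_gt0.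
rewrite /add_spin PE_shift (eq_PE _ _ (g := fun A => logZ (spread H + A) + 0 * 0)).
  rewrite -[X in X + PE _ _ _](PE_cst (jumps (fun=> rr) (@mixed_energy R beta V bool _ cavity_lit q)) (logZ H) 0).
  rewrite -[X in _ + X]mul1r -(PED (nu := @l1size R (config * bool)%type)).
  - by apply: eq_PE => A; rewrite mul0r addr0 mul1r E.
  - exact: sP.
  - exact: egrow_cst.
  apply: (@egrow_le _ _ _ _ (fun A => `|logZ (spread H + A)| + 1 * `|logZ H|)).
    apply: egrowD => //; last exact: egrow_cst.
    have := egrow_shift (spread H) sP (egrow_logZ WB0).
    move=> [C [k [C0 k0 HC]]]; exists C, k; split => // A.
    by rewrite normr_id addrC.
  move=> A; rewrite mul1r (_ : ln _ = logZ (spread H + A) - logZ H).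
    exact: ler_normB.
  by rewrite E; ring.
by move=> A; rewrite mul0r addr0.
Qed.

Lemma rate_jumps_const (S : zmodType) (I : finType) (J : I -> S) :
  rate (jumps (fun=> rr) J) = rr * #|I|%:R.
Proof. by rewrite rate_jumps sumr_const mulr_natr. Qed.

(** The clauses on [option V] split into independent processes: the inner ones act on [V] alone, the
    boundary ones are those of [add_spin], and each remaining one lowers [logZ] by at most
    [beta]. *)
Lemma Phi_option_ge M :
  M / #|{ffun 'I_q.+1 -> option V * bool}|%:R = rr ->
  PE (jumps (fun=> rr) (@clause_energy R q beta V)) add_spin 0 -
    beta * (rr * \sum_a @rest R V q a) <= Phi q beta (option V) M.
Proof.
move=> MR; have W'0 : (0 < #|{ffun option V -> bool}|)%N by exact: config_gt0.
have sP := @subadd_l1size R config'.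
have sPB := @subadd_l1size R (config * bool)%type.
pose l1' := jumps (fun=> rr) (fun a : clause => clause_energy beta (inner a)).
pose l2' := jumps (fun=> rr) (fun l => clause_energy beta (@boundary V q l)).
pose l3' := jumps (fun a => rr * @rest R V q a) (@clause_energy R q beta (option V)).
have c0 : forall a, 0 <= rr * @rest R V q a by move=> a; rewrite mulr_ge0 ?rest_ge0.
have P3 : nonneg_rates l3' by exact: nonneg_rates_jumps.
have P12 : nonneg_rates (l1' ++ l2').
  by rewrite /nonneg_rates all_cat; apply/andP; split; exact: nonneg_rates_jumps.
rewrite /Phi (@PE_ext _ _ _ ((l1' ++ l2') ++ l3')); last first.
  move=> f s; rewrite !tstep_cat !tstep_jumps /sat_rates MR.
  rewrite -mulr_sumr (@sum_clause_split R V V0 q (fun a => f (s + clause_energy beta a))).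
  rewrite 2!mulrDr; congr (_ + _ + _); rewrite mulr_sumr//.
  by apply: eq_bigr => a _; rewrite mulrA.
have eZ' : egrow (@l1size R config') (@logZ R config') by exact: egrow_logZ.
rewrite (PE_cat _ _ _ sP eZ').
have -> : beta * (rr * \sum_a @rest R V q a) = beta * rate l3'.
  by rewrite rate_jumps mulr_sumr.
have -> : PE (jumps (fun=> rr) (@clause_energy R q beta V)) add_spin 0 =
    PE (l1' ++ l2') (@logZ R config') 0.
  pose l1'' := jumps (fun=> rr) (fun (a : clause) (se : config * bool) => clause_energy beta a se.1).
  pose l2'' := jumps (fun=> rr) (@mixed_energy R beta V bool _ cavity_lit q).
  pose chi (A : config * bool -> R) : config' -> R := A \o unglue.
  have -> : l1' ++ l2' = [seq (x.1, chi x.2) | x <- l1'' ++ l2''].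
    rewrite map_cat /l1' /l2' /l1'' /l2'' /jumps -!map_comp; congr (_ ++ _); apply/eq_map => i /=.
      by congr (_, _); apply/funext => s; rewrite clause_energy_inner.
    by congr (_, _); apply/funext => s; rewrite clause_energy_boundary.
  have chiD A B : chi (A + B) = chi A + chi B by [].
  have -> : (0 : config' -> R) = chi 0 by [].
  rewrite (PE_hom chiD) (eq_PE _ _ (g := @logZ R (config * bool)%type)); last first.
    by move=> A; exact: logZ_unglue.
  rewrite (PE_cat _ _ _ sPB (egrow_logZ WB0)).
  rewrite (@PE_jumps_hom _ _ _ spread _ _ (@clause_energy R q beta V))//.
have -> : PE (l1' ++ l2') (@logZ R config') 0 - beta * rate l3' =
    PE (l1' ++ l2') (fun H => logZ H + -1 * (beta * rate l3')) 0.
  by rewrite (PED _ _ _ sP eZ' (egrow_cst _ _)) PE_cst mulN1r.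
apply: (PE_le _ sP P12).
- by apply: egrowD => //; exact: egrow_cst.
- exact: egrow_PE.
move=> H; rewrite mulN1r; apply: PE_logZ_ge => // x /mem_jumps[a ->] s /=.
by case/andP : (clause_energy_bounds a s).
Qed.

Definition add_clauses (tau : R) (H : config -> R) : R :=
  PE (jumps (fun=> tau) (@clause_energy R q beta V)) (@logZ R config) H.

Lemma egrow_add_clauses tau : egrow (@l1size R config) (add_clauses tau).
Proof. by apply: egrow_PE (@subadd_l1size R _) _; exact: egrow_logZ. Qed.

(** Isolates the rate [rr], common to both sizes, so that the two quantities are averages over the
    same inner energy. *)
Lemma Phi_add_clauses M tau :
  M / #|{ffun 'I_q.+1 -> V * bool}|%:R = rr + tau ->
  Phi q beta V M = PE (jumps (fun=> rr) (@clause_energy R q beta V)) (add_clauses tau) 0.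
Proof.
move=> MR; rewrite -(PE_cat _ _ _ (@subadd_l1size R _) (egrow_logZ W0)).
apply: PE_ext => f s; rewrite tstep_cat !tstep_jumps -big_split.
by apply: eq_bigr => a _; rewrite /sat_rates MR mulrDl.
Qed.

Definition full_lit (_ _ : unit) : R := 1.

Lemma add_clausesE tau H : add_clauses tau H = logZ H +
  PE (jumps (fun=> tau) (@mixed_energy R beta V unit unit full_lit q.+1))
     (fun A => ln (mixpart H A)) 0.
Proof.
have sP := @subadd_l1size R config.
pose G (K : config -> R) := ln (\sum_s gibbs H s * expR (K s)).
have GE K : G K = logZ (H + K) - logZ H.
  by rewrite logZD// /G; ring.
have -> : PE (jumps (fun=> tau) (@mixed_energy R beta V unit unit full_lit q.+1))
     (fun A => ln (mixpart H A)) 0 = PE (jumps (fun=> tau) (@clause_energy R q beta V)) G 0.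
  pose phi (A : config * unit -> R) : config -> R := fun s => A (s, tt).
  rewrite -(@PE_ext _ _ (jumps (fun=> tau) (fun l : unit * clause => clause_energy beta l.2))); last first.
    move=> f s; rewrite !tstep_jumps -(pair_bigA _ (fun (u : unit) a => tau * f (s + clause_energy beta a))) /=.
    by rewrite (big_pred1 tt)//; case.
  rewrite (@PE_jumps_hom _ _ _ phi _ _ (@mixed_energy R beta V unit unit full_lit q.+1))//.
    by apply: eq_PE => A; rewrite /G /mixpart /= (big_pred1 tt)//; case.
  move=> [[] a]; apply/funext => s.
  by rewrite /phi /mixed_energy /full_lit mul1r.
rewrite /add_clauses PE_shift.
rewrite -[X in X + PE _ _ _](PE_cst (jumps (fun=> tau) (@clause_energy R q beta V)) (logZ H) 0).
rewrite -[X in _ + X]mul1r -(PED (nu := @l1size R config)) //.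
- by apply: eq_PE => K; rewrite mul1r GE; ring.
- exact: egrow_cst.
apply: (@egrow_le _ _ _ _ (fun K => `|logZ (K + H)| + 1 * `|logZ H|)).
  apply: egrowD => //; last exact: egrow_cst.
  have := egrow_shift H sP (egrow_logZ W0).
  move=> [C [k [C0 k0 HC]]]; exists C, k; split => // A.
  by rewrite normr_id.
by move=> K; rewrite mul1r GE (addrC H); exact: ler_normB.
Qed.

End spin_addition.
Section etheta_bounds.
Context {R : realType} (q : nat) (beta : R) (beta0 : 0 < beta) {I : finType}.
Variables (w x : I -> R) (w0 : forall i, 0 <= w i) (w1 : \sum_i w i = 1).
Variable (x1 : forall i, -1 <= x i <= 1).

Lemma etheta_bounds : - beta <= etheta q beta w x <= 0.
Proof.
have P0 n (b : {ffun 'I_n -> I * bool}) : 0 <= \prod_j (w (b j).1 / 2).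
  by apply: prodr_ge0 => j _; rewrite divr_ge0.
have P1 : \sum_(b : {ffun 'I_q.+1 -> I * bool}) \prod_j (w (b j).1 / 2) = 1.
  by rewrite (sum_ffun_prod _ (fun y : I * bool => w y.1 / 2)) sum_pair_bool ?expr1n.
have lb (b : {ffun 'I_q.+1 -> I * bool}) :
    - beta <= ln (1 - cbeta beta * \prod_j lit (b j).2 (x (b j).1)) <= 0.
  by apply: weight_bounds => //; apply: prod01 => j; exact: lit01.
apply/andP; split.
  rewrite -[leLHS]mul1r -[X in X * _ <= _]P1 mulr_suml; apply: ler_sum => b _.
  by rewrite ler_wpM2l//; case/andP : (lb b).
rewrite /etheta; apply: sumr_le0 => b _; rewrite mulr_ge0_le0//.
by case/andP : (lb b).
Qed.

Lemma field_energy_le0 l e : field_energy beta (q := q) x l e <= 0.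
Proof.
have /andP[l0 l1] := lit_spin01 (R := R) l.1 e.
have /andP[p0 p1] : 0 <= \prod_j lit (l.2 j).2 (x (l.2 j).1) <= 1.
  by apply: prod01 => j; exact: lit01.
suff /(weight_bounds beta0)/andP[] :
  0 <= lit l.1 (spin R e) * \prod_j lit (l.2 j).2 (x (l.2 j).1) <= 1 by [].
by rewrite mulr_ge0//= mulr_ile1.
Qed.

End etheta_bounds.

(** * The increment of N F_N *)

Section aizenman_sims_starr.
Context {R : realType} (q : nat) (alpha beta : R).
Hypotheses (alpha0 : 0 < alpha) (beta0 : 0 < beta).
Context {V : finType} (V0 : (0 < #|V|)%N).
Notation config := {ffun V -> bool}.
Notation clause := {ffun 'I_q.+1 -> V * bool}.
Notation c := (cbeta beta).
Notation N := (#|V|%:R : R).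

Let N0 : 0 < N. Proof. by rewrite ltr0n. Qed.
(** The rate of one clause on [option V]. On [V] a clause has at least this rate, and the excess is
    the [tau] of [ass_step]. *)
Let rr : R := alpha * (N + 1) / ((N + 1) * 2) ^+ q.+1.
Let rr0 : 0 <= rr.
Proof.
have N1 : 0 <= N + 1 by rewrite addr_ge0// ltW.
by rewrite /rr divr_ge0 ?exprn_ge0 ?mulr_ge0// ltW.
Qed.
Let w (v : V) : R := N^-1.
(** The probability that a uniform slot avoids the new spin. *)
Let y : R := N / (N + 1).
Let N10 : N + 1 != 0 :> R. Proof. by rewrite gt_eqF// ltr_wpDr. Qed.

Lemma uniform_weights : (forall v, 0 <= w v) /\ \sum_v w v = 1.
Proof.
split=> [v|]; first by rewrite invr_ge0 ltW.
by rewrite sumr_const -[LHS]mulr_natl divff// gt_eqF.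
Qed.

Lemma y01 : 0 <= y <= 1.
Proof.
have N1 : 0 < N + 1 by rewrite ltr_wpDr.
apply/andP; split; first by rewrite divr_ge0// ltW.
by rewrite /y ler_pdivrMr// mul1r lerDl.
Qed.

Lemma rr_inner : rr * #|clause|%:R = alpha * N * y ^+ q.
Proof.
rewrite card_clause /rr /y exprMn exprMn expr_div_n !exprS.
have : (2 : R) ^+ q != 0 by rewrite expf_neq0.
have : (N + 1) ^+ q != 0 by rewrite expf_neq0.
move: (2 ^+ q) ((N + 1) ^+ q) (N ^+ q) N10 => a b d; move: (N + 1) => e e0 b0 a0.
by field; rewrite e0 b0 a0.
Qed.

Lemma rr_boundary :
  rr * #|{: ('I_q.+1 * bool) * {ffun 'I_q -> V * bool}}|%:R = alpha * q.+1%:R * y ^+ q.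
Proof.
rewrite !card_prod card_ffun !card_prod card_bool !card_ord !natrM natrX natrM.
rewrite /rr /y exprMn exprMn expr_div_n !exprS.
have : (2 : R) ^+ q != 0 by rewrite expf_neq0.
have : (N + 1) ^+ q != 0 by rewrite expf_neq0.
move: (2 ^+ q) ((N + 1) ^+ q) (N ^+ q) N10 (q.+1%:R : R) => a b d; move: (N + 1) => e e0 p b0 a0.
by field; rewrite e0 b0 a0.
Qed.

Section pointwise.
Variables (k : R) (k0 : 0 < k) (H : config -> R).
Let eta := (k * spin_cov H + k^-1) / 2 / N.
Let x := magnetization H.
(** Common to both uses of [cavity_estimate]: [q] random literals beside a new spin, and [q.+1] in a
    whole clause. *)
Let K := expR (2 * expR beta * (alpha * q.+1%:R)) * (2 * q.+1%:R).

Let eta0 : 0 <= eta. Proof. exact: eta_ge0. Qed.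
Let x1 v : -1 <= x v <= 1. Proof. exact: magnetization_bounds. Qed.

Lemma error_factor L n : L <= alpha * q.+1%:R -> (n <= q.+1)%N ->
  expR (2 * expR beta * L) * (2 * (n%:R * eta)) <= K * eta.
Proof.
move=> LA nq; rewrite /K -[leRHS]mulrA; apply: ler_pM.
- exact: expR_ge0.
- by do 2!apply: mulr_ge0 => //.
- by rewrite ler_expR ler_wpM2l// mulr_ge0// expR_ge0.
- by rewrite -mulrA ler_wpM2l// ler_wpM2r// ler_nat.
Qed.

(** By [cavity_estimate] the boundary clauses act as mean-field jumps, but of total rate
    [alpha * q.+1%:R * y ^+ q], short of the rate in [cavity]. Field energies are nonpositive, so
    supplying the missing jumps only lowers [logZ]. *)
Lemma add_spin_ge :
  logZ H + (ln 2 + cavity q beta w x (alpha * q.+1%:R)) - K * eta <= add_spin q beta rr H.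
Proof.
rewrite add_spinE// -addrA lerD2l.
have b0 : (0 < #|{: bool}|)%N by rewrite card_bool.
have := cavity_estimate beta0 V0 b0 (@cavity_lit01 R q) q rr0 k0 H.
rewrite rr_boundary -/eta => /ler_normlP[CE _].
have /andP[y0 y1] := y01.
have yL : alpha * q.+1%:R * y ^+ q <= alpha * q.+1%:R.
  by rewrite ler_piMr ?exprn_ile1// mulr_ge0// ltW.
have EF := error_factor yL (leqnSn q).
rewrite -cavity_logZ.
set fl := jumps (field_rates _ _) _.
pose lm := jumps (fun=> rr) (@mean_energy R beta V bool _ (@cavity_lit R q) q H).
(* The missing rate per label, once the [q.+1] slots of the new spin, which have equal energies, are
   merged. *)
pose dif (l : bool * {ffun 'I_q -> V * bool}) := field_rates w (alpha * q.+1%:R) l - rr * q.+1%:R.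
have frE (l : bool * {ffun 'I_q -> V * bool}) : field_rates w (alpha * q.+1%:R) l = alpha * q.+1%:R / 2 * (N * 2)^-1 ^+ q.
  by rewrite /field_rates /w prodr_const card_ord -invfM.
have dif0 l : 0 <= dif l.
  rewrite /dif frE subr_ge0 /rr.
  have -> : alpha * (N + 1) / ((N + 1) * 2) ^+ q.+1 * q.+1%:R =
      alpha * q.+1%:R / 2 * ((N + 1) * 2)^-1 ^+ q.
    rewrite exprVn exprS; have : ((N + 1) * 2) ^+ q != 0.
      by rewrite expf_neq0// mulf_neq0.
    move: (((N + 1) * 2) ^+ q) N10 => z; move: (N + 1) => e e0 z0.
    by field; rewrite e0 z0.
  have a0 : 0 <= alpha * q.+1%:R / 2 by rewrite divr_ge0// mulr_ge0// ltW.
  rewrite ler_wpM2l//; have NN : 0 < N + 1 by rewrite ltr_wpDr.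
  apply: lerXn2r; rewrite ?nnegrE ?invr_ge0.
  - by rewrite mulr_ge0// ltW.
  - by rewrite mulr_ge0// ltW.
  - by rewrite lef_pV2 ?posrE ?mulr_gt0// ler_wpM2r// lerDl.
pose extra := jumps dif (field_energy beta x).
have flE : PE fl (@logZ R bool) 0 = PE (lm ++ extra) (@logZ R bool) 0.
  apply: PE_ext => f s; rewrite tstep_cat !tstep_jumps.
  rewrite -(pair_bigA _ (fun jb xi => rr * f (s + mean_energy beta (@cavity_lit R q) H (jb, xi)))) /=.
  rewrite -(pair_bigA _ (fun j b => \sum_xi rr * f (s + mean_energy beta (@cavity_lit R q) H (j, b, xi)))) /=.
  rewrite [X in _ = X + _](eq_bigr (fun=> \sum_(b : bool) \sum_(xi : {ffun 'I_q -> V * bool})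
    rr * f (s + field_energy beta x (b, xi))))//.
  rewrite sumr_const pair_bigA /= card_ord -[X in _ = X + _]mulr_natl mulr_sumr -big_split /=.
  by apply: eq_bigr => -[b xi] _; rewrite /dif /= mulrBl; ring.
have le : PE fl (@logZ R bool) 0 <= PE lm (@logZ R bool) 0.
  rewrite flE; apply: (PE_cat_le _ (@subadd_l1size R bool)).
  - by apply: nonneg_rates_jumps.
  - exact: nonneg_rates_jumps.
  - exact: egrow_logZ.
  move=> s z /mem_jumps[l ->] /=; apply: le_logZ => // e.
  by rewrite -[leRHS]addr0; apply: lerD => //; exact: field_energy_le0.
apply: le_trans (lerD le (lexx _)) _.
rewrite lerBlDr -lerBlDl; apply: le_trans EF; apply: le_trans CE.
by rewrite opprB.
Qed.

(** Without a new spin the mean-field state is a single number and [ln (partf f)] is this number.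
    Its expectation is thus exactly the total rate times [etheta]. *)
Lemma add_clauses_le tau : 0 <= tau -> tau * #|clause|%:R <= alpha * q.+1%:R ->
  add_clauses q beta tau H <=
  logZ H + tau * #|clause|%:R * etheta q beta w x + K * eta.
Proof.
move=> tau0 tauL; rewrite add_clausesE// -addrA lerD2l.
have u0 : (0 < #|{: unit}|)%N by rewrite card_unit.
have fl01 (i j : unit) : 0 <= (full_lit i j : R) <= 1 by rewrite /full_lit ler01 lexx.
have := cavity_estimate beta0 V0 u0 fl01 q.+1 tau0 k0 H.
rewrite -/eta card_prod card_unit mul1n => /ler_normlP[_ CE].
have EF := error_factor tauL (leqnn q.+1).
rewrite -lerBlDl; apply: le_trans EF; apply: le_trans CE.
rewrite lerD2l lerN2 (@PE_gen_const _ _ (@l1size R unit) _ _ (tau * #|clause|%:R * etheta q beta w x)).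
- rewrite /partf (big_pred1 tt) => [|[]//]; rewrite expRK.
  by rewrite -[X in _ <= X]add0r lerD2r.
- exact: subadd_l1size.
- exact: nonneg_rates_jumps.
- exact: egrow_logZ.
move=> f; rewrite -gen_jumps.
have E (h : unit -> R) : ln (partf h) = h tt.
  by rewrite /partf (big_pred1 tt) => [|[]//]; rewrite expRK.
rewrite -(pair_bigA _ (fun u a => tau * (ln (partf (f + mean_energy beta full_lit H (u, a))) - ln (partf f)))) /=.
rewrite (big_pred1 tt) => [|[]//]; rewrite /etheta mulr_sumr; apply: eq_bigr => a _.
rewrite !E /w /= prodr_const card_ord -invfM [N * 2]mulrC exprVn.
rewrite (mulrC 2) -card_clause -mulrA mulVKf; last first.
  by rewrite card_clause expf_neq0// mulf_neq0// gt_eqF.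
congr (_ * _); rewrite -[(f + _) tt]/(f tt + mean_energy beta full_lit H (tt, a) tt).
by rewrite addrC addKr /mean_energy /full_lit /= mul1r.
Qed.

End pointwise.
Lemma prod_bool (J : finType) (B : pred J) :
  \prod_j (B j)%:R = [forall j, B j]%:R :> R.
Proof.
have [/forallP H|/forallPn[j /negbTE Bj]] := boolP [forall j, B j].
  by rewrite big1// => j _; rewrite H.
by rewrite (bigD1 j)//= Bj mul0r.
Qed.

Lemma expR_clause_energy (a : clause) (s : config) :
  expR (clause_energy beta a s) = clausew c a s.
Proof.
have -> : clausew c a s = 1 - c * \prod_j lit (a j).2 (spin R (s (a j).1)).
  rewrite /clausew /satisfies -prod_bool; congr (1 - c * _).
  by apply: eq_bigr => j _; rewrite lit_spin eq_sym.
rewrite lnK// posrE; apply: weight_gt0 => //.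
have /andP[] // : 0 <= \prod_j lit (a j).2 (spin R (s (a j).1)) <= 1.
by apply: prod01 => j; exact: lit_spin01.
Qed.

Lemma expR_sum_clause_energy (t : seq clause) (s : config) :
  expR ((\sum_(a <- t) clause_energy beta a) s) = \prod_(a <- t) clausew c a s.
Proof.
elim: t => [|a t IH]; first by rewrite !big_nil expR0.
by rewrite !big_cons -IH -expR_clause_energy -expRD.
Qed.

Lemma gibbs_avgE (t : seq clause) (f : config -> R) :
  gibbs_avg c f t = \sum_s gibbs (\sum_(a <- t) clause_energy beta a) s * f s.
Proof.
have wE s : gibbsw c (@one_field R V) t s = expR ((\sum_(a <- t) clause_energy beta a) s).
  by rewrite expR_sum_clause_energy /gibbsw big1 ?mul1r.
rewrite /gibbs_avg /gsum.
have -> : \sum_s 1 * gibbsw c (@one_field R V) t s = partf (\sum_(a <- t) clause_energy beta a).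
  by apply: eq_bigr => s _; rewrite mul1r wE.
rewrite mulr_suml; apply: eq_bigr => s _.
by rewrite wE /gibbs -mulrA mulrC.
Qed.

Lemma spin_covE (t : seq clause) :
  spin_cov (\sum_(a <- t) clause_energy beta a) = covsum c t.
Proof.
by apply: eq_bigr => v _; apply: eq_bigr => u _; rewrite !gibbs_avgE.
Qed.

Lemma spin_cov_bounded (H : config -> R) : `|spin_cov H| <= N * (N * 2).
Proof.
rewrite ger0_norm ?spin_cov_ge0// /spin_cov.
have g0 := gibbs_ge0 config_gt0 H; have g1 := gibbs_sum1 config_gt0 H.
have F1 (f : config -> bool) : `|\sum_s gibbs H s * (f s)%:R| <= 1.
  by apply: avg_norm_le1 => // s; case: (f s); rewrite ?normr1 ?normr0.
apply: (@le_trans _ _ (\sum_(v : V) \sum_(u : V) 2)); last first.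
  by rewrite !sumr_const -[leLHS]mulr_natl -[X in _ * X <= _]mulr_natl.
apply: ler_sum => v _; apply: ler_sum => u _.
apply: (le_trans (ler_normB _ _)); rewrite mulr2n; apply: lerD.
  have := F1 (fun s => s v && s u).
  by rewrite (eq_bigr (fun s => gibbs H s * ((s v)%:R * (s u)%:R)))// => s _; rewrite -mulnb natrM.
by rewrite normrM mulr_ile1.
Qed.

Definition rho := c * (q.+1 * q)%:R * alpha.

Hypothesis rho1 : rho < 1.

Let l1 := jumps (fun=> rr) (@clause_energy R q beta V).

(** Given m inner clauses the covariances are summed over all m-tuples by [sum_tuple_covsum], and
    [poisson_walk_count] averages over m. The mean number of inner clauses times the weight of a
    step is [rho * y ^+ q]. *)
Lemma PE_spin_cov : PE l1 (@spin_cov R V) 0 <= N / (1 - rho).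
Proof.
have c0 := cbeta_ge0 beta0; have c1 := cbeta_lt1 beta.
have L0 : 0 <= rr * #|clause|%:R by rewrite mulr_ge0.
pose r0 := c * (q.+1 * q)%:R / N.
have r00 : 0 <= r0 by rewrite !mulr_ge0// invr_ge0 ltW.
have Lr : rr * #|clause|%:R * r0 <= rho.
  rewrite rr_inner /r0 /rho.
  rewrite (_ : _ * _ = c * (q.+1 * q)%:R * alpha * y ^+ q); last by field; rewrite gt_eqF.
  have /andP[y0 y1] := y01.
  apply: ler_piMr; last exact: exprn_ile1.
  by rewrite !mulr_ge0// ltW.
apply: (@PE_partial_le _ _ (@l1size R config)); first exact: subadd_l1size.
  apply: (@egrow_bounded _ _ _ _ (N * (N * 2))); last exact: spin_cov_bounded.
  by rewrite !mulr_ge0.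
move=> n; rewrite series_ord.
apply: le_trans (_ : N * \sum_(m < n) expR (- (rr * #|clause|%:R)) / m`!%:R *
    (rr * #|clause|%:R) ^+ m * walk_count 1 r0 m <= _); last first.
  by rewrite ler_wpM2l//; exact: poisson_walk_count.
rewrite mulr_sumr; apply: ler_sum => m _.
rewrite /pterm rate_jumps_const// iter_tstep_jumps.
rewrite (_ : N * _ = expR (- (rr * #|clause|%:R)) / m`!%:R *
  (rr ^+ m * (#|clause|%:R ^+ m * (N * walk_count 1 r0 m)))); last by rewrite exprMn; ring.
apply: ler_wpM2l; first by rewrite mulr_ge0 ?expR_ge0 ?invr_ge0.
have -> : \sum_(t : m.-tuple clause) (\prod_(i <- t) rr) *
     spin_cov (0 + \sum_(i <- t) clause_energy beta i) =
   rr ^+ m * \sum_(t : m.-tuple clause) covsum c t.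
  rewrite mulr_sumr; apply: eq_bigr => t _; rewrite add0r spin_covE.
  by rewrite big_const_seq count_predT size_tuple -Monoid.iteropE.
rewrite ler_wpM2l ?exprn_ge0//.
have := sum_tuple_covsum (p := q.+1) c0 c1 m V0.
by rewrite /r0 /=.
Qed.

Definition ass_const : R :=
  expR (2 * expR beta * (alpha * q.+1%:R)) * (2 * q.+1%:R).

(** The first term pays for replacing the mass of the missing clauses by [alpha * q%:R], the second
    for the clauses that contain the new spin more than once. *)
Definition ass_shift : R :=
  beta * (alpha * (q%:R + q%:R ^+ 2)) + beta * (alpha * (q.+1%:R * q%:R)).

Let d : R := (N + 1)^-1.
Let d0 : 0 <= d. Proof. by rewrite invr_ge0 addr_ge0// ltW. Qed.
Let d1 : d <= 1.
Proof. by rewrite invf_le1 ?ltr_wpDr// lerDr ltW. Qed.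
Let yd : y = 1 - d.
Proof. by rewrite /y /d; move: N10 => e; field. Qed.

(** Two slots must hit the new spin, which has probability of order d^2, against a total rate of
    order 1 / d. *)
Lemma rest_mass : rr * \sum_a @rest R V q a <= alpha * (q.+1%:R * q%:R) * d.
Proof.
have -> : rr * \sum_a @rest R V q a =
    alpha * (N + 1) * (1 - y ^+ q.+1 - q.+1%:R * d * y ^+ q).
  rewrite sum_rest // /rr /y /d !exprMn !exprVn !exprS.
  have : (2 : R) ^+ q != 0 by rewrite expf_neq0.
  have : (N + 1) ^+ q != 0 by rewrite expf_neq0.
  move: (2 ^+ q) ((N + 1) ^+ q) (N ^+ q) N10 (q.+1%:R : R) => a b e.
  move: (N + 1) => f f0 p b0 a0.
  by field; rewrite f0 b0 a0.
rewrite yd.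
have H1 := bernoulli_lower q.+1 d0 d1.
have H2 : q.+1%:R * d * (1 - q%:R * d) <= q.+1%:R * d * (1 - d) ^+ q.
  by rewrite ler_wpM2l ?mulr_ge0// bernoulli_lower.
apply: (@le_trans _ _ (alpha * (N + 1) * (q.+1%:R * q%:R * d ^+ 2))).
  rewrite ler_wpM2l//; first by rewrite mulr_ge0// ?ltW// ltr_wpDr.
  have -> : q.+1%:R * q%:R * d ^+ 2 = 1 - (1 - q.+1%:R * d) - q.+1%:R * d * (1 - q%:R * d) by ring.
  lra.
rewrite le_eqVlt; apply/orP; left; apply/eqP.
by rewrite /d; move: N10 => e; field.
Qed.

Lemma ass_step L k : 0 < k ->
  (forall x : V -> R, (forall v, -1 <= x v <= 1) -> L <= Pdisc q beta w x alpha) ->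
  L - ass_shift / (N + 1) - ass_const * (k / (1 - rho) + (k * N)^-1) <=
  Phi q beta (option V) (alpha * #|{: option V}|%:R) - Phi q beta V (alpha * N).
Proof.
move=> k0 HL.
have sP := @subadd_l1size R config.
have a0 := ltW alpha0; have b0 := ltW beta0; have Nge0 := ltW N0.
(* Chosen so that the rate [rr + tau] per clause on [V] adds up to [alpha * N]. *)
pose tau := (alpha * N - rr * #|clause|%:R) / #|clause|%:R.
have cl0 : (#|clause|%:R : R) != 0.
  by rewrite card_clause expf_neq0// mulf_neq0// gt_eqF.
have clp : 0 < (#|clause|%:R : R) by rewrite lt0r cl0 /=.
have tauL : tau * #|clause|%:R = alpha * N * (1 - y ^+ q).
  by rewrite /tau divfK// rr_inner; ring.
have /andP[y0 y1] := y01.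
have aN0 : 0 <= alpha * N by rewrite mulr_ge0// ltW.
have tau0 : 0 <= tau.
  rewrite -(pmulr_lge0 _ clp) tauL mulr_ge0// subr_ge0; exact: exprn_ile1.
have Nd : N * d <= 1.
  by rewrite /d ler_pdivrMr ?ltr_wpDr// mul1r lerDl.
have tauU : tau * #|clause|%:R <= alpha * q%:R.
  rewrite tauL -mulrA ler_wpM2l// yd.
  have H := bernoulli_lower q d0 d1.
  apply: (@le_trans _ _ (N * (q%:R * d))); first by rewrite ler_wpM2l// lerBlDr -lerBlDl.
  by rewrite mulrCA ler_piMr.
have tauU' : tau * #|clause|%:R <= alpha * q.+1%:R.
  by apply: (le_trans tauU); rewrite ler_wpM2l// ler_nat.
have tauG : alpha * q%:R - tau * #|clause|%:R <= alpha * (q%:R + q%:R ^+ 2) * d.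
  rewrite tauL -mulrA -mulrBr -mulrA ler_wpM2l// yd.
  have H := bernoulli_upper q d0 d1.
  have H2 : N * (q%:R * d - q%:R ^+ 2 * d ^+ 2) <= N * (1 - (1 - d) ^+ q).
    by rewrite ler_wpM2l//; lra.
  have NdE : N * d = 1 - d by rewrite /d; move: N10 => e; field.
  have E : N * (q%:R * d - q%:R ^+ 2 * d ^+ 2) = (1 - d) * q%:R - (1 - d) * d * q%:R ^+ 2.
    by rewrite -NdE; ring.
  have : 0 <= d ^+ 2 * q%:R ^+ 2 by rewrite mulr_ge0// exprn_ge0.
  rewrite E in H2 *; move=> ?.
  have -> : (q%:R + q%:R ^+ 2) * d = q%:R - ((1 - d) * q%:R - (1 - d) * d * q%:R ^+ 2) + d ^+ 2 * q%:R ^+ 2 by ring.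
  lra.
have PhiV : Phi q beta V (alpha * N) = PE l1 (add_clauses q beta tau) 0.
  by apply: Phi_add_clauses => //; rewrite /tau mulrBl mulfK// addrC subrK.
have PhiO : PE l1 (add_spin q beta rr) 0 - beta * (rr * \sum_a @rest R V q a) <=
    Phi q beta (option V) (alpha * #|{: option V}|%:R).
  apply: Phi_option_ge => //.
  by rewrite card_clause card_option -(natr1 #|V|).
have [w0 w1] := uniform_weights.
pose err (H : config -> R) := ass_const * ((k * spin_cov H + k^-1) / N).
(* For each inner energy [H] the terms [logZ H] of the two additions cancel, which leaves [Pdisc] at
   the magnetizations of [H]. *)
have pw H : L - beta * (alpha * (q%:R + q%:R ^+ 2) * d) - err H <=
    add_spin q beta rr H + -1 * add_clauses q beta tau H.
  have x1 := magnetization_bounds H.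
  have A1 := add_spin_ge k0 H; have A2 := add_clauses_le k0 H tau0 tauU'.
  have := HL _ x1; rewrite /Pdisc => A3.
  have /andP[e0 e1] := etheta_bounds q beta0 w0 w1 x1.
  (* The missing clauses have slightly less mass than [alpha * q%:R]; as [etheta] lies between -
     beta and 0, the deficit costs at most [beta] times itself. *)
  have A4 : - (beta * (alpha * (q%:R + q%:R ^+ 2) * d)) <=
      (alpha * q%:R - tau * #|clause|%:R) * etheta q beta w (magnetization H).
    move: tauG e0 e1 tauU; set X := _ - _; set Y := _ * d; set e := etheta _ _ _ _.
    move=> XY be e0 X0; have {}X0 : 0 <= X by rewrite /X; lra.
    have : X * (- beta) <= X * e by rewrite ler_wpM2l.
    have : beta * X <= beta * Y by rewrite ler_wpM2l.
    by rewrite mulrN (mulrC X beta); lra.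
  move: A1 A2 A3 A4; rewrite /err /ass_const -/w.
  set K := expR _ * _; set T := tau * _.
  have -> : K * ((k * spin_cov H + k^-1) / N) = K * ((k * spin_cov H + k^-1) / 2 / N) +
     K * ((k * spin_cov H + k^-1) / 2 / N).
    by field; rewrite !gt_eqF.
  lra.
have l1P : nonneg_rates l1 by exact: nonneg_rates_jumps.
have eC : egrow (@l1size R config) (@spin_cov R V).
  apply: (@egrow_bounded _ _ _ _ (N * (N * 2))); last exact: spin_cov_bounded.
  by rewrite !mulr_ge0.
have e1 : egrow (@l1size R config) (add_spin q beta rr) by exact: egrow_add_spin.
have e2 : egrow (@l1size R config) (add_clauses q beta tau) by exact: egrow_add_clauses.
have E1 : PE l1 (fun H => (L - beta * (alpha * (q%:R + q%:R ^+ 2) * d) - ass_const * (k^-1 / N)) +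
     (- (ass_const * (k / N))) * spin_cov H) 0 <= 
   PE l1 (fun H => add_spin q beta rr H + -1 * add_clauses q beta tau H) 0.
  apply: (PE_le _ sP l1P).
  - by apply: egrowD => //; exact: egrow_cst.
  - exact: egrowD.
  move=> H; apply: le_trans (pw H); rewrite le_eqVlt; apply/orP; left; apply/eqP.
  by rewrite /err; field; rewrite !gt_eqF.
rewrite (PED _ _ _ sP (egrow_cst _ _) eC) PE_cst (PED _ _ _ sP e1 e2) mulN1r in E1.
rewrite PhiV; have PC := PE_spin_cov.
have K0 : 0 <= ass_const * (k / N).
  by rewrite !mulr_ge0 ?expR_ge0 ?invr_ge0// ltW.
have := ler_wpM2l K0 PC.
have -> : ass_const * (k / N) * (N / (1 - rho)) = ass_const * (k / (1 - rho)).
  by field; rewrite !gt_eqF ?subr_gt0.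
have RM := ler_wpM2l (ltW beta0) rest_mass.
have -> : ass_const * (k / (1 - rho) + (k * N)^-1) =
    ass_const * (k / (1 - rho)) + ass_const * (k^-1 / N).
  by rewrite invfM mulrDr.
have -> : ass_shift / (N + 1) = beta * (alpha * (q%:R + q%:R ^+ 2) * d) +
    beta * (alpha * (q.+1%:R * q%:R) * d).
  by rewrite /ass_shift /d; ring.
move: E1; rewrite mulNr; lra.
Qed.

End aizenman_sims_starr.

(** * From random variables to compound Poisson expectations *)
Section compound_poisson.
Context {d : measure_display} {T : measurableType d} {R : realType}.
Context (P : probability T R) {I : finType} {S : zmodType}.
Variables (count : T -> nat) (xi : nat -> T -> I) (L : R) (pi : I -> R) (J : I -> S).
Hypotheses (L0 : 0 < L) (pi1 : \sum_i pi i = 1).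
Hypothesis mcount : forall m, measurable (count @^-1` [set m]).
Hypothesis mxi : forall k i, measurable (xi k @^-1` [set i]).

Definition cylinder m (t : m.-tuple I) : set T :=
  count @^-1` [set m] `&` \bigcap_(k : 'I_m) (xi k @^-1` [set tnth t k]).

Hypothesis law : forall m (t : m.-tuple I),
  P (cylinder t) = (poisson_pmf L m * \prod_(k < m) pi (tnth t k))%:E.

Let l := jumps (fun i => L * pi i) J.
Let F (f : S -> R) (w : T) : R := f (\sum_(k < count w) J (xi k w)).

Lemma measurable_cylinder m (t : m.-tuple I) : measurable (cylinder t).
Proof.
apply: measurableI => //; apply: fin_bigcap_measurable => //.
Qed.

Lemma count_cylinder m : count @^-1` [set m] =
  \big[setU/set0]_(t <- enum {: m.-tuple I}) cylinder t.
Proof.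
rewrite -bigcup_seq; apply/seteqP; split=> [w cw|w [t _ []]//].
exists [tuple xi k w | k < m] => /=; first by rewrite mem_enum.
by split=> // k _ /=; rewrite tnth_mktuple.
Qed.

Lemma F_cylinder f m (t : m.-tuple I) w : cylinder t w -> F f w = f (0 + \sum_(i <- t) J i).
Proof.
move=> [cw tw]; rewrite /F cw add0r big_tuple; congr f.
by apply: eq_bigr => k _; have /= -> := tw k Logic.I.
Qed.

Lemma bigcup_count : \bigcup_m (count @^-1` [set m]) = setT.
Proof. by apply/seteqP; split=> // w _; exists (count w). Qed.

Lemma trivIset_count : trivIset setT (fun m => count @^-1` [set m]).
Proof. by apply/trivIsetP => i j _ _ ij; apply/seteqP; split=> // w [/= -> /eqP]; rewrite (negbTE ij). Qed.

Lemma measurable_F f : measurable_fun setT (F f).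
Proof.
rewrite -bigcup_count; apply/measurable_fun_bigcup => // m.
move=> mD Y mY.
rewrite (_ : _ `&` _ = \bigcup_(t in [set t : m.-tuple I | Y (f (0 + \sum_(i <- t) J i))]) cylinder t).
  by apply: fin_bigcup_measurable => // t _; exact: measurable_cylinder.
apply/seteqP; split=> [w [cw Fw]|w [t /= tY ct]].
  move: cw; rewrite count_cylinder -bigcup_seq => -[t tm ct].
  by exists t => //=; rewrite -(F_cylinder f ct).
split; first by have [] := ct.
by rewrite /preimage /= (F_cylinder f ct).
Qed.

(** The integrand is constant on each cylinder. The label probabilities sum to 1, so the total rate
    is [L] and the law of the cylinders reproduces the Poisson term exactly. *)
Lemma integral_count f m :
  (\int[P]_(w in count @^-1` [set m]) (F f w)%:E = (pterm l f 0 m)%:E)%E.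
Proof.
rewrite count_cylinder integral_bigsetU_EFin.
- rewrite big_enum /=.
  rewrite (eq_bigr (fun t : m.-tuple I => (f (0 + \sum_(i <- t) J i) *
      (poisson_pmf L m * \prod_(k < m) pi (tnth t k)))%:E)); last first.
    move=> t _; rewrite (eq_integral (fun=> (f (0 + \sum_(i <- t) J i))%:E)).
      rewrite integral_cst; last exact: measurable_cylinder.
      by rewrite /= law EFinM.
    by move=> w /set_mem ct; rewrite (F_cylinder f ct).
  rewrite sumEFin; congr EFin.
  rewrite /pterm iter_tstep_jumps rate_jumps -mulr_sumr pi1 mulr1 mulr_sumr.
  apply: eq_bigr => t _; rewrite /poisson_pmf L0 big_split /= !big_tuple.
  by rewrite prodr_const card_ord; ring.
- exact: measurable_cylinder.
- exact: enum_uniq.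
- apply/trivIsetP => t u _ _ tu; apply/seteqP; split=> // w [[_ tw] [_ uw]].
  move/eqP : tu; apply; apply/eq_from_tnth => k.
  by have /= <- := tw k Logic.I; have /= <- := uw k Logic.I.
- rewrite -count_cylinder; apply/measurable_EFinP.
  exact: measurable_funS (measurable_F f).
Qed.

Context (nu : S -> R) (nuP : subadd nu) (f : S -> R) (fE : egrow nu f).

Lemma pterm_series_EFin (g : S -> R) : egrow nu g ->
  (\sum_(m <oo) (pterm l g 0 m)%:E = (PE l g 0)%:E)%E.
Proof.
move=> gE; apply: cvg_lim => //.
rewrite (_ : (fun n => _) = EFin \o series (pterm l g 0)); last first.
  by apply/funext => n /=; rewrite sumEFin.
apply: cvg_EFin; first by apply: nearW.
exact: PE_cvg gE.
Qed.

(** The same computation for the absolute value of [f], which is still in the growth class. *)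
Lemma integrable_F : P.-integrable setT (EFin \o F f).
Proof.
apply/integrableP; split; first by apply/measurable_EFinP; exact: measurable_F.
pose g s := `|f s|.
have gE : egrow nu g.
  by have [C [k [C0 k0 fC]]] := fE; exists C, k; split => // s; rewrite normr_id.
rewrite (_ : (fun w => _) = (fun w => (F g w)%:E)); last first.
  by apply/funext => w /=.
rewrite -bigcup_count ge0_integral_bigcup//.
- under eq_eseriesr do rewrite integral_count.
  by rewrite pterm_series_EFin// ltry.
- by rewrite bigcup_count; apply/measurable_EFinP; exact: measurable_F.
- by move=> w _; rewrite lee_fin normr_ge0.
- exact: trivIset_count.
Qed.

Lemma expectation_compound : ('E_P[F f] = (PE l f 0)%:E)%E.
Proof.
rewrite unlock -bigcup_count integral_bigcup//.
- under eq_eseriesr do rewrite integral_count.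
  exact: pterm_series_EFin.
- exact: trivIset_count.
- by rewrite bigcup_count; exact: integrable_F.
Qed.

End compound_poisson.

(** * Joint law of the clause labels *)

Lemma mutually_independent_fin (d : measure_display) (T : measurableType d)
  (R : realType) (P : probability T R) (Lb : Type) (F : Lb -> set (set T)) :
  mutually_independent P F ->
  forall (D : finType) (s : D -> Lb), injective s ->
  forall A : D -> set T, (forall x, F (s x) (A x)) ->
  P (\bigcap_(x : D) A x) = (\prod_x P (A x))%E.
Proof.
move=> H D s sI A FA.
have := H #|D| (s \o enum_val) (inj_comp sI enum_val_inj) (A \o enum_val) (fun k => FA _).
rewrite [X in _ -> _ = X](reindex (fun k : 'I_#|D| => enum_val k)) /=; last first.
  by apply: onW_bij; exact: enum_val_bij.
move=> <-; congr (P _); apply/seteqP; split=> w Aw x _; first exact: Aw.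
by have := Aw (enum_rank x) Logic.I; rewrite /= enum_rankK.
Qed.

Lemma prod_option (R : comPzSemiRingType) (D : finType) (F : option D -> R) :
  \prod_x F x = F None * \prod_x F (Some x).
Proof.
rewrite (bigD1 None)//=; congr (_ * _).
rewrite (reindex_omap Some id) => [|[x|]//].
by apply: eq_bigl => x; rewrite eqxx.
Qed.

Section label_law.
Context {d : measure_display} {T : measurableType d} {R : realType}.
Context (P : probability T R) {p : nat} {A0 : finType} (Lb : Type).
Variables (F : Lb -> set (set T)) (c0 : Lb) (ca cs : nat -> 'I_p -> Lb).
Hypothesis indep : mutually_independent P F.
Variables (count : T -> nat) (a : nat -> 'I_p -> T -> A0) (sg : nat -> 'I_p -> T -> R).
Variables (w : A0 -> R) (L : R).

(** A whole clause as one element of a finite type. Each sign is encoded by the test that it equals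
    1, since it takes the values 1 and -1 only almost surely. *)
Definition label k t : {ffun 'I_p -> A0 * bool} := [ffun j => (a k j t, sg k j t == 1)].

Hypothesis Fc : forall m, F c0 (count @^-1` [set m]).
Hypothesis Fa : forall k j i, F (ca k j) (a k j @^-1` [set i]).
Hypothesis Fs : forall k j b, F (cs k j) [set t | (sg k j t == 1) = b].
Hypothesis Pc : forall m, P (count @^-1` [set m]) = (poisson_pmf L m)%:E.
Hypothesis Pa : forall k j i, P (a k j @^-1` [set i]) = (w i)%:E.
Hypothesis Ps : forall k j b, P [set t | (sg k j t == 1) = b] = (2^-1)%:E.

(** One index type for the count, the indices or points, and the signs: distinctness of all
    variables is a single injectivity, and the lemma serves both kinds of disorder. *)
Definition family_label (x : option (nat * 'I_p * bool)) : Lb :=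
  if x is Some (k, j, b) then (if b then cs k j else ca k j) else c0.
Hypothesis family_inj : injective family_label.

Definition label_weight (l : {ffun 'I_p -> A0 * bool}) : R := \prod_j (w (l j).1 / 2).

Lemma label_law m (t : m.-tuple {ffun 'I_p -> A0 * bool}) :
  P (cylinder count label t) =
  (poisson_pmf L m * \prod_(k < m) label_weight (tnth t k))%:E.
Proof.
pose D : finType := option ('I_m * 'I_p * bool).
pose emb (x : D) : option (nat * 'I_p * bool) :=
  if x is Some (k, j, b) then Some (nat_of_ord k, j, b) else None.
have embI : injective emb.
  move=> [[[k j] b]|] [[[k' j'] b']|]//= [] kk -> ->.
  by rewrite (val_inj kk).
pose A (x : D) : set T := match x with
  | None => count @^-1` [set m]
  | Some (k, j, true) => [set s | (sg k j s == 1) = (tnth t k j).2]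
  | Some (k, j, false) => a k j @^-1` [set (tnth t k j).1]
  end.
have -> : cylinder count label t = \bigcap_x A x.
  apply/seteqP; split=> s.
    move=> [cs0 ts] [[[k j] b]|] _ //=.
    have /= /ffunP/(_ j) := ts k Logic.I; rewrite ffunE => <-.
    by case: b.
  move=> As; split; first by have := As None Logic.I.
  move=> k _ /=; apply/ffunP => j; rewrite ffunE.
  have /= -> := As (Some (k, j, true)) Logic.I.
  have /= -> := As (Some (k, j, false)) Logic.I.
  by case: (tnth t k j).
rewrite (mutually_independent_fin indep (s := family_label \o emb)).
- pose v (x : D) : R := match x with
    | None => poisson_pmf L m
    | Some (k, j, true) => 2^-1
    | Some (k, j, false) => w (tnth t k j).1
    end.
  rewrite (eq_bigr (fun x => (v x)%:E)); last first.
    by move=> [[[k j] []]|] _ /=; rewrite /A ?Pc ?Pa ?Ps.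
  rewrite prodEFin; congr EFin; rewrite prod_option /=; congr (_ * _).
  rewrite [LHS](eq_bigr (fun x => v (Some (x.1.1, x.1.2, x.2)))); last by move=> [[k j] b].
  rewrite -(pair_bigA _ (fun kj b => v (Some (kj.1, kj.2, b)))) /=.
  rewrite -(pair_bigA _ (fun k j => \prod_b v (Some (k, j, b)))) /=.
  by apply: eq_bigr => k _; apply: eq_bigr => j _; rewrite big_bool /= mulrC.
- exact: inj_comp.
- by move=> [[[k j] []]|] /=; [exact: Fs | exact: Fa | exact: Fc].
Qed.

End label_law.

Section measurability.
Context {d : measure_display} {T : measurableType d} {R : realType}.

Lemma measurable_theta (p : nat) beta (D : set T) (J x : 'I_p -> T -> R) :
  (forall j, measurable_fun D (J j)) -> (forall j, measurable_fun D (x j)) ->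
  measurable_fun D (fun w => theta beta (J^~ w) (x^~ w)).
Proof.
move=> mJ mx; apply: measurableT_comp; first exact: measurable_ln.
apply: measurable_funD; first exact: measurable_cst.
apply: measurable_funM; first exact: measurable_cst.
apply: measurable_prod => j _; apply: measurable_funM; last exact: measurable_cst.
apply: measurable_funD; first exact: measurable_cst.
exact: measurable_funM.
Qed.

Lemma measurable_on_count (count : T -> nat) (G : nat -> T -> R) :
  (forall m, measurable (count @^-1` [set m])) ->
  (forall m, measurable_fun setT (G m)) ->
  measurable_fun setT (fun w => G (count w) w).
Proof.
move=> mc mG; rewrite -(bigcup_count count); apply/measurable_fun_bigcup => // m.
apply: (@eq_measurable_fun _ _ _ _ _ (G m)) => [w /set_mem /= -> //|].
exact: measurable_funTS.
Qed.

Lemma measurable_log_sum_exp (E : finType) (H : E -> T -> R) :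
  (forall e, measurable_fun setT (H e)) ->
  measurable_fun setT (fun w => ln (\sum_e expR (H e w))).
Proof.
move=> mH; apply: measurableT_comp; first exact: measurable_ln.
by apply: measurable_sum => e; apply: measurableT_comp.
Qed.

End measurability.
Section probability_facts.
Context {d : measure_display} {T : measurableType d} {R : realType}.
Context (P : probability T R).

Lemma preimage_in_sigma (d' : measure_display) (T' : measurableType d') (f : T -> T')
  (B : set T') : measurable B -> g_sigma_algebra_preimage f (f @^-1` B).
Proof. by move=> mB; exists B => //; rewrite setTI. Qed.

Lemma measurable_preimage (d' : measure_display) (T' : measurableType d')
  (f : {mfun T >-> T'}) (B : set T') : measurable B -> measurable (f @^-1` B).
Proof. by move=> mB; rewrite -[X in measurable X]setTI; exact: measurable_funP. Qed.

Lemma ae_prob1 (A : set T) : measurable A -> P A = 1%E -> {ae P, forall w, A w}.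
Proof.
move=> mA PA; exists (~` A); split=> //; first exact: measurableC.
by apply: etrans (probability_setC P mA) _; rewrite PA subee.
Qed.

Lemma eq_expectation_ae (f g : T -> R) : measurable_fun setT f -> measurable_fun setT g ->
  {ae P, forall w, f w = g w} -> ('E_P[f] = 'E_P[g])%E.
Proof.
move=> mf mg fg; rewrite unlock; apply: ae_eq_integral => //.
- exact/measurable_EFinP.
- exact/measurable_EFinP.
- by apply: filterS fg => w -> _.
Qed.

Section random_sign.
Variable (X : {RV P >-> R}).
Hypothesis XP : is_random_sign X.

Lemma sign_test b : [set w | (X w == 1) = b] = X @^-1` (if b then [set 1] else ~` [set 1]).
Proof.
apply/seteqP; split=> w; case: b => /=.
- by move/eqP.
- by move=> /negP h /eqP.
- by move=> ->; rewrite eqxx.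
- by move=> /eqP/negbTE.
Qed.

Lemma measurable_sign_test b : measurable [set w | (X w == 1) = b].
Proof.
by rewrite sign_test; apply: measurable_preimage; case: b => //; exact: measurableC.
Qed.

Lemma prob_sign_test b : P [set w | (X w == 1) = b] = (2^-1)%:E.
Proof.
have [X1 _] := XP; rewrite sign_test; case: b; first exact: X1.
rewrite -preimage_setC probability_setC; last exact: measurable_preimage.
have -> : P (X @^-1` [set 1]) = (2^-1)%:E by exact: X1.
by rewrite -EFinB; congr EFin; lra.
Qed.

Lemma ae_sign : {ae P, forall w, X w = spin R (X w == 1)}.
Proof.
have [X1 XN] := XP.
have m1 : measurable (X @^-1` [set 1]) by exact: measurable_preimage.
have mN : measurable (X @^-1` [set -1]) by exact: measurable_preimage.
have : P (X @^-1` [set 1] `|` X @^-1` [set -1]) = 1%E.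
  have U : P (X @^-1` [set 1] `|` X @^-1` [set -1]) =
      (P (X @^-1` [set 1%R]) + P (X @^-1` [set (-1)%R]))%E.
    apply: measureU => //; apply/seteqP; split=> // w [/= -> /eqP].
    by rewrite -subr_eq0 opprK -mulr2n pnatr_eq0.
  have P1 : P (X @^-1` [set 1]) = (2^-1)%:E by exact: X1.
  have PN : P (X @^-1` [set -1]) = (2^-1)%:E by exact: XN.
  by rewrite U P1 PN -EFinD; congr EFin; lra.
move/(ae_prob1 (measurableU _ _ m1 mN)); apply: filterS => w [] /= ->; first by rewrite eqxx.
by rewrite -subr_eq0 -opprD oppr_eq0 -mulr2n pnatr_eq0.
Qed.

End random_sign.

End probability_facts.

Lemma theta_ln (R : realType) (p : nat) (beta : R) (J : 'I_p -> bool) (y : 'I_p -> R) :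
  theta beta (fun j => spin R (J j)) y = ln (1 - cbeta beta * \prod_j lit (J j) (y j)).
Proof. by rewrite /theta /cbeta /lit; congr (ln _); rewrite -mulNr opprB. Qed.

Lemma label_weight_sum1 (R : realType) (p : nat) (A : finType) (w : A -> R) :
  \sum_i w i = 1 -> \sum_(a : {ffun 'I_p -> A * bool}) label_weight w a = 1.
Proof.
move=> w1; rewrite /label_weight.
by rewrite (sum_ffun_prod _ (fun b : A * bool => w b.1 / 2)) sum_pair_bool// expr1n.
Qed.

Section free_energy_Phi.
Context {R : realType} {q n : nat} {alpha : R}.
Variables (beta : R) (X : sat_disorder q.+1 n alpha).
Hypotheses (alpha0 : 0 < alpha) (beta0 : 0 < beta).

Let P := sat_prob X.
Let lab := label (fun k j => sat_index X k j) (fun k j => sat_sign X k j).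

Lemma hamiltonian_label : {ae P, forall w,
  ln (\sum_(s : {ffun 'I_n.+1 -> bool}) expR (- hamiltonian beta w s)) =
  logZ (\sum_(k < sat_count X w) (clause_energy beta (lab k w)
          : {ffun 'I_n.+1 -> bool} -> R))}.
Proof.
have : {ae P, forall w, forall k j, sat_sign X k j w = spin R (sat_sign X k j w == 1)}.
  by apply: ae_foralln => k; apply: filter_forall => j; exact: (ae_sign (sat_signP X k j)).
apply: filterS => w sgE; congr ln; apply: eq_bigr => s _; congr expR.
rewrite /hamiltonian opprK fct_sumE; apply: eq_bigr => k _.
rewrite (_ : (fun j => sat_sign X k j w) = fun j => spin R (sat_sign X k j w == 1)).
  rewrite theta_ln /clause_energy; congr (ln (1 - _ * _)).
  by apply: eq_bigr => j _; rewrite /lab /label ffunE.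
by apply/funext => j; exact: sgE.
Qed.

Lemma free_energy_Phi :
  (free_energy beta X = (n.+1%:R^-1 * Phi q beta 'I_n.+1 (alpha * n.+1%:R))%:E)%E.
Proof.
have L0 : 0 < alpha * n.+1%:R by rewrite mulr_gt0// ltr0n.
have mlab k i : measurable (lab k @^-1` [set i]).
  rewrite (_ : _ @^-1` _ = \bigcap_(j : 'I_q.+1)
      (sat_index X k j @^-1` [set (i j).1] `&` [set w | (sat_sign X k j w == 1) = (i j).2])).
    apply: fin_bigcap_measurable => // j _.
    by apply: measurableI; [exact: measurable_preimage | exact: measurable_sign_test].
  apply/seteqP; split=> w.
    by move=> /= <- j _; rewrite /lab /label ffunE.
  move=> h; apply/ffunP => j; rewrite ffunE.
  by have [/= -> /= ->] := h j Logic.I; case: (i j).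
have mcount m : measurable (sat_count X @^-1` [set m]) by exact: measurable_preimage.
have law m (t : m.-tuple {ffun 'I_q.+1 -> 'I_n.+1 * bool}) :
    P (cylinder (sat_count X) lab t) = (poisson_pmf (alpha * n.+1%:R) m *
       \prod_(k < m) label_weight (fun=> n.+1%:R^-1) (tnth t k))%:E.
  apply: (@label_law _ _ _ P _ _ _ _ (SatCount _) (fun k j => SatIndex k j)
    (fun k j => SatSign k j) (@sat_indep _ _ _ _ X) (sat_count X)
    (fun k j => sat_index X k j) (fun k j => sat_sign X k j) (fun=> n.+1%:R^-1)) => //=.
  - by move=> m'; exact: preimage_in_sigma.
  - by move=> k j i; exact: preimage_in_sigma.
  - move=> k j b; rewrite sign_test; apply: preimage_in_sigma.
    by case: b => //; exact: measurableC.
  - exact: sat_countP.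
  - by move=> k j i; exact: sat_indexP.
  - by move=> k j b; exact: (prob_sign_test (sat_signP X k j)).
  - by move=> [[[k j] []]|] [[[k' j'] []]|]//= [] -> ->.
have w1 : \sum_(i < n.+1) (n.+1%:R^-1 : R) = 1.
  by rewrite sumr_const card_ord -[LHS]mulr_natl mulfV// pnatr_eq0.
have pi1 := label_weight_sum1 q.+1 w1.
pose J (a : {ffun 'I_q.+1 -> 'I_n.+1 * bool}) : {ffun 'I_n.+1 -> bool} -> R :=
  clause_energy beta a.
have W0 : (0 < #|{ffun 'I_n.+1 -> bool}|)%N by exact: config_gt0.
have E := expectation_compound J L0 pi1 mcount mlab law
  (@subadd_l1size _ _) (egrow_logZ W0).
rewrite /free_energy (eq_expectation_ae _ _ hamiltonian_label).
- rewrite [X in (_ * X)%E]E -EFinM /Phi.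
  suff -> : (fun a => alpha * n.+1%:R * label_weight (fun=> n.+1%:R^-1) a) =
            @sat_rates R q 'I_n.+1 (alpha * n.+1%:R) by [].
  apply/funext => a; rewrite /sat_rates /label_weight card_clause card_ord.
  by rewrite prodr_const card_ord -exprVn invfM.
- apply: measurable_log_sum_exp => s.
  pose G m w : R := \sum_(k < m) theta beta (fun j => sat_sign X k j w)
                 (fun j => spin R (s (sat_index X k j w))).
  rewrite (_ : (fun w => _) = fun w => G (sat_count X w) w); last first.
    by apply/funext => w; rewrite /hamiltonian opprK.
  apply: measurable_on_count => // m; apply: measurable_sum => k.
  apply: measurable_theta => j //.
  exact: (measurableT_comp (f := fun i => spin R (s i))).
- exact: (measurable_F J mcount mlab).
Qed.

End free_energy_Phi.

(** * Discretization of the replica symmetric functional *)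
Lemma prod_dist_le (R : realType) (J : finType) (a b : J -> R) :
  (forall j, 0 <= a j <= 1) -> (forall j, 0 <= b j <= 1) ->
  `|\prod_j a j - \prod_j b j| <= \sum_j `|a j - b j|.
Proof.
move=> a01 b01.
suff S : [/\ 0 <= \prod_j a j <= 1, 0 <= \prod_j b j <= 1 &
  `|\prod_j a j - \prod_j b j| <= \sum_j `|a j - b j|] by have [] := S.
apply: (big_rec3 (fun x y z => [/\ 0 <= x <= 1, 0 <= y <= 1 & `|x - y| <= z])).
  by rewrite subrr normr0 lexx ler01.
move=> j x y z _ [/andP[x0 x1] /andP[y0 y1] xy].
have /andP[a0 a1] := a01 j; have /andP[b0 b1] := b01 j.
split; rewrite ?mulr_ge0//= ?mulr_ile1//.
rewrite (_ : a j * x - b j * y = (a j - b j) * x + b j * (x - y)); last by ring.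
apply: le_trans (ler_normD _ _) _; rewrite !normrM (ger0_norm x0) (ger0_norm b0).
apply: lerD; first by rewrite ler_piMr.
by apply: le_trans xy; rewrite ler_piMl.
Qed.

Lemma ln_weight_dist_le (R : realType) (beta u v : R) : 0 < beta ->
  0 <= u <= 1 -> 0 <= v <= 1 ->
  `|ln (1 - cbeta beta * u) - ln (1 - cbeta beta * v)| <=
    2 * expR beta * `|u - v|.
Proof.
move=> beta0 /andP[u0 u1] /andP[v0 v1].
have c0 := cbeta_ge0 beta0; have c1 := ltW (cbeta_lt1 beta).
have inv y : y <= 1 -> (1 - cbeta beta * y)^-1 <= expR beta.
  move=> y1; rewrite -[leRHS]invrK -expRN lef_pV2 ?posrE ?expR_gt0 ?weight_gt0//.
  by rewrite -oneB_cbeta lerD2l lerN2 ler_piMr.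
apply: le_trans (ln_dist_le _ _) _; rewrite ?weight_gt0//.
rewrite (_ : 1 - _ - _ = cbeta beta * (v - u)); last by ring.
rewrite normrM (ger0_norm c0) distrC mulrC; apply: ler_pM => //.
- by rewrite addr_ge0// invr_ge0 ltW// weight_gt0.
- by rewrite mulr_ge0.
- by rewrite [leRHS]mulrDl mul1r lerD// inv.
- by rewrite ler_piMl.
Qed.

Lemma lit_dist (R : realType) b (y z : R) : `|lit b y - lit b z| = `|y - z| / 2.
Proof.
rewrite /lit (_ : _ - _ = spin R b * ((y - z) / 2)); last by lra.
rewrite normrM (_ : `|spin R b| = 1) ?mul1r; last by case: b; rewrite ?normrN normr1.
by rewrite normrM [X in _ * X]ger0_norm.
Qed.

Lemma partf_half_dist (R : realType) (h g : bool -> R) eps :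
  (forall e, `|h e - g e| <= eps) ->
  `|ln (partf h / 2) - ln (partf g / 2)| <= eps.
Proof.
have b0 : (0 < #|{: bool}|)%N by rewrite card_bool.
have half (a b : bool -> R) : (forall e, `|a e - b e| <= eps) ->
    ln (partf a / 2) <= ln (partf b / 2) + eps.
  move=> ab; rewrite !ln_div ?posrE ?partf_gt0// addrAC lerD2r.
  rewrite -[leLHS]/(logZ a) -[X in _ <= X + _]/(logZ b) -logZ_cst//.
  by apply: le_logZ => // e; have := ab e; rewrite ler_norml => /andP[_]; rewrite lerBlDl addrC.
move=> hg; rewrite ler_norml; apply/andP; split.
  by rewrite lerBrDr addrC lerBlDr; apply: half => e; rewrite distrC.
by rewrite lerBlDl; exact: half.
Qed.

Section mean.
Context {d : measure_display} {T : measurableType d} {R : realType}.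
Context (P : probability T R).

Definition has_mean (f : T -> R) (a : R) :=
  P.-integrable setT (EFin \o f) /\ ('E_P[f] = a%:E)%E.

Lemma has_mean_integral f a : has_mean f a -> (\int[P]_w (f w)%:E = a%:E)%E.
Proof. by move=> [_]; rewrite unlock. Qed.

(** The mean of [f] is not given beforehand: domination by |g| + h provides integrability, hence a
    finite mean, together with its distance to [a]. *)
Lemma mean_dist_le (f g h : T -> R) a m : measurable_fun setT f ->
  has_mean g a -> has_mean h m -> (forall w, `|f w - g w| <= h w) ->
  exists r, has_mean f r /\ `|r - a| <= m.
Proof.
move=> mf gP hP fg.
have [gI gE] := gP; have [hI hE] := hP.
have fI : P.-integrable setT (EFin \o f).
  apply: (@le_integrable _ _ _ _ setT _ _ (fun w => `|(g w)%:E| + (h w)%:E)%E) => //.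
  - exact/measurable_EFinP.
  - move=> w _ /=; rewrite lee_fin [leRHS]ger0_norm ?addr_ge0//; last first.
      exact: le_trans (fg w).
    rewrite (_ : f w = g w + (f w - g w)); last by rewrite addrC subrK.
    by apply: le_trans (ler_normD _ _) _; rewrite lerD2l.
  - by apply: integrableD => //; exact: integrable_abse gI.
have fin : ('E_P[f] = (fine 'E_P[f])%:E)%E.
  by rewrite fineK// unlock; exact: integrable_fin_num.
exists (fine ('E_P[f])%E); split=> //; set r := fine _.
have fE := has_mean_integral (conj fI fin).
have gE' := has_mean_integral gP; have hE' := has_mean_integral hP.
rewrite ler_norml; apply/andP; split.
  rewrite lerBrDr addrC lerBlDr -lee_fin EFinD -fE -gE' -hE'.
  rewrite -integralD//; apply: le_integral => //; first exact: integrableD.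
  by move=> w _; rewrite -EFinD lee_fin; have := fg w; rewrite ler_norml => /andP[+ _]; lra.
rewrite lerBlDl -lee_fin EFinD -fE -gE' -hE'.
rewrite -integralD//; apply: le_integral => //; first exact: integrableD.
by move=> w _; rewrite -EFinD lee_fin; have := fg w; rewrite ler_norml => /andP[_]; lra.
Qed.

Lemma measurable_finite (d' : measure_display) (U : measurableType d') (I : finType)
  (e : U -> I) (g : I -> R) :
  (forall i, measurable (e @^-1` [set i])) -> measurable_fun setT (g \o e).
Proof.
move=> me _ Y mY; rewrite setTI.
rewrite (_ : _ @^-1` _ = \bigcup_(i in [set i | Y (g i)]) (e @^-1` [set i])).
  by apply: fin_bigcup_measurable.
by apply/seteqP; split=> [w Yw|w [i Yi /= ei]]; [exists (e w) | rewrite /preimage /= ei].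
Qed.

Lemma has_mean_finite (I : finType) (xi : T -> I) (pi g : I -> R) :
  (forall i, measurable (xi @^-1` [set i])) ->
  (forall i, P (xi @^-1` [set i]) = (pi i)%:E) ->
  has_mean (g \o xi) (\sum_i pi i * g i).
Proof.
move=> mxi pE; have mg := measurable_finite g mxi.
have gB w : `|g (xi w)| <= \sum_i `|g i|.
  by rewrite (bigD1 (xi w))//= lerDl sumr_ge0.
split.
  apply: (@le_integrable _ _ _ _ setT _ _ (fun=> (\sum_i `|g i|)%:E)) => //.
  - exact/measurable_EFinP.
  - by move=> w _ /=; rewrite lee_fin [leRHS]ger0_norm ?sumr_ge0.
  - exact: finite_measure_integrable_cst.
rewrite unlock.
have -> : [set: T] = \big[setU/set0]_(i <- enum I) (xi @^-1` [set i]).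
  rewrite -bigcup_seq; apply/seteqP; split=> // w _.
  by exists (xi w) => //=; rewrite mem_enum.
rewrite integral_bigsetU_EFin.
- rewrite big_enum /= -sumEFin; apply: eq_bigr => i _.
  rewrite (eq_integral (fun=> (g i)%:E)) => [|w /set_mem /= <- //].
  by rewrite integral_cst// mulrC EFinM -pE.
- by [].
- exact: enum_uniq.
- by apply/trivIsetP => i j _ _ ij; apply/seteqP; split=> // w [/= -> /eqP]; rewrite (negbTE ij).
- by apply/measurable_EFinP; apply: measurable_funS mg.
Qed.

End mean.
Lemma theta_dist (R : realType) (p : nat) (beta delta : R) (J : 'I_p -> bool)
  (y z : 'I_p -> R) : 0 < beta ->
  (forall j, -1 <= y j <= 1) -> (forall j, -1 <= z j <= 1) ->
  (forall j, `|y j - z j| <= delta) ->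
  `|theta beta (fun j => spin R (J j)) y - theta beta (fun j => spin R (J j)) z| <=
    expR beta * p%:R * delta.
Proof.
move=> beta0 y1 z1 yz; rewrite !theta_ln.
apply: le_trans (ln_weight_dist_le beta0 _ _) _.
- by apply: prod01 => j; exact: lit01.
- by apply: prod01 => j; exact: lit01.
rewrite [2 * _]mulrC -!mulrA ler_wpM2l ?expR_ge0//.
have /(ler_wpM2l (ler0n R 2)) := prod_dist_le (fun j => lit01 (J j) (y1 j)) (fun j => lit01 (J j) (z1 j)).
move/le_trans; apply; rewrite mulr_sumr.
rewrite (_ : p%:R * delta = \sum_(j < p) delta); last by rewrite sumr_const card_ord -[RHS]mulr_natl.
by apply: ler_sum => j _; rewrite lit_dist; have := yz j; lra.
Qed.

Section mean_count.
Context {R : realType}.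

(** The mean number of clauses; it enters as a constant independent of the mesh. *)
Definition poisson_mean (L : R) : R := PE (jumps (fun _ : unit => L) (fun=> 1 : R)) id 0.

Context {d : measure_display} {T : measurableType d} (P : probability T R).

Lemma has_mean_count (count : T -> nat) (L a : R) : 0 < L ->
  (forall m, measurable (count @^-1` [set m])) ->
  (forall m, P (count @^-1` [set m]) = (poisson_pmf L m)%:E) ->
  has_mean P (fun w => a * (count w)%:R) (a * poisson_mean L).
Proof.
move=> L0 mc Pc.
have nuP : subadd (fun s : R => `|s|) by split => // s t; exact: ler_normD.
have fE (b : R) : egrow (fun s : R => `|s|) (fun s => b * s).
  exists `|b|, 1; split => // s; rewrite normrM ler_wpM2l// mul1r.
  by apply: le_trans (expR_ge1Dx _); rewrite lerDr.
have law m (t : m.-tuple unit) : P (cylinder count (fun _ _ => tt) t) =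
    (poisson_pmf L m * \prod_(k < m) (fun=> 1) (tnth t k))%:E.
  rewrite big1// mulr1 -Pc; congr (P _).
  by apply/seteqP; split=> [w []//|w ct]; split => // k _ /=; case: (tnth t k).
have m1 (k : nat) (i : unit) : measurable ((fun _ : T => tt) @^-1` [set i]).
  by case: i; rewrite (_ : _ @^-1` _ = setT)//; apply/seteqP; split.
have p1 : \sum_(i : unit) (1 : R) = 1.
  by rewrite sumr_const (_ : #|{: unit}| = 1%N)// card_unit.
have F : (fun w => a * (count w)%:R) = fun w => a * \sum_(k < count w) (fun=> 1) tt.
  by apply/funext => w; rewrite sumr_const card_ord.
split; rewrite F.
  exact: (integrable_F (fun=> 1) L0 p1 mc m1 law nuP (fE a)).
rewrite (expectation_compound (fun=> 1) L0 p1 mc m1 law nuP (fE a)).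
congr EFin.
rewrite /poisson_mean (_ : (fun i : unit => L * 1) = fun=> L); last by apply/funext => ?; rewrite mulr1.
pose l := jumps (fun _ : unit => L) (fun=> 1 : R).
have -> : PE l id 0 = PE l (fun s => 1 * s) 0 by apply: eq_PE => s; rewrite mul1r.
have := PED l 0 a nuP (fE 0) (fE 1).
have -> : PE l (fun s => 0 * s) 0 = 0 by rewrite (eq_PE _ (g := fun=> 0)) ?PE_cst// => s; rewrite mul0r.
by rewrite add0r => <-; apply: eq_PE => s; rewrite mul0r add0r mul1r.
Qed.

End mean_count.
Section rs_discretization.
Context {R : realType} {q : nat} {alpha beta : R} {zeta : probability R R}.
Variable (Y : rs_disorder q.+1 alpha zeta).
Hypotheses (alpha0 : 0 < alpha) (beta0 : 0 < beta).
Context {I : finType}.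
Variables (e : R -> I) (x : I -> R) (D : set R) (delta : R).
Hypotheses (me : forall i, measurable (e @^-1` [set i])) (mD : measurable D).
Hypotheses (zetaD : zeta D = 1%E) (delta0 : 0 <= delta).
Hypotheses (x1 : forall i, -1 <= x i <= 1) (D1 : forall z, D z -> -1 <= z <= 1).
Hypothesis Dx : forall z, D z -> `|z - x (e z)| <= delta.

Definition cell_weight i : R := fine (zeta (e @^-1` [set i])).

Lemma cell_weightE i : zeta (e @^-1` [set i]) = (cell_weight i)%:E.
Proof. by rewrite fineK// fin_num_measure. Qed.

Lemma cell_weight_ge0 i : 0 <= cell_weight i.
Proof. exact: fine_ge0. Qed.

Lemma cell_weight_sum1 : \sum_i cell_weight i = 1.
Proof.
have [_] := has_mean_finite (P := zeta) (fun=> 1) me cell_weightE.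
have -> : (fun=> 1) \o e = cst 1 :> (R -> R) by [].
rewrite expectation_cst => -[->].
by apply: eq_bigr => i _; rewrite mulr1.
Qed.

(* Agrees almost surely with [z], but is close to the grid everywhere. *)
Definition snap z := if z \in D then z else x (e z).

Lemma snap_dist z : `|snap z - x (e z)| <= delta.
Proof. by rewrite /snap; case: ifPn => [/set_mem/Dx //|_]; rewrite subrr normr0. Qed.

Lemma snap1 z : -1 <= snap z <= 1.
Proof. by rewrite /snap; case: ifPn => [/set_mem/D1 //|_]; exact: x1. Qed.

Lemma measurable_snap : measurable_fun setT snap.
Proof.
apply: measurable_fun_if => //.
- by apply: (measurable_fun_bool true); rewrite setTI (_ : _ @^-1` _ = D)//; apply/seteqP; split=> z; [move/set_mem|move/mem_set].
- by apply: measurable_funTS; exact: (measurable_finite x me).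
Qed.

Let P := rs_prob Y.
Let L : R := alpha * q.+1%:R.
Let L0 : 0 < L. Proof. by rewrite mulr_gt0// ltr0n. Qed.
Let K := expR beta * q.+1%:R * delta.

Lemma ae_snap (X : {RV P >-> R}) : has_law zeta X -> {ae P, forall w, X w = snap (X w)}.
Proof.
move=> XP; have : P (X @^-1` D) = 1%E by rewrite -zetaD -XP.
have mXD : measurable (X @^-1` D) by exact: measurable_preimage.
by move/(ae_prob1 mXD); apply: filterS => w XD; rewrite /snap mem_set.
Qed.

Lemma measurable_snapX (X : {RV P >-> R}) : measurable_fun setT (fun w => snap (X w)).
Proof. by apply: (measurableT_comp measurable_snap). Qed.

Lemma measurable_spin (X : {RV P >-> R}) :
  measurable_fun setT (fun w => spin R (X w == 1)).
Proof.
by apply: (measurable_finite (e := fun w => X w == 1)) => b; exact: measurable_sign_test.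
Qed.

Lemma theta_etheta : exists r,
  ('E_P[fun w => theta beta (fun j => rs_sign Y j w) (fun j => rs_point Y j w)] = r%:E)%E /\
  `|r - etheta q beta cell_weight x| <= K.
Proof.
pose lab w : {ffun 'I_q.+1 -> I * bool} := [ffun j => (e (rs_point Y j w), rs_sign Y j w == 1)].
pose g (a : {ffun 'I_q.+1 -> I * bool}) : R :=
  ln (1 - cbeta beta * \prod_j lit (a j).2 (x (a j).1)).
pose f w := theta beta (fun j => spin R (rs_sign Y j w == 1)) (fun j => snap (rs_point Y j w)).
have me' (X : {RV P >-> R}) i : measurable ((fun w => e (X w)) @^-1` [set i]).
  exact: (measurable_preimage X (me i)).
pose A (b : {ffun 'I_q.+1 -> I * bool}) (y : 'I_q.+1 * bool) : set (rs_space Y) :=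
  if y.2 then [set w | (rs_sign Y y.1 w == 1) = (b y.1).2]
  else (fun w => e (rs_point Y y.1 w)) @^-1` [set (b y.1).1].
have labE b : lab @^-1` [set b] = \bigcap_y A b y.
  apply/seteqP; split=> w.
    by move=> /= <- [j []] _; rewrite /A /= ffunE.
  move=> Aw; apply/ffunP => j; rewrite ffunE.
  have /= -> := Aw (j, true) Logic.I; have /= -> := Aw (j, false) Logic.I.
  by case: (b j).
have mlab b : measurable (lab @^-1` [set b]).
  rewrite labE; apply: fin_bigcap_measurable => // -[j []] _; rewrite /A /=.
    exact: measurable_sign_test.
  exact: me'.
have law b : P (lab @^-1` [set b]) = (label_weight cell_weight b)%:E.
  rewrite labE.
  rewrite (mutually_independent_fin (@rs_indep _ _ _ _ Y)
    (s := fun y : 'I_q.+1 * bool => if y.2 then RSSign y.1 else RSPoint y.1)).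
  - rewrite (eq_bigr (fun y => (if y.2 then 2^-1 else cell_weight (b y.1).1)%:E)).
      rewrite prodEFin -(pair_bigA _ (fun j (t : bool) => if t then 2^-1 else cell_weight (b j).1)) /=.
      congr EFin; apply: eq_bigr => j _; by rewrite big_bool /= mulrC.
    move=> [j []] _; rewrite /A /=.
      exact: (prob_sign_test (rs_signP Y j)).
    rewrite -cell_weightE; exact: (rs_pointP Y j (me _)).
  - by move=> [j []] [j' []] //= [] ->.
  - move=> [j []]; rewrite /A /=.
      by rewrite sign_test; apply: preimage_in_sigma; case: (b j).2 => //; exact: measurableC.
    exact: (preimage_in_sigma (rs_point Y j) (me _)).
have gM := has_mean_finite g mlab law.
have hM : has_mean P (fun=> K) K.
  split; first exact: finite_measure_integrable_cst.
  by rewrite expectation_cst.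
have mf : measurable_fun setT f.
  by apply: measurable_theta => j; [exact: measurable_spin | exact: measurable_snapX].
have [|r [[_ fE] rK]] := mean_dist_le mf gM hM.
  move=> w; rewrite /g /= -theta_ln.
  rewrite (_ : (fun j => spin R (lab w j).2) = fun j => spin R (rs_sign Y j w == 1)).
    apply: theta_dist => // j; first exact: snap1.
    by rewrite ffunE; exact: snap_dist.
  by apply/funext => j; rewrite ffunE.
exists r; split; last exact: rK.
rewrite -fE; apply: eq_expectation_ae => //.
  by apply: measurable_theta => j.
have H : {ae P, forall w, forall j, rs_sign Y j w = spin R (rs_sign Y j w == 1) /\
    rs_point Y j w = snap (rs_point Y j w)}.
  apply: filter_forall => j; apply: filterI.
    exact: (ae_sign (rs_signP Y j)).
  exact: (ae_snap (rs_pointP Y j)).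
apply: filterS H => w H; rewrite /f.
by congr theta; apply/funext => j; have [] := H j.
Qed.



(** The new spin occupies the last slot, as in [rs_clause]. *)
Let cav_jump (a : {ffun 'I_q.+1 -> I * bool}) : bool -> R :=
  field_energy beta x ((a ord_max).2, [ffun j => a (widen_ord (leqnSn q) j)]).

(** Summing out the point attached to the last slot, which the new spin occupies, leaves total
    weight 1. *)
Lemma cavity_label :
  PE (jumps (fun a => L * label_weight cell_weight a) cav_jump)
     (fun h : bool -> R => ln (partf h / 2)) 0 = cavity q beta cell_weight x L.
Proof.
apply: PE_ext => f h; rewrite !tstep_jumps.
pose glue (bc : (I * bool) * {ffun 'I_q -> I * bool}) : {ffun 'I_q.+1 -> I * bool} :=
  [ffun j => if unlift ord_max j is Some k then bc.2 k else bc.1].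
have widenE (k : 'I_q) : widen_ord (leqnSn q) k = lift ord_max k.
  by apply: val_inj; exact/esym/lift_max.
have glueW bc k : glue bc (widen_ord (leqnSn q) k) = bc.2 k.
  by rewrite ffunE widenE liftK.
have glueM bc : glue bc ord_max = bc.1 by rewrite ffunE unlift_none.
rewrite (reindex glue) /=; last first.
  exists (fun a => (a ord_max, [ffun k => a (widen_ord (leqnSn q) k)])) => [[b c] _|a _].
    by rewrite glueM; congr pair; apply/ffunP => k; rewrite ffunE glueW.
  apply/ffunP => j; rewrite ffunE /=; case: unliftP => [k ->|-> //].
  by rewrite ffunE widenE.
pose F (b : bool) (c : {ffun 'I_q -> I * bool}) :=
  L / 2 * (\prod_j (cell_weight (c j).1 / 2)) * f (h + field_energy beta x (b, c)).
rewrite (eq_bigr (fun bc => cell_weight bc.1.1 * F bc.1.2 bc.2)); last first.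
  move=> [[i b] c] _; rewrite /label_weight big_ord_recr /= glueM /F /cav_jump glueM /=.
  rewrite (_ : [ffun j => _] = c); last by apply/ffunP => k; rewrite ffunE glueW.
  under eq_bigr do rewrite glueW /=.
  by ring.
rewrite -(pair_bigA _ (fun (ib : I * bool) c => cell_weight ib.1 * F ib.2 c)) /=.
rewrite -(pair_bigA _ (fun i b => \sum_c cell_weight i * F b c)) /=.
rewrite (eq_bigr (fun i => cell_weight i * \sum_b \sum_c F b c)); last first.
  by move=> i _; rewrite mulr_sumr; apply: eq_bigr => b _; rewrite mulr_sumr.
by rewrite -mulr_suml cell_weight_sum1 mul1r pair_bigA; apply: eq_bigr => -[b c] _.
Qed.

Let rs_first (sg z : nat -> 'I_q.+1 -> rs_space Y -> R) w : R :=
  ln (partf (fun eps => \sum_(k < rs_count Y w) theta beta (fun j => sg k j w)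
    (fun j => if (j < q)%N then z k j w else spin R eps)) / 2).

Lemma measurable_rs_first sg z : (forall k j, measurable_fun setT (sg k j)) ->
  (forall k j, measurable_fun setT (z k j)) -> measurable_fun setT (rs_first sg z).
Proof.
move=> msg mz; pose G m w : R := ln (partf (fun eps => \sum_(k < m) theta beta (fun j => sg k j w)
    (fun j => if (j < q)%N then z k j w else spin R eps)) / 2).
rewrite (_ : rs_first sg z = fun w => G (rs_count Y w) w)//.
apply: measurable_on_count => [m|m]; first exact: measurable_preimage.
apply: measurableT_comp; first exact: measurable_ln.
apply: measurable_funM; last exact: measurable_cst.
apply: measurable_sum => eps; apply: measurableT_comp => //.
apply: measurable_sum => k; apply: measurable_theta => // j.
by case: (j < q)%N => //; exact: measurable_cst.
Qed.

(** Rounding its points moves a clause by at most [K], and the logarithm of an average of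
    exponentials moves no more than its exponents. The error is thus [K] times the number of
    clauses, whose mean is finite. *)
Lemma rs_cavity : exists r,
  ('E_P[fun w => ln ((\sum_(eps : bool)
      expR (\sum_(k < rs_count Y w) rs_clause beta w k eps)) / 2)] = r%:E)%E /\
  `|r - cavity q beta cell_weight x L| <= K * poisson_mean L.
Proof.
pose lab := label (fun k j w => e (rs_points Y k j w)) (fun k j => rs_signs Y k j).
pose f := rs_first (fun k j w => spin R (rs_signs Y k j w == 1))
                   (fun k j w => snap (rs_points Y k j w)).
have mcount m : measurable (rs_count Y @^-1` [set m]) by exact: measurable_preimage.
have me' (X : {RV P >-> R}) i : measurable ((fun w => e (X w)) @^-1` [set i]).
  exact: (measurable_preimage X (me i)).
have mlab k a : measurable (lab k @^-1` [set a]).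
  rewrite (_ : _ @^-1` _ = \bigcap_(j : 'I_q.+1)
      ((fun w => e (rs_points Y k j w)) @^-1` [set (a j).1] `&`
       [set w | (rs_signs Y k j w == 1) = (a j).2])).
    apply: fin_bigcap_measurable => // j _.
    by apply: measurableI; [exact: me' | exact: measurable_sign_test].
  apply/seteqP; split=> w.
    by move=> /= <- j _; rewrite /lab /label ffunE.
  move=> h; apply/ffunP => j; rewrite ffunE.
  by have [/= -> /= ->] := h j Logic.I; case: (a j).
have law m (t : m.-tuple {ffun 'I_q.+1 -> I * bool}) :
    P (cylinder (rs_count Y) lab t) = (poisson_pmf L m *
       \prod_(k < m) label_weight cell_weight (tnth t k))%:E.
  apply: (@label_law _ _ _ P _ _ _ _ (RSCount _) (fun k j => RSPoints k j)
    (fun k j => RSSigns k j) (@rs_indep _ _ _ _ Y) (rs_count Y)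
    (fun k j w => e (rs_points Y k j w)) (fun k j => rs_signs Y k j) cell_weight) => //=.
  - by move=> m'; exact: preimage_in_sigma.
  - by move=> k j i; exact: (preimage_in_sigma (rs_points Y k j) (me i)).
  - move=> k j b; rewrite sign_test; apply: preimage_in_sigma.
    by case: b => //; exact: measurableC.
  - exact: rs_countP.
  - by move=> k j i; rewrite -cell_weightE; exact: (rs_pointsP Y k j (me i)).
  - by move=> k j b; exact: (prob_sign_test (rs_signsP Y k j)).
  - by move=> [[[k j] []]|] [[[k' j'] []]|]//= [] -> ->.
have pi1 := label_weight_sum1 q.+1 cell_weight_sum1.
have b0 : (0 < #|{: bool}|)%N by rewrite card_bool.
have fE := @egrow_ln_half R.
have gM : has_mean P (fun w => ln (partf (\sum_(k < rs_count Y w) cav_jump (lab k w)) / 2))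
    (cavity q beta cell_weight x L).
  split; first exact: (integrable_F cav_jump L0 pi1 mcount mlab law (@subadd_l1size R bool) fE).
  rewrite -cavity_label.
  exact: (expectation_compound cav_jump L0 pi1 mcount mlab law (@subadd_l1size R bool) fE).
have hM := has_mean_count K L0 mcount (rs_countP Y).
have mf : measurable_fun setT f.
  by apply: measurable_rs_first => k j; [exact: measurable_spin | exact: measurable_snapX].
have [|r [[_ fr] rK]] := mean_dist_le mf gM hM.
  move=> w; apply: partf_half_dist => eps; rewrite fct_sumE -sumrB.
  apply: le_trans (ler_norm_sum _ _ _) _.
  rewrite (_ : K * _ = \sum_(k < rs_count Y w) K); last first.
    by rewrite sumr_const card_ord mulr_natr.
  apply: ler_sum => k _; pose b := lab k w.
  rewrite (_ : cav_jump _ _ = theta beta (fun j => spin R (rs_signs Y k j w == 1))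
      (fun j => if (j < q)%N then x (e (rs_points Y k j w)) else spin R eps)).
    apply: theta_dist => // j; case: ifP => // _.
    - exact: snap1.
    - by case: eps; apply/andP; split; rewrite /=; lra.
    - by case: eps; apply/andP; split; rewrite /=; lra.
    - exact: snap_dist.
    - by rewrite subrr normr0.
  rewrite theta_ln big_ord_recr /= ltnn /cav_jump /field_energy /=.
  rewrite /lab /label ffunE /=; congr (ln (1 - _ * _)); rewrite mulrC; congr (_ * _).
  by apply: eq_bigr => j _; rewrite !ffunE /= ltn_ord.
exists r; split; last exact: rK.
rewrite -fr; apply: eq_expectation_ae => //.
  exact: (measurable_rs_first (sg := fun k j => rs_signs Y k j) (z := fun k j => rs_points Y k j)).
have H : {ae P, forall w, forall k j, rs_signs Y k j w = spin R (rs_signs Y k j w == 1) /\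
    rs_points Y k j w = snap (rs_points Y k j w)}.
  apply: ae_foralln => k; apply: filter_forall => j; apply: filterI.
    exact: (ae_sign (rs_signsP Y k j)).
  exact: (ae_snap (rs_pointsP Y k j)).
apply: filterS H => w H; rewrite /f /rs_first /partf.
congr (ln (_ / 2)); apply: eq_bigr => eps _; congr expR; apply: eq_bigr => k _.
rewrite /rs_clause; congr theta; apply/funext => j; first by have [] := H k j.
by case: ifP => // _; have [] := H k j.
Qed.

Lemma rs_discretize : exists2 r, rs_functional beta Y = r%:E &
  `|r - Pdisc q beta cell_weight x alpha| <=
    expR beta * q.+1%:R * (poisson_mean L + q%:R * alpha) * delta.
Proof.
have [r [rE rK]] := rs_cavity; have [t [tE tK]] := theta_etheta.
exists (ln 2 + r - q%:R * alpha * t).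
  rewrite /rs_functional rE tE -EFinM; congr (_ - _ * _ * _)%:E.
  by rewrite -natr1 addrK.
rewrite /Pdisc (_ : _ - _ = (r - cavity q beta cell_weight x L) -
  q%:R * alpha * (t - etheta q beta cell_weight x)); last by rewrite /L; ring.
apply: le_trans (ler_normB _ _) _.
rewrite (_ : expR _ * _ * _ * _ = K * poisson_mean L + q%:R * alpha * K); last first.
  by rewrite /K; ring.
have qa : 0 <= q%:R * alpha by rewrite mulr_ge0// ltW.
by apply: lerD => //; rewrite normrM (ger0_norm qa) ler_wpM2l.
Qed.

End rs_discretization.

(** * Grids and empirical measures *)

Section grid.
Context {R : realType} (M : nat).

Definition grid_cell (z : R) : 'I_(2 * M.+1).+1 :=
  inord (minn (2 * M.+1) (Num.truncn ((z + 1) * M.+1%:R))).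

Definition grid_point (i : 'I_(2 * M.+1).+1) : R := i%:R / M.+1%:R - 1.

Lemma grid_cellE z : grid_cell z = minn (2 * M.+1) (Num.truncn ((z + 1) * M.+1%:R)) :> nat.
Proof. by rewrite inordK// ltnS geq_minl. Qed.

Lemma grid_point1 i : -1 <= grid_point i <= 1.
Proof.
have M0 : 0 < M.+1%:R :> R by rewrite ltr0n.
rewrite /grid_point lerBrDr addNr divr_ge0 ?ler0n//= lerBlDr ler_pdivrMr//.
by rewrite -[1 + 1]/(2%:R) -natrM ler_nat -ltnS.
Qed.

(** [grid_cell] is monotone, so its fibres are intervals. *)
Lemma measurable_grid_cell i : measurable (grid_cell @^-1` [set i]).
Proof.
apply: is_interval_measurable => a b /= <- ab c /andP[ac cb].
have mono u v : u <= v -> (grid_cell u <= grid_cell v)%N.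
  move=> uv; rewrite !grid_cellE leq_min geq_minl /= geq_min.
  by rewrite le_truncn ?orbT// ler_wpM2r// lerD2r.
apply/val_inj/eqP; rewrite /= eqn_leq; apply/andP; split; last exact: mono.
by rewrite -[X in (_ <= nat_of_ord X)%N]ab; exact: mono.
Qed.

Lemma grid_dist z : -1 <= z <= 1 -> `|z - grid_point (grid_cell z)| <= M.+1%:R^-1.
Proof.
move=> /andP[z0 z1]; have M0 : 0 < M.+1%:R :> R by rewrite ltr0n.
have y0 : 0 <= (z + 1) * M.+1%:R by rewrite mulr_ge0 ?ler0n//; lra.
have /andP[t0 t1] := truncn_itv y0.
rewrite /grid_point grid_cellE (minn_idPr _); last first.
  rewrite -ltnS -(ltr_nat R); apply: le_lt_trans t0 _.
  apply: (@le_lt_trans _ _ (2 * M.+1)%:R); last by rewrite ltr_nat.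
  by rewrite natrM ler_wpM2r ?ler0n//; lra.
set t := _%:R in t0 *.
have E (m : R) : m != 0 -> z - (t / m - 1) = ((z + 1) * m - t) / m by move=> ?; field.
rewrite E ?gt_eqF//.
rewrite normrM [X in _ * X]ger0_norm ?invr_ge0 ?ler0n// -[leRHS]mul1r.
by rewrite ler_wpM2r ?invr_ge0 ?ler0n// ger0_norm ?subr_ge0// lerBlDl /t natr1 ltW.
Qed.

End grid.

Section distinct.
Context {R : realType} {n : nat} (M : nat) (x : 'I_n.+1 -> R).
Hypothesis x1 : forall v, -1 <= x v <= 1.

(* The fractional part v / (n + 1) makes the points distinct. *)
Definition jitter v : R :=
  ((Num.floor (M%:R * x v))%:~R + v%:R / n.+1%:R) / M.+1%:R.

Lemma jitter_inj : injective jitter.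
Proof.
have M0 : 0 < M.+1%:R :> R by rewrite ltr0n.
have N0 : 0 < n.+1%:R :> R by rewrite ltr0n.
move=> u v /(mulIf (invr_neq0 (lt0r_neq0 M0))) uv.
have {}uv : (Num.floor (M%:R * x u) * n.+1%:Z + u)%:~R =
            (Num.floor (M%:R * x v) * n.+1%:Z + v)%:~R :> R.
  move/(congr1 (fun t => t * n.+1%:R)) : uv.
  by rewrite !mulrDl !divfK ?gt_eqF// !intrD !intrM.
move/intr_inj : uv => uv; apply: val_inj => /=.
(* Modulo [n.+1] the floor disappears and only the index survives. *)
have := congr1 (fun t => (t %% n.+1%:Z)%Z) uv.
by rewrite !modzMDl !modz_small ?ltz_nat ?ltn_ord// => -[].
Qed.

Let floor_bounds v : exists a : int, [/\ Num.floor (M%:R * x v) = a,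
  a%:~R <= M%:R * x v < a%:~R + 1 & - M%:R <= (a%:~R : R) <= M%:R].
Proof.
have /andP[a0 a1] := x1 v; have M0 : 0 <= M%:R :> R by rewrite ler0n.
have /andP[f0 f1] := floor_itv (M%:R * x v).
exists (Num.floor (M%:R * x v)); split=> //; first by rewrite f0 -(intrD _ _ 1).
apply/andP; split; last by apply: le_trans f0 _; rewrite ler_piMr.
rewrite -[M%:R]/(M%:Z%:~R) -intrN ler_int floor_ge_int intrN.
by rewrite -[- _]mulrN1 ler_wpM2l.
Qed.

Let frac (v : 'I_n.+1) : 0 <= (v%:R / n.+1%:R : R) < 1.
Proof.
by rewrite divr_ge0 ?ler0n//= ltr_pdivrMr ?ltr0n// mul1r ltr_nat ltn_ord.
Qed.

(** The scale [M] inside the floor against [M.+1] outside leaves room for the fractional part. *)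
Lemma jitter1 v : -1 <= jitter v <= 1.
Proof.
have M0 : 0 < M.+1%:R :> R by rewrite ltr0n.
have [a [aE _ /andP[a0 a1]]] := floor_bounds v; have /andP[v0 v1] := frac v.
rewrite /jitter aE ler_pdivlMr// ler_pdivrMr// -(natr1 M); move: a0 a1 v0 v1; move: (_ / _) (M%:R) (a%:~R) => t m b *.
by apply/andP; split; lra.
Qed.

Lemma jitter_dist v : `|jitter v - x v| <= 2 / M.+1%:R.
Proof.
have M0 : 0 < M.+1%:R :> R by rewrite ltr0n.
have [a [aE /andP[f0 f1] _]] := floor_bounds v; have /andP[v0 v1] := frac v.
have /andP[x0 x2] := x1 v.
rewrite /jitter aE; set t := v%:R / _ in v0 v1 *.
rewrite (_ : _ - _ = (a%:~R + t - M.+1%:R * x v) / M.+1%:R); last first.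
  by rewrite mulrBl mulrAC mulfV ?gt_eqF// mul1r.
rewrite normrM [X in _ * X]ger0_norm ?invr_ge0 ?ler0n// ler_wpM2r ?invr_ge0 ?ler0n//.
rewrite -(natr1 M) ler_norml; move: f0 f1 v0 v1 x0 x2.
move: t (M%:R) (a%:~R) (x v) => t m b y *.
by apply/andP; split; lra.
Qed.

End distinct.

Section empirical.
Context {R : realType} {n : nat} (y : 'I_n.+1 -> R).

Definition empirical : set R -> \bar R :=
  mscale (n.+1%:R^-1)%:nng (msum (fun k => \d_(y (inord k))) n.+1).

HB.instance Definition _ := Measure.on empirical.

Lemma empiricalE A : empirical A = (n.+1%:R^-1 * \sum_(v < n.+1) \1_A (y v))%:E.
Proof.
rewrite /empirical /mscale /msum EFinM -sumEFin; congr (_ * _)%E.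
by apply: eq_bigr => v _; rewrite inord_val indicE; exact: diracE.
Qed.

Lemma empirical_setT : empirical setT = 1%E.
Proof.
rewrite empiricalE (eq_bigr (fun=> 1)) => [|v _]; last by rewrite indicT.
by rewrite sumr_const card_ord mulVf// pnatr_eq0.
Qed.

HB.instance Definition _ := Measure_isProbability.Build _ _ R empirical empirical_setT.

End empirical.
Lemma le_add_inv (R : realType) (a b c : R) :
  (forall M : nat, a <= b + c / M.+1%:R) -> a <= b.
Proof.
move=> H; rewrite leNgt; apply/negP => ba.
have d0 : 0 < a - b by rewrite subr_gt0.
have := truncnS_gt (c / (a - b)); set M := Num.truncn _.
rewrite ltr_pdivrMr// => cM; have := H M.
have M0 : 0 < M.+1%:R :> R by rewrite ltr0n.
by rewrite -lerBlDl ler_pdivlMr// mulrC leNgt cM.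
Qed.

Section replica_symmetric.
Context {R : realType} {q : nat} {alpha beta : R}.
Hypotheses (alpha0 : 0 < alpha) (beta0 : 0 < beta).

Let C : R := expR beta * q.+1%:R * (poisson_mean (alpha * q.+1%:R) + q%:R * alpha).

Lemma rs_functional_grid (zeta : probability R R) (Y : rs_disorder q.+1 alpha zeta) M :
  zeta `[-1, 1]%classic = 1%E ->
  exists2 r, rs_functional beta Y = r%:E &
    `|r - Pdisc q beta (cell_weight (zeta := zeta) (@grid_cell R M)) (@grid_point R M) alpha|
      <= C / M.+1%:R.
Proof.
move=> zeta1.
apply: (rs_discretize Y alpha0 beta0 (@measurable_grid_cell R M) _ zeta1).
- exact: measurable_itv.
- by rewrite invr_ge0.
- exact: grid_point1.
- by move=> z; rewrite /= in_itv.
- by move=> z; rewrite /= in_itv /= => z1; exact: grid_dist.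
Qed.

Lemma Phi_le_rs_functional (V : finType) (zeta : probability R R)
  (Y : rs_disorder q.+1 alpha zeta) r : (0 < #|V|)%N ->
  zeta `[-1, 1]%classic = 1%E -> rs_functional beta Y = r%:E ->
  Phi q beta V (alpha * #|V|%:R) <= #|V|%:R * r.
Proof.
move=> V0 zeta1 Yr; apply: (@le_add_inv _ _ _ (#|V|%:R * C)) => M.
have [r' r'E rM] := rs_functional_grid Y M zeta1.
have rr : r' = r by move: r'E; rewrite Yr => -[].
have N0 : 0 < #|V|%:R :> R by rewrite ltr0n.
have w0 := cell_weight_ge0 (zeta := zeta) (@grid_cell R M).
have w1 := cell_weight_sum1 (zeta := zeta) (@measurable_grid_cell R M).
have U := Phi_le_Pdisc q beta0 V0 alpha0 w0 w1 (@grid_point1 R M).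
apply: le_trans U _.
rewrite -mulrA -mulrDr ler_pM2l//.
by move: rM; rewrite rr ler_norml lerBrDr addrC lerBlDr => /andP[].
Qed.

(** Equal values of [x] would merge into a single atom of the empirical measure. After [jitter] the
    atoms are distinct, each has cell weight exactly 1 / (n + 1), and the displacement vanishes as
    [M] grows. *)
Lemma Pdisc_ge_rs_functional
  (Y : forall zeta : pr_itv R, rs_disorder q.+1 alpha (sval zeta)) L :
  (forall zeta r, rs_functional beta (Y zeta) = r%:E -> L <= r) ->
  forall n (x : 'I_n.+1 -> R), (forall v, -1 <= x v <= 1) ->
  L <= Pdisc q beta (fun=> n.+1%:R^-1) x alpha.
Proof.
move=> HL n x x1; apply: (@le_add_inv _ _ _ (C * 2)) => M.
pose y := jitter M x; have yI := jitter_inj (M := M) (x := x).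
(* Points that are not atoms are sent to [ord0], whose fibre therefore contains the complement of
   [D]. *)
pose e (z : R) : 'I_n.+1 := if [pick v | y v == z] is Some v then v else ord0.
have ey v : e (y v) = v.
  rewrite /e; by case: pickP => [u /eqP/yI |/(_ v)]; rewrite ?eqxx.
pose D : set R := \bigcup_v [set y v].
have mD : measurable D by apply: fin_bigcup_measurable.
have me i : measurable (e @^-1` [set i]).
  rewrite (_ : _ @^-1` _ = [set y i] `|` (if i == ord0 then ~` D else set0)).
    by apply: measurableU => //; case: ifP => // _; exact: measurableC.
  apply/seteqP; split=> z /=.
    rewrite /e; case: pickP => [v /eqP <- ->|nz <-]; first by left.
    by right; rewrite eqxx => -[v _ /= zv]; have := nz v; rewrite zv eqxx.
  case=> [->|]; first exact: ey.
  case: ifP => // /eqP -> nD; rewrite /e; case: pickP => // v /eqP vz.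
  by case: nD; exists v.
have D1 z : D z -> -1 <= z <= 1 by move=> [v _ /= ->]; exact: jitter1.
have empD (A : set R) : D `<=` A -> empirical y A = 1%E.
  move=> DA; rewrite -(empirical_setT y) !empiricalE; congr (_ * _)%:E.
  by apply: eq_bigr => v _; rewrite !indicE in_setT mem_set//; apply: DA; exists v.
have emp1 : empirical y `[-1, 1]%classic = 1%E.
  by apply: empD => z /D1; rewrite /= in_itv.
pose zeta : pr_itv R := exist _ (empirical y : probability R R) emp1.
have Dx z : D z -> `|z - x (e z)| <= 2 / M.+1%:R.
  by move=> [v _ /= ->]; rewrite ey; exact: jitter_dist.
have dl0 : 0 <= 2 / M.+1%:R :> R by rewrite divr_ge0// ler0n.
have [r rE rP] := rs_discretize (Y zeta) alpha0 beta0 me mD (empD D (@subset_refl _ D)) dl0 x1 D1 Dx.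
have wE : cell_weight (zeta := empirical y) e = fun=> n.+1%:R^-1.
  apply/funext => v; rewrite -[LHS]/(fine (empirical y (e @^-1` [set v]))) empiricalE /=.
  rewrite (bigD1 v)//= big1 => [|u uv].
    by rewrite indicE mem_set ?addr0 ?mulr1//=; exact: ey.
  rewrite indicE memNset//= => uE; move: uv; rewrite -uE ey eqxx.
  by [].
move: rP; rewrite wE -/C => rP.
apply: le_trans (HL _ _ rE) _; rewrite -mulrA -lerBlDl.
by move: rP; rewrite ler_norml => /andP[].
Qed.

End replica_symmetric.

(** Identifies [option 'I_n.+1], on which the new spin is added, with ['I_n.+2]. *)
Lemma Phi_bij (R : realType) (q : nat) (beta : R) (V V' : finType) (g : V -> V') M :
  bijective g -> Phi q beta V' M = Phi q beta V M.
Proof.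
move=> [g' gK g'K].
pose lift (H : {ffun V -> bool} -> R) (s : {ffun V' -> bool}) := H [ffun v => s (g v)].
pose relabel (a : {ffun 'I_q.+1 -> V * bool}) : {ffun 'I_q.+1 -> V' * bool} :=
  [ffun j => (g (a j).1, (a j).2)].
have relabel_bij : bijective relabel.
  exists (fun a : {ffun 'I_q.+1 -> V' * bool} => [ffun j => (g' (a j).1, (a j).2)]) => a; apply/ffunP => j; rewrite !ffunE /=.
    by rewrite gK; case: (a j).
  by rewrite g'K; case: (a j).
have -> : Phi q beta V' M = PE (jumps (@sat_rates R q V M)
    (fun a => lift (clause_energy beta a))) (@logZ R _) 0.
  apply: PE_ext => f s; rewrite !tstep_jumps.
  rewrite (reindex relabel) /=; last exact: onW_bij.
  have cE := bij_eq_card relabel_bij.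
  apply: eq_bigr => a _; rewrite /sat_rates cE; congr (_ * f (s + _)).
  apply/funext => t; rewrite /lift /clause_energy; congr (ln (1 - _ * _)).
  by apply: eq_bigr => j _; rewrite !ffunE.
rewrite (@PE_jumps_hom _ _ _ lift _ _ (fun a : {ffun 'I_q.+1 -> V * bool} =>
  (clause_energy beta a : {ffun V -> bool} -> R)))//.
apply: eq_PE => H /=; rewrite /logZ /partf /lift; congr ln.
rewrite (reindex (fun s : {ffun V -> bool} => [ffun v => s (g' v)])) /=.
  by apply: eq_bigr => s _; congr (expR (H _)); apply/ffunP => v; rewrite !ffunE gK.
apply: onW_bij; exists (fun s : {ffun V' -> bool} => [ffun v => s (g v)]) => s; apply/ffunP => v.
  by rewrite !ffunE gK.
by rewrite !ffunE g'K.
Qed.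

(** * The limit *)
Lemma eventually_small (R : realType) (a eps : R) : 0 < eps ->
  exists n0, forall n, (n0 <= n)%N -> a / n.+1%:R <= eps.
Proof.
move=> e0; exists (Num.truncn (a / eps)) => n nn.
have n1 : 0 < n.+1%:R :> R by rewrite ltr0n.
rewrite ler_pdivrMr// mulrC -ler_pdivrMr// ltW//.
by apply: lt_le_trans (truncnS_gt _) _; rewrite ler_nat ltnS.
Qed.

Lemma liminf_cesaro (R : realType) (u : nat -> R) (L : R) :
  (forall eps, 0 < eps -> exists n0, forall n, (n0 <= n)%N -> L - eps <= u n.+1 - u n) ->
  forall eps, 0 < eps -> exists n0, forall n, (n0 <= n)%N -> L - eps <= n.+1%:R^-1 * u n.
Proof.
move=> H eps e0; have e2 : 0 < eps / 2 by rewrite divr_gt0.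
have [n0 Hn0] := H _ e2; pose l := L - eps / 2.
(* The deficit accumulated up to [n0]; division by [n.+1] makes it negligible. *)
pose A := n0.+1%:R * l - u n0.
have [n1 Hn1] := eventually_small A e2.
exists (maxn n0 n1) => n; rewrite geq_max => /andP[n0n n1n].
have n0' : 0 < n.+1%:R :> R by rewrite ltr0n.
have : n.+1%:R * l - A <= u n.
  rewrite -(subnKC n0n) -addSn; elim: (n - n0)%N => [|k IH].
    by rewrite !addn0 /A subKr.
  have := Hn0 (n0 + k)%N (leq_addr _ _); rewrite -/l !addnS -natr1 mulrDl mul1r.
  by move: IH; lra.
move=> h2; have h1 := Hn1 n n1n; rewrite ler_pdivrMr// in h1.
rewrite mulrC ler_pdivlMr//; move: h1 h2; rewrite /l.
by move: n.+1%:R => N h1 h2; lra.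
Qed.

Section increments.
Context {R : realType} {q : nat} {alpha beta : R}.
Hypotheses (alpha0 : 0 < alpha) (beta0 : 0 < beta) (rho1 : rho q alpha beta < 1).

Lemma Phi_increment (L : R) :
  (forall n (x : 'I_n.+1 -> R), (forall v, -1 <= x v <= 1) ->
     L <= Pdisc q beta (fun=> n.+1%:R^-1) x alpha) ->
  forall eps, 0 < eps -> exists n0, forall n, (n0 <= n)%N ->
  L - eps <= Phi q beta 'I_n.+2 (alpha * n.+2%:R) - Phi q beta 'I_n.+1 (alpha * n.+1%:R).
Proof.
move=> HL eps e0.
set K := ass_const q alpha beta; set S := ass_shift q alpha beta.
have K0 : 0 < `|K| + 1 by rewrite ltr_wpDl.
have r0 : 0 < 1 - rho q alpha beta by rewrite subr_gt0.
(* Fixed before [n]: the covariance term is then at most [eps / 3], and the term with the inverse of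
   [k * n.+1%:R] vanishes as [n] grows. Adding 1 keeps the denominator positive. *)
pose k := eps / 3 * (1 - rho q alpha beta) / (`|K| + 1).
have e3 : 0 < eps / 3 by rewrite divr_gt0.
have k0 : 0 < k by rewrite !divr_gt0// mulr_gt0.
have [n1 H1] := eventually_small `|S| e3.
have [n2 H2] := eventually_small (`|K| / k) e3.
exists (maxn n1 n2) => n; rewrite geq_max => /andP[/H1 S1 /H2 S2].
have V0 : (0 < #|'I_n.+1|)%N by rewrite card_ord.
have := @ass_step R q alpha beta alpha0 beta0 'I_n.+1 V0 rho1 L k k0.
rewrite card_option !card_ord => /(_ (HL n)).
have -> : Phi q beta (option 'I_n.+1) (alpha * n.+2%:R) = Phi q beta 'I_n.+2 (alpha * n.+2%:R).
  apply: (@Phi_bij _ _ _ _ _ (unlift ord0)).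
  exists (fun o => if o is Some i then lift ord0 i else ord0) => [i|[i|]].
  - by case: unliftP.
  - exact: liftK.
  - exact: unlift_none.
apply: le_trans; rewrite -/K -/S.
have n0' : 0 < n.+1%:R :> R by rewrite ltr0n.
have A1 : S / (n.+1%:R + 1) <= eps / 3.
  apply: le_trans S1; apply: (@le_trans _ _ (`|S| / (n.+1%:R + 1))).
    by rewrite ler_wpM2r ?ler_norm// invr_ge0 addr_ge0// ltW.
  have n1' : 0 < n.+1%:R + 1 :> R by rewrite addr_gt0.
  by rewrite ler_wpM2l// lef_pV2 ?posrE// lerDl.
have A2 : K * (k / (1 - rho q alpha beta)) <= eps / 3.
  have -> : k / (1 - rho q alpha beta) = eps / 3 / (`|K| + 1).
    by rewrite /k mulrAC mulfK// gt_eqF.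
  rewrite mulrCA; apply: ler_piMr; first exact: ltW.
  rewrite ler_pdivrMr// mul1r.
  by rewrite (le_trans (ler_norm K))// lerDl.
have A3 : K * (k * n.+1%:R)^-1 <= eps / 3.
  apply: le_trans S2; rewrite invfM mulrA.
  by rewrite !ler_wpM2r ?ler_norm ?invr_ge0 ?(ltW k0) ?(ltW n0').
rewrite mulrDr; move: A1 A2 A3.
set a := S / _; set b := K * (k / _); set c := K / _.
by move: a b c => a b c *; lra.
Qed.

End increments.

Theorem theorem1 (R : realType) (p : nat) (alpha beta : R)
    (X : forall n : nat, sat_disorder p n alpha)
    (Y : forall zeta : pr_itv R, rs_disorder p alpha (sval zeta)) :
  (2 <= p)%N -> 0 < alpha -> 0 < beta ->
  Num.min (4 * beta) 1 * (p%:R - 1) * p%:R * alpha < 1 ->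
  free_energy beta (X n) @[n --> \oo] -->
    ereal_inf (range (fun zeta : pr_itv R => rs_functional beta (Y zeta))).
Proof.
case: p X Y => // q X Y _ alpha0 beta0 H.
have rho1 : rho q alpha beta < 1.
  apply: le_lt_trans H; rewrite /rho natrM -(natr1 q) addrK mulrA.
  have c0 := cbeta_ge0 beta0.
  rewrite ler_wpM2r ?(ltW alpha0)// [leRHS]mulrAC ler_wpM2r//.
  rewrite ler_wpM2r ?addr_ge0// le_min /cbeta.
  (* Convexity gives 1 - exp(- beta) <= beta, which is below 4 beta, and positivity of exp gives the
     bound by 1. *)
  have := expR_ge1Dx (- beta); have := expR_ge0 (- beta) => ? ?.
  by apply/andP; split; lra.
set u := fun n => Phi q beta 'I_n.+1 (alpha * n.+1%:R).
have FE n : free_energy beta (X n) = (n.+1%:R^-1 * u n)%:E by exact: free_energy_Phi.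
set inf := ereal_inf _.
have rsE (zeta : pr_itv R) : exists r, rs_functional beta (Y zeta) = r%:E.
  by have [r rE _] := rs_functional_grid alpha0 beta0 (Y zeta) 0 (svalP zeta); exists r.
have upper n : ((n.+1%:R^-1 * u n)%:E <= inf)%E.
  apply: le_ereal_inf_tmp => _ [zeta _ <-]; have [r rE] := rsE zeta; rewrite rE lee_fin.
  have V0 : (0 < #|'I_n.+1|)%N by rewrite card_ord.
  have := Phi_le_rs_functional alpha0 beta0 V0 (svalP zeta) rE; rewrite card_ord => U.
  by rewrite mulrC ler_pdivrMr ?ltr0n// mulrC.
have empty1 : empirical (fun _ : 'I_1 => (0 : R)) `[-1, 1]%classic = 1%E.
  rewrite empiricalE big_ord1 invr1 mul1r indicE mem_set// /= in_itv /=.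
  by rewrite lerN10 ler01.
(* The infimum is finite: [upper] at index 0 excludes minus infinity, and the value at the unit mass
   at 0 excludes plus infinity. *)
have [l lE] : exists l, inf = l%:E.
  pose zeta : pr_itv R := exist _ (empirical (fun _ : 'I_1 => (0 : R)) : probability R R) empty1.
  have [r rE] := rsE zeta.
  have : (inf <= r%:E)%E by apply: ereal_inf_lbound; exists zeta.
  by move: (upper 0%N); case: (inf) => [l| |]// _ _; exists l.
have lower (zeta : pr_itv R) r : rs_functional beta (Y zeta) = r%:E -> l <= r.
  by move=> rE; rewrite -lee_fin -lE; apply: ereal_inf_lbound; exists zeta.
have Hl := liminf_cesaro (Phi_increment alpha0 beta0 rho1 (Pdisc_ge_rs_functional alpha0 beta0 lower)).
rewrite lE (_ : (fun n => _) = EFin \o (fun n => n.+1%:R^-1 * u n)); last exact/funext.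
apply: cvg_EFin; first exact: nearW.
apply/cvgrPdist_le => e e0 /=.
have [n0 Hn0] := Hl e e0.
exists n0 => // n /= n0n; have := Hn0 n n0n; have := upper n.
by rewrite lE lee_fin => up lo; rewrite ger0_norm ?subr_ge0// lerBlDr -lerBlDl.
Qed.
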